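(* Assume that $\zeta_{n,1}\ge 1$ a.s. for all $n\ge 0$, that $L:=\prod_{n=0}^{\infty}\mathbb{E}\zeta_{n,1}<\infty$, that $\mathbb{E}\xi=0$, and that the family of increments $\{\xi_{i,k}\}$ is independent of the branching mechanism $\{\zeta_{n,j}\}$. Assume that the integrated tail distribution $F_I$ is subexponential. Then, for any $c>0$, as $x\to\infty$, $$\mathbb{P}\left(R_{\infty}^{\widehat{c}}>x\right)\sim H_{\infty}^{\widehat{c}}(x;\widehat{\mathcal{P}})\sim\frac{\mathbb{E}Z}{c}\,\overline{F}_I(x),$$ where $R_\infty^{\widehat c}=\sup_{\pi}\,(S(\pi)-c|\pi|)$ (supremum over all finite paths $\pi$ of the genealogical tree starting at the root) and $H_{\infty}^{\widehat{c}}(x;\widehat{\mathcal{P}})=\sum_{n=1}^{\infty}\mathbb{E}[Z_n]\,\overline{F}(x+cn)$.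
   Context: Branching process in varying environment: $Z_0=1$, $Z_{n+1}=\sum_{j=1}^{Z_n}\zeta_{n,j}$ for $n\ge 0$, where for each $n\ge0$ the variables $\{\zeta_{n,j}\}_{j}$ are i.i.d. non-negative integer-valued with common distribution $\mathcal{P}_n$, and the sequences for different $n\ge 0$ are mutually independent; $\widehat{\mathcal{P}}=(\mathcal{P}_0,\mathcal{P}_1,\ldots)$. Its genealogical tree $\mathcal{T}$ has $Z_n$ vertices in generation $n$, numbered $1,\dots,Z_n$, vertex $j$ of generation $n$ having $\zeta_{n,j}$ children in generation $n+1$. Under $\zeta_{n,1}\ge1$ a.s. and $L<\infty$, $Z_n$ converges a.s. and in $L_1$ to an a.s. finite limit denoted $Z$, with $\mathbb{E}Z=L$. Branching random walk: $\{\xi,\xi_{i,k}\}_{i,k\ge0}$ are i.i.d. with distribution function $F$; the edge of $\mathcal{T}$ ending at vertex $i$ of generation $k$ carries the increment $\xi_{i,k}$. For a finite path $\pi$ in $\mathcal{T}$ starting from the root, $|\pi|$ is its number of edges and $S(\pi)$ is the sum of the increments along its edges ($S(\emptyset)=0$ for the empty path). Notation: $\overline{F}(x)=1-F(x)$; $\overline{F}_I(x)=\min\{1,\int_x^\infty\overline{F}(y)\,dy\}$ is the tail of the distribution $F_I$; $f_1(x)\sim f_2(x)$ means $f_1(x)/f_2(x)\to1$ as $x\to\infty$. A distribution $G$ on $\mathbb{R}$ is long-tailed if $\overline G(x)>0$ for all $x>0$ and $\overline G(x+h)\sim\overline G(x)$ for every fixed $h>0$; it is subexponential ($G\in\mathcal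 S$) if it is long-tailed and $\overline{G*G}(x)\sim2\overline G(x)$. *)

(* Defs.v *)
From HB Require Import structures.
From mathcomp Require Import all_boot all_order all_algebra.
From mathcomp Require Import all_classical all_reals all_analysis.

Set Implicit Arguments.
Unset Strict Implicit.
Unset Printing Implicit Defensive.

Import Order.TTheory GRing.Theory Num.Theory.
Import numFieldNormedType.Exports.

Local Open Scope classical_set_scope.
Local Open Scope ring_scope.

(* [f(x) ~ g(x)] as x -> +oo.  Since [fine] sends infinite values to 0 and
   division by 0 yields 0, a ratio tending to 1 forces f and g to be finite
   and nonzero eventually. *)
Definition tail_equiv (R : realType) (f g : R -> \bar R) : Prop :=
  fine (f x) / fine (g x) @[x --> +oo%R] --> (1 : R).

Section subexponential.
Context (R : realType).
Implicit Type G : probability (measurableTypeR R) R.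

Definition tail G (x : R) : \bar R := G `]x, +oo[%classic.

Definition long_tailed G : Prop :=
  (forall x : R, 0 < x -> (0 < tail G x)%E) /\
  (forall h : R, 0 < h -> tail_equiv (fun x => tail G (x + h)) (tail G)).

Definition conv_tail G (x : R) : \bar R :=
  (G \x G)%E [set z : measurableTypeR R * measurableTypeR R | x < z.1 + z.2].

Definition subexponential G : Prop :=
  long_tailed G /\ tail_equiv (conv_tail G) (fun x => 2%:E * tail G x)%E.

(* In the next two definitions F is a distribution function on R. *)
Definition integrated_tail (F : R -> R) (x : R) : \bar R :=
  Order.min 1%E
    (\int[@lebesgue_measure R]_(y in `[x, +oo[%classic) (1 - F y)%:E)%E.

Definition integrated_tail_law (F : R -> R) G : Prop :=
  forall x : R, tail G x = integrated_tail F x.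

End subexponential.

Section independence.
Context d (T : measurableType d) (R : realType) (P : probability T R).

Definition mutually_independent (I : choiceType) (C : I -> set (set T)) : Prop :=
  forall (J : seq I) (A : I -> set T), uniq J ->
    (forall i, i \in J -> C i (A i)) ->
    P (\bigcap_(i in [set` J]) A i) = (\prod_(i <- J) P (A i))%E.

Definition independent_classes (C D : set (set T)) : Prop :=
  forall A B, C A -> D B -> P (A `&` B) = (P A * P B)%E.

Definition sigma_rv d' (U : measurableType d') (X : T -> U) : set (set T) :=
  preimage_set_system setT X measurable.

Definition sigma_family d' (U : measurableType d') (I : Type) (X : I -> T -> U) :
    set (set T) :=
  <<s \bigcup_(i in [set: I]) sigma_rv (X i) >>.

End independence.

(* Vertices of generation n are numbered 0, ..., Z_n - 1 (so the root is 0),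
   and vertex j of generation n has [z n j] children. *)
Section tree.
Variable z : nat -> nat -> nat.

Fixpoint gen_size (n : nat) : nat :=
  if n is m.+1 then \sum_(j < gen_size m) z m j else 1%N.

(* The children of successive vertices of generation n are numbered
   consecutively in generation n+1. *)
Definition is_child (n j i : nat) : bool :=
  (\sum_(l < j) z n l <= i < \sum_(l < j.+1) z n l)%N.

(* [v] lists the vertices of a finite path after the root: its k-th entry is a
   vertex of generation k+1, and its size is the number of edges. *)
Definition root_path (v : seq nat) : Prop :=
  forall k : nat, (k < size v)%N ->
    (nth 0%N v k < gen_size k.+1)%N /\
    is_child k (nth 0%N (0%N :: v) k) (nth 0%N v k).

End tree.

(* [y i k] is the increment on the edge ending at vertex i of generation k. *)
Definition path_sum (R : realType) (y : nat -> nat -> R) (v : seq nat) : R :=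
  \sum_(k < size v) y (nth 0%N v k) k.+1.

Section branching_random_walk.
Context d (T : measurableType d) (R : realType) (P : probability T R).
Variables (zeta : nat -> nat -> T -> nat) (xi : nat -> nat -> T -> R).

Definition bp_size (n : nat) (w : T) : R :=
  (gen_size (fun m j => zeta m j w) n)%:R.

(* Almost surely convergent in the intended setting; unspecified where the
   sequence of generation sizes diverges. *)
Definition bp_limit (w : T) : R := limn (fun n => bp_size n w).

Definition mean_product : \bar R :=
  limn (fun n => \prod_(0 <= k < n) 'E_P[fun w => (zeta k 0%N w)%:R])%E.

Definition brw_sup (c : R) (w : T) : \bar R :=
  ereal_sup [set (path_sum (fun i k => xi i k w) v - c * (size v)%:R)%:E
            | v in root_path (fun m j => zeta m j w)].

Definition H_infty (F : R -> R) (c x : R) : \bar R :=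
  (\sum_(1 <= n <oo) 'E_P[bp_size n] * (1 - F (x + c * n%:R))%:E)%E.

End branching_random_walk.

(* Main.v *)
Require Import Defs.
From HB Require Import structures.
From mathcomp Require Import all_boot all_order all_algebra.
From mathcomp Require Import all_classical all_reals all_analysis.
From mathcomp Require Import measurable_realfun.
From mathcomp Require Import ring lra zify.

Import Order.TTheory GRing.Theory Num.Theory.
Import numFieldNormedType.Exports.

Local Open Scope classical_set_scope.
Local Open Scope ring_scope.

Set Implicit Arguments.
Unset Strict Implicit.
Unset Printing Implicit Defensive.

(** Each of the three functions of [x] is asymptotic to [L / c * f x], where [f]
    is the tail of [FI] and [L], the limit of the mean generation sizes, is also
    the mean of the limit of the branching process.

    Along one ray of the tree [S(pi) - c |pi|] is a random walk of drift [-c].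
    Let [hit n x] be the probability that its maximum over [n] steps exceeds [x].
    Veraverbeke's theorem says that the limit of [hit n x] in [n] is asymptotic to
    [f x / c].  The proof below avoids ladder heights.  The maximum [M] over [n]
    steps has the law of a walk reflected at 0, and in one step of the latter the
    mean of [(M - x)^+] gains the mean flow upwards through level [x] and loses the
    mean flow downwards ([flow_balance]).  Since [M] is stochastically increasing
    in [n], downward flow cannot exceed upward flow.  For a large constant [K] and
    much larger [x], the former is at least about [hit n (x + K)] times the mean of
    [(c - xi)^+]; the latter is at most [hit n (x - K)] times the mean of
    [(xi - c)^+], plus the contribution of one jump from far below, which is about
    [f x] because the moderate part of a convolution of two subexponential tails is
    negligible ([middle_small], [hit_recursion]).  The two means differ by [c], so
    that asymptotically [c * hit n x <= f x], uniformly in [n] ([hit_upper]).  Read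
    in the other direction, at a step where the mean of [(M - x)^+] hardly
    increases any more, the balance gives the lower bound ([hit_lower]).

    For the tree, a path of at most [n] edges whose value exceeds [x] extends to
    generation [n], where there are [L] vertices in the mean at most; the union
    bound gives [P(R > x) <= L * sup_n (hit n x)] ([sup_prob_upper]).  Conversely,
    fix a generation [g] whose mean size is close to [L] and one ray through each of
    its vertices.  Beyond generation [g] these rays have no edge in common, so that
    they climb independently; their first [g] increments only shift the level by a
    constant, which a long tail does not notice; and two of them climb high with
    probability [O(f x ^ 2)].  Bonferroni's inequality then gives the matching lower
    bound ([sup_prob_lower]).  In both estimates independence allows the tree to be
    kept fixed while the increments vary ([freeze_tree]).

    The series [H_infty] is a sum of the tail of [xi] over a lattice of step [c],
    with weights increasing to [L]; [c] times the tail is compared with the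
    integral of the tail over one step ([overshoot_increment]).  Lastly, the
    generation sizes increase almost surely, so that monotone convergence
    identifies the mean of their limit ([expectation_bp_limit]). *)

(** * The reflected walk along one ray *)

Lemma integral_probability_cst d (T : measurableType d) (R : realType)
  (Q : probability T R) (r : \bar R) : (\int[Q]_x r = r)%E.
Proof.
rewrite integral_cst// [X in (_ * X)%E](_ : _ = 1%E) ?mule1//.
exact: probability_setT.
Qed.

Section walk_law.
Context (R : realType) (c : R) (nu : probability R R).

Definition reflect_step (z : R * R) : R := Num.max 0 (z.1 + z.2 - c).

Lemma measurable_reflect_step : measurable_fun setT reflect_step.
Proof.
apply: measurable_maxr; first exact: measurable_cst.
apply: measurable_funB; last exact: measurable_cst.
by apply: measurable_funD.
Qed.

HB.instance Definition _ := isMeasurableFun.Build _ _ _ _ reflect_step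
  measurable_reflect_step.

(** By Lindley's recursion this is also the law of the maximum of the first [n]
    partial sums, the empty one included, of independent steps [xi - c] with [xi]
    of law [nu]; see [reflected_law]. *)
Fixpoint walk_law (n : nat) : probability R R :=
  if n is m.+1 then distribution (walk_law m \x nu)%E reflect_step
  else \d_(0 : R).

Local Open Scope ereal_scope.

Lemma integral_walk_law0 (phi : R -> \bar R) : measurable_fun setT phi ->
  \int[walk_law 0]_m phi m = phi 0%R.
Proof. by move=> mphi; rewrite /= integral_dirac// diracT mul1e. Qed.

Lemma integral_walk_lawS n (phi : R -> \bar R) : measurable_fun setT phi ->
  (forall m, 0 <= phi m) ->
  \int[walk_law n.+1]_m phi m = \int[walk_law n \x nu]_z phi (reflect_step z).
Proof. by move=> mphi phi0; rewrite /= ge0_integral_distribution. Qed.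

(** The laws [walk_law n] are carried by the nonnegative reals; this is the form in
    which their support is used. *)
Lemma integral_walk_law_max n (phi : R -> \bar R) : measurable_fun setT phi ->
  (forall m, 0 <= phi m) ->
  \int[walk_law n]_m phi m = \int[walk_law n]_m phi (Num.max 0%R m).
Proof.
move=> mphi phi0.
have mmax : measurable_fun setT (fun m : R => Num.max 0%R m : R).
  by apply: measurable_maxr => //; exact: measurable_cst.
have mphi' : measurable_fun setT (fun m : R => phi (Num.max 0%R m)).
  exact: (measurableT_comp mphi mmax).
case: n => [|n].
  by rewrite !integral_walk_law0// maxxx.
rewrite !integral_walk_lawS//; apply: eq_integral => z _.
by rewrite /reflect_step maxA maxxx.
Qed.

(** The first step can only raise the walk above its starting point 0, which is the
    minimum; later steps are monotone in the position, so they preserve this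
    comparison of laws. *)
Lemma walk_law_nondecreasing n (phi : R -> \bar R) : measurable_fun setT phi ->
  (forall m, 0 <= phi m) -> {homo phi : x y / (x <= y)%R >-> x <= y} ->
  \int[walk_law n]_m phi m <= \int[walk_law n.+1]_m phi m.
Proof.
elim: n phi => [|n IH] phi mphi phi0 phiM.
  rewrite integral_walk_law0// integral_walk_lawS//.
  have -> : phi 0%R = \int[walk_law 0 \x nu]_z phi 0%R.
    by rewrite integral_probability_cst.
  apply: ge0_le_integral => //.
    exact: (measurableT_comp mphi measurable_reflect_step).
  by move=> z _; apply: phiM; rewrite /reflect_step le_max lexx.
rewrite integral_walk_lawS// [leRHS]integral_walk_lawS//.
have ms := measurableT_comp mphi measurable_reflect_step.
have H k : \int[walk_law k \x nu]_z phi (reflect_step z) =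
    \int[walk_law k]_m \int[nu]_t phi (reflect_step (m, t)).
  by rewrite fubini_tonelli1//.
rewrite !H; apply: IH.
- have := @measurable_fun_fubini_tonelli_F _ _ _ _ _ nu (phi \o reflect_step) ms; apply => z; exact: phi0.
- by move=> m; apply: integral_ge0.
- move=> x y xy; apply: ge0_le_integral => //.
  + exact: (measurableT_comp ms (pair1_measurable _)).
  + exact: (measurableT_comp ms (pair1_measurable _)).
  + move=> t _; apply: phiM; rewrite /reflect_step /=.
    by rewrite ge_max !le_max lexx /= !lerD2r xy orbT.
Qed.

End walk_law.

Ltac minmax_free t := lazymatch t with
  | context [@Order.max] => fail | context [@Order.min] => fail | _ => idtac end.

(* Innermost occurrences first: [leP] resolves min and max simultaneously. *)
Ltac minmax_lra := repeat match goal with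
  | |- context [@Order.max _ _ ?a ?b] =>
      minmax_free a; minmax_free b; case: (leP a b) => ?
  | |- context [@Order.min _ _ ?a ?b] =>
      minmax_free a; minmax_free b; case: (leP a b) => ? end; lra.

(** * Flows through a level *)

Section pointwise.
Variable R : realType.
Implicit Types (c m t x y K : R).

Definition jump_down c t : R := Num.max 0 (c - t).
Definition jump_up c t : R := Num.max 0 (t - c).

(** Lengths of the parts above level [x] of an upward jump and of a downward jump
    from [m], when the increment [t] moves the walk by [t - c]. *)
Definition up_flow c x m t : R := Num.max 0 (jump_up c t - Num.max 0 (x - m)).
Definition down_flow c x m t : R := Num.min (Num.max 0 (m - x)) (jump_down c t).

(** The reflection at 0 is invisible from above a level [x >= 0]. *)
Lemma flow_balance c x m t : 0 <= x -> 0 <= m ->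
  Num.max 0 (Num.max 0 (m + t - c) - x) + down_flow c x m t
  = Num.max 0 (m - x) + up_flow c x m t.
Proof.
move=> x0 m0; rewrite /down_flow /up_flow /jump_down /jump_up.
have -> : Num.max 0 (Num.max 0 (m + t - c) - x) = Num.max 0 (m + t - c - x).
  by minmax_lra.
have [tc|/ltW ct] := leP t c.
- rewrite (max_r (_ : 0 <= c - t)) ?subr_ge0// (max_l (_ : t - c <= 0)) ?subr_le0//.
  rewrite sub0r [X in _ = _ + X]max_l ?oppr_le0 ?le_max ?lexx//.
  by minmax_lra.
- rewrite (max_r (_ : 0 <= t - c)) ?subr_ge0// (max_l (_ : c - t <= 0)) ?subr_le0//.
  rewrite [X in _ + X = _]min_r ?le_max ?lexx//.
  by minmax_lra.
Qed.

Lemma excess_split x y m : x <= y ->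
  Num.max 0 (m - x) = Num.min (Num.max 0 (m - x)) (y - x) + Num.max 0 (m - y).
Proof.
by move=> xy; minmax_lra.
Qed.

Lemma down_flow_ge c x K m t : 0 <= K ->
  \1_`]x + K, +oo[ m * Num.min (jump_down c t) K <= down_flow c x m t.
Proof.
move=> K0; rewrite indicE; case: (boolP (m \in _)) => [|_].
  rewrite inE/= in_itv/= andbT /down_flow /jump_down => xm; rewrite mul1r.
  minmax_lra.
by rewrite mul0r /down_flow /jump_down le_min !le_max lexx.
Qed.

Lemma down_flow_le c x m t :
  down_flow c x m t <= \1_`]x, +oo[ m * jump_down c t.
Proof.
rewrite indicE; case: (boolP (m \in _)) => [_|].
  by rewrite mul1r ge_min lexx orbT.
rewrite notin_setE/= in_itv/= andbT => /negP; rewrite -leNgt => mx.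
rewrite mul0r /down_flow ge_min; apply/orP; left.
by rewrite ge_max lexx subr_le0.
Qed.

(** A walk below [x - K] crosses [x] only by a jump longer than its distance to
    [x]; a walk above [x - K] may use any upward jump. *)
Lemma up_flow_le c x K m t : 0 <= K ->
  up_flow c x m t <= \1_`]x - K, +oo[ m * jump_up c t
                     + jump_up (c + Num.max (x - m) K) t.
Proof.
move=> K0; rewrite indicE; case: (boolP (m \in _)) => [_|].
  rewrite mul1r /up_flow /jump_up.
  minmax_lra.
rewrite notin_setE/= in_itv/= andbT => /negP; rewrite -leNgt => mx.
rewrite mul0r add0r /up_flow /jump_up (max_r (_ : 0 <= x - m)); last lra.
rewrite (max_l (_ : K <= x - m)); last lra.
by minmax_lra.
Qed.

Lemma up_flow_ge c x m t : 0 <= x -> 0 <= m ->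
  \1_`]x, +oo[ m * jump_up c t + \1_`]-oo, x] m * jump_up (x + c) t
  <= up_flow c x m t.
Proof.
move=> x0 m0; rewrite !indicE /up_flow /jump_up.
have [xm|mx] := ltP x m.
  rewrite mem_set ?memNset/= ?in_itv/= ?andbT//; last by apply/negP; rewrite -ltNge.
  by rewrite mul1r mul0r addr0; minmax_lra.
rewrite memNset ?mem_set/= ?in_itv/= ?andbT//; last by apply/negP; rewrite -leNgt.
by rewrite mul1r mul0r add0r; minmax_lra.
Qed.

End pointwise.

Section walk_flows.
Context (R : realType) (c : R) (nu : probability R R).
Local Open Scope ereal_scope.

Implicit Types (x y : R) (n : nat).
Let lam n := walk_law c nu n.

Definition overshoot (r : R) : \bar R := \int[nu]_t (jump_up r t)%:E.

Lemma measurable_jump_up r : measurable_fun setT (jump_up r : R -> R).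
Proof.
by apply: measurable_maxr => //; apply: measurable_funB => //; exact: measurable_cst.
Qed.

Lemma measurable_jump_down r : measurable_fun setT (jump_down r : R -> R).
Proof.
by apply: measurable_maxr => //; apply: measurable_funB => //; exact: measurable_cst.
Qed.

Lemma jump_up_ge0 r (t : R) : (0 <= jump_up r t)%R.
Proof. by rewrite /jump_up le_max lexx. Qed.

Lemma jump_down_ge0 r (t : R) : (0 <= jump_down r t)%R.
Proof. by rewrite /jump_down le_max lexx. Qed.

Lemma integral_prod_indic (mu : probability R R) (A : set R) (g : R -> R) :
  measurable A -> measurable_fun setT g -> (forall t, 0 <= g t)%R ->
  \int[mu \x nu]_z (\1_A z.1 * g z.2)%:E = mu A * \int[nu]_t (g t)%:E.
Proof.
move=> mA mg g0.
have mI : measurable_fun setT (\1_A : R -> R) by exact: measurable_indic.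
rewrite fubini_tonelli1/=; last 2 first.
- apply/measurable_EFinP; apply: measurable_funM.
    exact: (measurableT_comp mI).
  exact: (measurableT_comp mg).
- by move=> z; rewrite lee_fin mulr_ge0// ?g0// indicE.
rewrite /fubini_F /=.
have E m : \int[nu]_t (\1_A m * g t)%:E = (\1_A m)%:E * \int[nu]_t (g t)%:E.
  under eq_integral do rewrite EFinM.
  rewrite ge0_integralZl//; first exact/measurable_EFinP.
  by move=> t _; rewrite lee_fin.
under eq_integral do rewrite E.
rewrite ge0_integralZr//.
- by rewrite integral_indic// setIT.
- exact/measurable_EFinP.
- by apply: integral_ge0 => t _; rewrite lee_fin.
Qed.

Lemma integral_walk_law_prod_max n (g : R * R -> \bar R) :
  measurable_fun setT g -> (forall z, 0 <= g z) ->
  \int[lam n \x nu]_z g z = \int[lam n \x nu]_z g (Num.max 0%R z.1, z.2).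
Proof.
move=> mg g0.
have mmax : measurable_fun setT (fun z : R * R => (Num.max 0%R z.1 : R, z.2)).
  apply: measurable_fun_pair; last exact: measurable_snd.
  by apply: measurable_maxr => //; exact: measurable_cst.
have mg' := measurableT_comp mg mmax.
rewrite fubini_tonelli1// fubini_tonelli1//=.
rewrite integral_walk_law_max//.
- by have := @measurable_fun_fubini_tonelli_F _ _ _ _ _ nu g mg; apply.
- by move=> m; apply: integral_ge0.
Qed.

Lemma le_integral_walk_law_prod n (f g : R * R -> R) :
  measurable_fun setT f -> measurable_fun setT g ->
  (forall z, 0 <= f z)%R -> (forall z, 0 <= g z)%R ->
  (forall m t, 0 <= m -> f (m, t) <= g (m, t))%R ->
  \int[lam n \x nu]_z (f z)%:E <= \int[lam n \x nu]_z (g z)%:E.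
Proof.
move=> mf mg f0 g0 fg.
have mmax : measurable_fun setT (fun z : R * R => (Num.max 0%R z.1 : R, z.2)).
  apply: measurable_fun_pair; last exact: measurable_snd.
  by apply: measurable_maxr => //; exact: measurable_cst.
rewrite integral_walk_law_prod_max//; last exact/measurable_EFinP.
rewrite [leRHS]integral_walk_law_prod_max//; last exact/measurable_EFinP.
apply: ge0_le_integral => //.
- by move=> z _; rewrite lee_fin.
- apply/measurable_EFinP; exact: (measurableT_comp mf mmax).
- apply/measurable_EFinP; exact: (measurableT_comp mg mmax).
- by move=> z _; rewrite lee_fin fg// le_max lexx.
Qed.

Lemma eq_integral_walk_law_prod n (f g : R * R -> R) :
  measurable_fun setT f -> measurable_fun setT g ->
  (forall z, 0 <= f z)%R -> (forall z, 0 <= g z)%R ->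
  (forall m t, 0 <= m -> f (m, t) = g (m, t))%R ->
  \int[lam n \x nu]_z (f z)%:E = \int[lam n \x nu]_z (g z)%:E.
Proof.
move=> mf mg f0 g0 fg; apply/eqP; rewrite eq_le; apply/andP; split.
  by apply: le_integral_walk_law_prod => // m t m0; rewrite fg.
by apply: le_integral_walk_law_prod => // m t m0; rewrite fg.
Qed.

Definition mean_up_flow n x := \int[lam n \x nu]_z (up_flow c x z.1 z.2)%:E.
Definition mean_down_flow n x := \int[lam n \x nu]_z (down_flow c x z.1 z.2)%:E.
Definition excess n x := \int[lam n]_m (Num.max 0%R (m - x)%R)%:E.

Let mfst := @measurable_fst _ _ R R.
Let msnd := @measurable_snd _ _ R R.

Lemma measurable_up_flow x :
  measurable_fun setT (fun z : R * R => up_flow c x z.1 z.2 : R).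
Proof.
apply: measurable_maxr => //; apply: measurable_funB.
  exact: (measurableT_comp (measurable_jump_up c) msnd).
apply: measurable_maxr => //; apply: measurable_funB => //; exact: measurable_cst.
Qed.

Lemma measurable_down_flow x :
  measurable_fun setT (fun z : R * R => down_flow c x z.1 z.2 : R).
Proof.
apply: measurable_minr.
  apply: measurable_maxr => //; apply: measurable_funB => //; exact: measurable_cst.
exact: (measurableT_comp (measurable_jump_down c) msnd).
Qed.

Lemma measurable_pos_part x :
  measurable_fun setT (fun m : R => Num.max 0%R (m - x)%R : R).
Proof.
by apply: measurable_maxr => //; apply: measurable_funB => //; exact: measurable_cst.
Qed.

Lemma up_flow_ge0 x (m t : R) : (0 <= up_flow c x m t)%R.
Proof. by rewrite /up_flow le_max lexx. Qed.

Lemma down_flow_ge0 x (m t : R) : (0 <= down_flow c x m t)%R.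
Proof. by rewrite /down_flow le_min jump_down_ge0 le_max lexx. Qed.

Lemma pos_part_ge0 (x m : R) : (0 <= Num.max 0 (m - x))%R.
Proof. by rewrite le_max lexx. Qed.

Hint Resolve jump_up_ge0 jump_down_ge0 up_flow_ge0 down_flow_ge0 pos_part_ge0 : core.

Lemma excess_fst n x :
  excess n x = \int[lam n \x nu]_z (Num.max 0%R (z.1 - x)%R)%:E.
Proof.
rewrite fubini_tonelli1//=; last 2 first.
- by apply/measurable_EFinP; exact: (measurableT_comp (measurable_pos_part x) mfst).
- by move=> z; rewrite lee_fin.
apply: eq_integral => m _.
rewrite /fubini_F /= integral_cst// [X in _ * X](_ : _ = 1) ?mule1//.
exact: (probability_setT nu).
Qed.

Lemma flow_balance_integral n x : (0 <= x)%R ->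
  excess n.+1 x + mean_down_flow n x = excess n x + mean_up_flow n x.
Proof.
move=> x0; rewrite {1}/excess /lam integral_walk_lawS//; last 2 first.
- apply/measurable_EFinP; exact: measurable_pos_part.
- by move=> m; rewrite lee_fin.
have mstep : measurable_fun setT
    (fun z : R * R => Num.max 0%R (reflect_step c z - x)%R : R).
  exact: (measurableT_comp (measurable_pos_part x) (measurable_reflect_step c)).
rewrite excess_fst /mean_down_flow /mean_up_flow -ge0_integralD//; last 4 first.
- by move=> z _; rewrite lee_fin.
- exact/measurable_EFinP.
- by move=> z _; rewrite lee_fin.
- by apply/measurable_EFinP; exact: measurable_down_flow.
rewrite -ge0_integralD//; last 4 first.
- by move=> z _; rewrite lee_fin.
- by apply/measurable_EFinP; exact: (measurableT_comp (measurable_pos_part x) mfst).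
- by move=> z _; rewrite lee_fin.
- by apply/measurable_EFinP; exact: measurable_up_flow.
apply: (@eq_integral_walk_law_prod n
   (fun z => Num.max 0 (reflect_step c z - x) + down_flow c x z.1 z.2)%R
   (fun z => Num.max 0 (z.1 - x) + up_flow c x z.1 z.2)%R) => //.
- exact: (measurable_funD mstep (measurable_down_flow x)).
- apply: (measurable_funD _ (measurable_up_flow x)).
  exact: (measurableT_comp (measurable_pos_part x) mfst).
- by move=> z; rewrite addr_ge0.
- by move=> z; rewrite addr_ge0.
- by move=> m t m0; exact: flow_balance.
Qed.

Lemma excess_nondecreasing n x : excess n x <= excess n.+1 x.
Proof.
apply: walk_law_nondecreasing => //.
- by apply/measurable_EFinP; exact: measurable_pos_part.
- by move=> m; rewrite lee_fin.
- by move=> u v uv; rewrite lee_fin ge_max !le_max lexx/= lerD2r uv orbT.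
Qed.

End walk_flows.

Section walk_moments.
Context (R : realType) (c : R) (nu : probability R R).
Hypothesis nu_integrable : nu.-integrable setT (fun t : R => t%:E).
Hypothesis nu_mean0 : (\int[nu]_t t%:E = 0)%E.
Implicit Types (x y r K : R) (n : nat).
Hint Resolve jump_up_ge0 jump_down_ge0 up_flow_ge0 down_flow_ge0 pos_part_ge0 : core.

Local Open Scope ereal_scope.

Lemma integrable_jump_up r : nu.-integrable setT (fun t => (jump_up r t)%:E).
Proof.
have h : nu.-integrable setT (fun t : R => (t - r)%:E).
  under eq_fun do rewrite EFinB.
  by apply: integrableB => //; apply: finite_measure_integrable_cst.
apply: le_integrable h => //; first by apply/measurable_EFinP; exact: measurable_jump_up.
move=> t _; rewrite !abse_EFin lee_fin ger0_norm ?jump_up_ge0// /jump_up ge_max normr_ge0.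
exact: ler_norm.
Qed.

Lemma integrable_jump_down r : nu.-integrable setT (fun t => (jump_down r t)%:E).
Proof.
have h : nu.-integrable setT (fun t : R => (t - r)%:E).
  under eq_fun do rewrite EFinB.
  by apply: integrableB => //; apply: finite_measure_integrable_cst.
apply: le_integrable h => //; first by apply/measurable_EFinP; exact: measurable_jump_down.
move=> t _; rewrite !abse_EFin lee_fin ger0_norm ?jump_down_ge0// /jump_down ge_max normr_ge0.
by rewrite distrC; exact: ler_norm.
Qed.

Lemma overshoot_fin r : overshoot nu r \is a fin_num.
Proof. by apply: integrable_fin_num => //; exact: integrable_jump_up. Qed.

Lemma overshoot_ge0 r : 0 <= overshoot nu r.
Proof. by apply: integral_ge0 => t _; rewrite lee_fin ?jump_up_ge0 ?jump_down_ge0. Qed.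

(** The drift of the walk is [- c]. *)
Lemma integral_jump_down : \int[nu]_t (jump_down c t)%:E = overshoot nu c + c%:E.
Proof.
have -> : c%:E = \int[nu]_t c%:E by rewrite integral_probability_cst.
have iu := integrable_jump_up c; have id := integrable_jump_down c.
have ic : nu.-integrable setT (fun=> c%:E) by exact: finite_measure_integrable_cst.
rewrite -[LHS]adde0 -nu_mean0 /overshoot -integralD// -integralD//.
apply: eq_integral => t _; rewrite -!EFinD; congr (_%:E).
by rewrite /jump_up /jump_down; minmax_lra.
Qed.

Lemma overshoot_nonincreasing r s : (r <= s)%R -> overshoot nu s <= overshoot nu r.
Proof.
move=> rs; apply: ge0_le_integral => //.
- by move=> t _; rewrite lee_fin ?jump_up_ge0 ?jump_down_ge0.
- by apply/measurable_EFinP; exact: measurable_jump_up.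
- by apply/measurable_EFinP; exact: measurable_jump_up.
- by move=> t _; rewrite lee_fin /jump_up ge_max !le_max lexx/= lerB// orbT.
Qed.

Definition down_trunc K := \int[nu]_t (Num.min (jump_down c t) K)%:E.

Lemma measurable_down_trunc K :
  measurable_fun setT (fun t : R => Num.min (jump_down c t) K).
Proof.
by apply: measurable_minr; [exact: measurable_jump_down|exact: measurable_cst].
Qed.

Lemma down_trunc_le K : (0 <= K)%R -> down_trunc K <= overshoot nu c + c%:E.
Proof.
move=> K0; rewrite -integral_jump_down; apply: ge0_le_integral => //.
- by move=> t _; rewrite lee_fin le_min jump_down_ge0.
- by apply/measurable_EFinP; exact: measurable_down_trunc.
- by apply/measurable_EFinP; exact: measurable_jump_down.
- by move=> t _; rewrite lee_fin ge_min lexx.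
Qed.

Lemma down_trunc_ge0 K : (0 <= K)%R -> 0 <= down_trunc K.
Proof.
by move=> K0; apply: integral_ge0 => t _; rewrite lee_fin le_min jump_down_ge0.
Qed.

Lemma down_trunc_fin K : (0 <= K)%R -> down_trunc K \is a fin_num.
Proof.
move=> K0; rewrite ge0_fin_numE ?down_trunc_ge0//.
by rewrite (le_lt_trans (down_trunc_le K0))// ltey_eq fin_numD overshoot_fin.
Qed.

(** Almost all of the downward drift comes from jumps of bounded length. *)
Lemma down_trunc_cvg (e : R) : (0 < e)%R ->
  exists2 K0 : R, (0 <= K0)%R &
  forall K, (K0 <= K)%R -> (fine (overshoot nu c) + c - e <= fine (down_trunc K))%R.
Proof.
move=> e0.
pose g (k : nat) (t : R) := (Num.min (jump_down c t) k%:R)%:E.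
have mg k : measurable_fun setT (g k).
  by apply/measurable_EFinP; exact: measurable_down_trunc.
have cv : (\int[nu]_t g k t) @[k --> \oo] --> \int[nu]_t (limn (g^~ t)).
  apply: cvg_monotone_convergence => //.
  - by move=> k t _; rewrite lee_fin le_min jump_down_ge0 ler0n.
  - move=> t _ a b ab; rewrite lee_fin le_min !ge_min lexx/=.
    by rewrite ler_nat ab orbT.
have E : \int[nu]_t (limn (g^~ t)) = overshoot nu c + c%:E.
  rewrite -integral_jump_down; apply: eq_integral => t _; apply/cvg_lim => //.
  apply: (cvg_near_cst); near=> k; rewrite /g min_l//.
  near: k; exact: nbhs_infty_ger.
rewrite E in cv.
pose I (k : nat) := \int[nu]_t g k t.
have /fine_cvgP[_ cv'] : I k @[k --> \oo] --> (fine (overshoot nu c) + c)%:E.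
  by rewrite EFinD fineK ?overshoot_fin.
have [N _ H] : \forall k \near \oo,
    (fine (overshoot nu c) + c - e <= (fine \o I) k)%R.
  by apply: (cvgr_ge _ cv'); rewrite ltrBlDr ltrDl.
exists N%:R => // K NK; apply: le_trans (H N (leqnn N)) _ => /=.
rewrite fine_le ?down_trunc_fin//.
- by rewrite (le_trans _ NK).
- apply: ge0_le_integral => //.
  + by move=> t _; rewrite lee_fin le_min jump_down_ge0 ler0n.
  + by apply/measurable_EFinP; exact: measurable_down_trunc.
  + by move=> t _; rewrite lee_fin le_min !ge_min lexx/= NK orbT.
Unshelve. all: end_near. Qed.

End walk_moments.

Section level_inequalities.
Context (R : realType) (c : R) (nu : probability R R).
Hypothesis nu_integrable : nu.-integrable setT (fun t : R => t%:E).
Hypothesis nu_mean0 : (\int[nu]_t t%:E = 0)%E.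
Implicit Types (x y r K : R) (n : nat).
Notation lam n := (walk_law c nu n).
Notation Phi := (overshoot nu).

Local Open Scope ereal_scope.

Definition hitE n x := lam n `]x, +oo[%classic.
Definition hit n x : R := fine (hitE n x).
(** Mean upward flow through [x] from positions below [x - K]; the positions above
    [x - K] add a further term that only makes it larger. *)
Definition far_overshoot n K x := \int[lam n]_m Phi (c + Num.max (x - m) K)%R.

(** The part of the mean excess over [x] that lies below [y]. *)
Definition capped n x y := \int[lam n]_m (Num.min (Num.max 0 (m - x)) (y - x))%R%:E.

Lemma hitE_fin n x : hitE n x = (hit n x)%:E.
Proof. by rewrite /hit fineK// fin_num_measure. Qed.

Lemma hit_ge0 n x : (0 <= hit n x)%R.
Proof. by rewrite fine_ge0. Qed.

Lemma hit_le1 n x : (hit n x <= 1)%R.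
Proof. by rewrite -lee_fin -hitE_fin; exact: probability_le1. Qed.

Lemma hit_nondecreasing n x : (hit n x <= hit n.+1 x)%R.
Proof.
rewrite -lee_fin -!hitE_fin /hitE.
have E k : lam k `]x, +oo[%classic = \int[lam k]_m (\1_(`]x, +oo[%classic : set R) m)%:E.
  by rewrite integral_indic// setIT.
rewrite !E; apply: walk_law_nondecreasing => //.
- by apply/measurable_EFinP; exact: measurable_indic.
- move=> u v uv; rewrite lee_fin !indicE !mem_setE !in_itv/= !andbT.
  by case: ltP => // xu; rewrite (lt_le_trans xu uv).
Qed.

Let mfst := @measurable_fst _ _ R R.
Let msnd := @measurable_snd _ _ R R.

Lemma measurable_indic_mul (A : set R) (g : R -> R) : measurable A ->
  measurable_fun setT g ->
  measurable_fun setT (fun z : R * R => \1_A z.1 * g z.2 : R)%R.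
Proof.
move=> mA mg; apply: measurable_funM; last exact: (measurableT_comp mg msnd).
exact: (measurableT_comp (measurable_indic mA) mfst).
Qed.

Let mIup (A : set R) r : measurable A ->
  measurable_fun setT (fun z : R * R => \1_A z.1 * jump_up r z.2 : R)%R.
Proof. by move=> mA; apply: measurable_indic_mul => //; exact: measurable_jump_up. Qed.

Lemma indic_mul_ge0 (A : set R) (g : R -> R) (z : R * R) :
  (forall t, 0 <= g t)%R -> (0 <= \1_A z.1 * g z.2)%R.
Proof. by move=> g0; rewrite mulr_ge0// indicE. Qed.

Lemma mean_down_flow_ge n x K : (0 <= K)%R ->
  hitE n (x + K) * down_trunc c nu K <= mean_down_flow c nu n x.
Proof.
move=> K0; rewrite -integral_prod_indic//; last 2 first.
- exact: measurable_down_trunc.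
- by move=> t; rewrite le_min jump_down_ge0.
apply: (@le_integral_walk_law_prod _ c nu n (fun z => \1_`]x + K, +oo[ z.1 *
    Num.min (jump_down c z.2) K)%R (fun z => down_flow c x z.1 z.2)).
- apply: (@measurable_indic_mul _ (fun t => Num.min (jump_down c t) K)) => //.
  exact: measurable_down_trunc.
- exact: measurable_down_flow.
- move=> z; apply: (@indic_mul_ge0 _ (fun t => Num.min (jump_down c t) K)) => t.
  by rewrite le_min jump_down_ge0.
- by move=> z; exact: down_flow_ge0.
- by move=> m t _; exact: down_flow_ge.
Qed.

Lemma mean_down_flow_le n x : mean_down_flow c nu n x <= hitE n x * (Phi c + c%:E).
Proof.
rewrite -(integral_jump_down c nu_integrable nu_mean0) -integral_prod_indic//.
- apply: (@le_integral_walk_law_prod _ c nu n (fun z => down_flow c x z.1 z.2)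
    (fun z => \1_`]x, +oo[ z.1 * jump_down c z.2)%R).
  + exact: measurable_down_flow.
  + by apply: measurable_indic_mul => //; exact: measurable_jump_down.
  + by move=> z; exact: down_flow_ge0.
  + by move=> z; apply: indic_mul_ge0 => t; exact: jump_down_ge0.
  + by move=> m t _; exact: down_flow_le.
- exact: measurable_jump_down.
- by move=> t; exact: jump_down_ge0.
Qed.

Let mfar K x : measurable_fun setT
  (fun z : R * R => jump_up (c + Num.max (x - z.1) K) z.2 : R)%R.
Proof.
apply: measurable_maxr => //; apply: measurable_funB => //.
apply: measurable_funD; first exact: measurable_cst.
apply: measurable_maxr; last exact: measurable_cst.
by apply: measurable_funB => //; exact: measurable_cst.
Qed.

Lemma mean_up_flow_le n x K : (0 <= K)%R ->
  mean_up_flow c nu n x <= hitE n (x - K) * Phi c + far_overshoot n K x.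
Proof.
move=> K0; rewrite -integral_prod_indic//; last 2 first.
- exact: measurable_jump_up.
- by move=> t; exact: jump_up_ge0.
have -> : far_overshoot n K x = \int[lam n \x nu]_z
    (jump_up (c + Num.max (x - z.1) K) z.2)%R%:E.
  rewrite fubini_tonelli1//.
  - exact/measurable_EFinP.
  - by move=> z; rewrite lee_fin jump_up_ge0.
rewrite -ge0_integralD//; last 4 first.
- by move=> z _; rewrite lee_fin; apply: indic_mul_ge0 => t; exact: jump_up_ge0.
- by apply/measurable_EFinP; exact: mIup.
- by move=> z _; rewrite lee_fin jump_up_ge0.
- exact/measurable_EFinP.
apply: (@le_integral_walk_law_prod _ c nu n (fun z => up_flow c x z.1 z.2)
   (fun z => \1_`]x - K, +oo[ z.1 * jump_up c z.2
             + jump_up (c + Num.max (x - z.1) K) z.2)%R).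
- exact: measurable_up_flow.
- apply: measurable_funD => //.
  by exact: mIup.
- by move=> z; exact: up_flow_ge0.
- move=> z; rewrite addr_ge0 ?jump_up_ge0//.
  by apply: indic_mul_ge0 => t; exact: jump_up_ge0.
- by move=> m t _; exact: up_flow_le.
Qed.

Lemma mean_up_flow_ge n x : (0 <= x)%R ->
  hitE n x * Phi c + lam n `]-oo, x]%classic * Phi (x + c) <= mean_up_flow c nu n x.
Proof.
have mu r := measurable_jump_up r; have u0 := @jump_up_ge0 R.
move=> x0; rewrite -integral_prod_indic// -integral_prod_indic//.
rewrite -ge0_integralD//; last 4 first.
- by move=> z _; rewrite lee_fin; apply: indic_mul_ge0 => t; exact: jump_up_ge0.
- by apply/measurable_EFinP; exact: mIup.
- by move=> z _; rewrite lee_fin; apply: indic_mul_ge0 => t; exact: jump_up_ge0.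
- by apply/measurable_EFinP; exact: mIup.
apply: (@le_integral_walk_law_prod _ c nu n
   (fun z => \1_`]x, +oo[ z.1 * jump_up c z.2
             + \1_`]-oo, x] z.1 * jump_up (x + c) z.2)%R
   (fun z => up_flow c x z.1 z.2)).
- by apply: measurable_funD; exact: mIup.
- exact: measurable_up_flow.
- by move=> z; rewrite addr_ge0//; apply: indic_mul_ge0 => t; exact: jump_up_ge0.
- by move=> z; exact: up_flow_ge0.
- by move=> m t m0; exact: up_flow_ge.
Qed.

Lemma mean_up_flow_fin n x : mean_up_flow c nu n x \is a fin_num.
Proof.
rewrite ge0_fin_numE; last first.
  by apply: integral_ge0 => z _; rewrite lee_fin up_flow_ge0.
apply: (@le_lt_trans _ _ (lam n setT * Phi c)).
  rewrite -integral_prod_indic//; last 2 first.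
  - exact: measurable_jump_up.
  - by move=> t; exact: jump_up_ge0.
  apply: (@le_integral_walk_law_prod _ c nu n (fun z => up_flow c x z.1 z.2)
    (fun z => \1_setT z.1 * jump_up c z.2)%R).
  - exact: measurable_up_flow.
  - by exact: mIup.
  - by move=> z; exact: up_flow_ge0.
  - by move=> z; apply: indic_mul_ge0 => t; exact: jump_up_ge0.
  - move=> m t _; rewrite indicE in_setT mul1r /up_flow ge_max jump_up_ge0/=.
    by rewrite gerBl le_max lexx.
rewrite ltey_eq fin_numM// ?overshoot_fin//.
exact: fin_num_measure.
Qed.

Lemma mean_down_flow_fin n x : mean_down_flow c nu n x \is a fin_num.
Proof.
rewrite ge0_fin_numE; last first.
  by apply: integral_ge0 => z _; rewrite lee_fin down_flow_ge0.
by rewrite (le_lt_trans (mean_down_flow_le n x))// ltey_eq hitE_fin fin_numM// fin_numD overshoot_fin.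
Qed.

Lemma excess_fin n x : (0 <= x)%R -> excess c nu n x \is a fin_num.
Proof.
move=> x0; elim: n => [|n IH].
  rewrite /excess integral_walk_law0//.
  by apply/measurable_EFinP; exact: measurable_pos_part.
have : excess c nu n.+1 x + mean_down_flow c nu n x \is a fin_num.
  by rewrite flow_balance_integral// fin_numD IH mean_up_flow_fin.
by rewrite fin_numD => /andP[].
Qed.

Lemma flow_balance_fine n x : (0 <= x)%R ->
  (fine (excess c nu n.+1 x) + fine (mean_down_flow c nu n x)
   = fine (excess c nu n x) + fine (mean_up_flow c nu n x))%R.
Proof.
move=> x0; have /(congr1 fine) := flow_balance_integral c nu n x0.
rewrite fineD ?excess_fin ?mean_down_flow_fin// => ->.
by rewrite fineD ?excess_fin ?mean_up_flow_fin//.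
Qed.

Lemma far_overshoot_fin n x K : (0 <= K)%R -> far_overshoot n K x \is a fin_num.
Proof.
move=> K0.
have p0 : forall m : R, 0 <= Phi (c + Num.max (x - m) K)%R.
  by move=> m; exact: overshoot_ge0.
rewrite ge0_fin_numE; last by apply: integral_ge0 => m _.
apply: (@le_lt_trans _ _ (\int[lam n]_m Phi c)).
  apply: ge0_le_integral => //.
  - have /measurable_EFinP := mfar K x.
    move/measurable_fun_fubini_tonelli_F; apply => z.
    by rewrite lee_fin jump_up_ge0.
  - move=> m _; apply: overshoot_nonincreasing => //.
    by rewrite lerDl le_max K0 orbT.
by rewrite integral_probability_cst ltey_eq overshoot_fin.
Qed.

(** The mean excess over [x] does not decrease with [n], so that the downward flow
    is at most the upward flow. *)
Lemma hit_upper_recursion n x K : (0 <= x)%R -> (0 <= K)%R ->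
  (hit n (x + K) * fine (down_trunc c nu K)
   <= hit n (x - K) * fine (Phi c) + fine (far_overshoot n K x))%R.
Proof.
move=> x0 K0; rewrite -lee_fin EFinD !EFinM -!hitE_fin.
rewrite !fineK ?down_trunc_fin ?overshoot_fin ?far_overshoot_fin//.
apply: le_trans (mean_down_flow_ge n x K0) _; apply: le_trans (mean_up_flow_le n x K0).
rewrite -[leLHS]fineK ?mean_down_flow_fin// -[leRHS]fineK ?mean_up_flow_fin// lee_fin.
rewrite -(lerD2l (fine (excess c nu n.+1 x))) flow_balance_fine// lerD2r.
by rewrite fine_le ?excess_fin//; exact: excess_nondecreasing.
Qed.

(** Flows starting above [x] differ by at most the drift [c]; the upward
    flow from a position between 0 and [x] is at least the one from 0, which is due
    to the jumps beyond [x + c]. *)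
Lemma hit_lower_recursion n x : (0 <= x)%R ->
  ((1 - hit n x) * fine (Phi (x + c)%R)
   <= c * hit n x + (fine (excess c nu n.+1 x) - fine (excess c nu n x)))%R.
Proof.
move=> x0; have := flow_balance_fine n x0.
have := mean_up_flow_ge n x0; have := mean_down_flow_le n x.
have -> : lam n `]-oo, x]%classic = (1 - hit n x)%:E.
  rewrite -setCitvr probability_setC//.
  by rewrite EFinB -hitE_fin.
rewrite hitE_fin -(fineK (overshoot_fin nu_integrable c)).
rewrite -(fineK (overshoot_fin nu_integrable (x + c))).
rewrite -(fineK (mean_down_flow_fin n x)) -(fineK (mean_up_flow_fin n x)).
rewrite -EFinD -!EFinM -EFinD !lee_fin.
by move=> *; lra.
Qed.

Let mcap x y : measurable_fun setT
  (fun m : R => Num.min (Num.max 0 (m - x)) (y - x) : R)%R.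
Proof. by apply: measurable_minr => //; exact: measurable_pos_part. Qed.

Lemma capped_ge0 n x y : (x <= y)%R -> 0 <= capped n x y.
Proof.
move=> xy; apply: integral_ge0 => m _.
by rewrite lee_fin le_min pos_part_ge0 subr_ge0.
Qed.

Lemma capped_le n x y : (x <= y)%R -> capped n x y <= (y - x)%:E.
Proof.
move=> xy; rewrite -(integral_probability_cst (lam n) (y - x)%:E).
apply: ge0_le_integral => //.
- by move=> m _; rewrite lee_fin le_min pos_part_ge0 subr_ge0.
- exact/measurable_EFinP.
- by move=> m _; rewrite lee_fin ge_min lexx orbT.
Qed.

Lemma capped_fin n x y : (x <= y)%R -> capped n x y \is a fin_num.
Proof.
move=> xy; rewrite ge0_fin_numE ?capped_ge0//.
exact: le_lt_trans (capped_le n xy) (ltry _).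
Qed.

Lemma capped_nondecreasing n x y : (x <= y)%R -> capped n x y <= capped n.+1 x y.
Proof.
move=> xy; apply: walk_law_nondecreasing => //.
- exact/measurable_EFinP.
- by move=> m; rewrite lee_fin le_min pos_part_ge0 subr_ge0.
- by move=> u v uv; rewrite lee_fin; minmax_lra.
Qed.

Lemma excess_capped n x y : (x <= y)%R ->
  excess c nu n x = capped n x y + excess c nu n y.
Proof.
move=> xy; rewrite -ge0_integralD//.
- by apply: eq_integral => m _; rewrite -EFinD; congr (_%:E); exact: excess_split.
- by move=> m _; rewrite lee_fin le_min pos_part_ge0 subr_ge0.
- exact/measurable_EFinP.
- by move=> m _; rewrite lee_fin pos_part_ge0.
- by apply/measurable_EFinP; exact: measurable_pos_part.
Qed.

(** Above a remote level [y] the increment of the excess is controlled by the upward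
    flow through [y] alone; below [y] the excess is bounded. *)
Lemma excess_increment_le n x y K : (0 <= x)%R -> (x <= y)%R -> (0 <= K)%R ->
  (fine (excess c nu n.+1 x) - fine (excess c nu n x)
   <= hit n (y - K) * fine (Phi c) + fine (far_overshoot n K y)
      + (fine (capped n.+1 x y) - fine (capped n x y)))%R.
Proof.
move=> x0 xy K0; have y0 : (0 <= y)%R by exact: le_trans xy.
rewrite !(excess_capped _ xy).
rewrite (fineD (capped_fin n.+1 xy) (excess_fin n.+1 y0)).
rewrite (fineD (capped_fin n xy) (excess_fin n y0)).
have := mean_up_flow_le n y K0; have := flow_balance_fine n y0.
have d0 : (0 <= fine (mean_down_flow c nu n y))%R.
  by apply: fine_ge0; apply: integral_ge0 => z _; rewrite lee_fin down_flow_ge0.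
rewrite hitE_fin -(fineK (overshoot_fin nu_integrable c)).
rewrite -(fineK (far_overshoot_fin n y K0)) -(fineK (mean_up_flow_fin n y)).
by rewrite -!EFinM -EFinD !lee_fin /= => *; lra.
Qed.

End level_inequalities.

(** * Subexponential tails *)

Section tails.
Context (R : realType) (G : probability (measurableTypeR R) R).
Notation RR := (measurableTypeR R).
Implicit Types x y K e : R.

Definition ftail x : R := fine (tail G x).

Lemma tail_fin x : tail G x = (ftail x)%:E.
Proof. by rewrite /ftail fineK// fin_num_measure. Qed.

Lemma ftail_ge0 x : 0 <= ftail x.
Proof. by rewrite fine_ge0. Qed.

Lemma ftail_nonincreasing x y : x <= y -> ftail y <= ftail x.
Proof.
move=> xy; rewrite -lee_fin -!tail_fin; apply: le_measure; rewrite ?inE//.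
by apply: subset_itv; rewrite ?bnd_simp.
Qed.

Lemma ftail_cvg0 e : 0 < e -> exists x0, forall x, x0 <= x -> ftail x < e.
Proof.
move=> e0.
pose F (n : nat) : set RR := `]n%:R, +oo[%classic.
have mF n : measurable (F n) by exact: measurable_itv.
have cv : G (F n) @[n --> \oo] --> G (\bigcap_n F n).
  apply: nonincreasing_cvg_mu => //.
  - by rewrite ltey_eq fin_num_measure.
  - exact: bigcapT_measurable.
  - move=> m n mn; apply/subsetPset; apply: subset_itv; rewrite ?bnd_simp//.
    by rewrite ler_nat.
have F0 : \bigcap_n F n = set0.
  rewrite -subset0 => x /= Fx.
  have := Fx (Num.truncn `|x|).+1 I; rewrite /F /= in_itv/= andbT => h.
  have := truncnS_gt `|x|; rewrite ltNge => /negP; apply.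
  by rewrite (le_trans (ltW h))// ler_norm.
rewrite F0 measure0 in cv.
have /fine_cvgP[_ cv'] := cv.
have [N _ H] := cvgr_lt 0 cv' _ e0.
exists N%:R => x Nx; apply: le_lt_trans (ftail_nonincreasing Nx) _.
exact: (H N (leqnn N)).
Qed.

Lemma centered_interval_prob e : 0 < e ->
  exists2 K0, 0 <= K0 & forall K, K0 <= K -> 1 - e <= fine (G `[- K, K]%classic).
Proof.
move=> e0.
pose F (n : nat) : set RR := `[- n%:R, n%:R]%classic.
have mF n : measurable (F n) by exact: measurable_itv.
have cv : G (F n) @[n --> \oo] --> G (\bigcup_n F n).
  apply: nondecreasing_cvg_mu => //.
  - exact: bigcupT_measurable.
  - move=> m n mn; apply/subsetPset; apply: subset_itv; rewrite ?bnd_simp.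
      by rewrite lerN2 ler_nat.
    by rewrite ler_nat.
have FT : \bigcup_n F n = setT.
  rewrite -subTset => x _; exists (Num.truncn `|x|).+1 => //=.
  rewrite /F /= in_itv/= -ler_norml ltW//; exact: truncnS_gt.
rewrite FT probability_setT in cv.
have /fine_cvgP[_ cv'] := cv.
have [|N _ H] := cvgr_ge _ cv' (1 - e); first by rewrite ltrBlDr ltrDl.
exists N%:R => // K NK; apply: le_trans (H N (leqnn N)) _ => /=.
rewrite fine_le ?fin_num_measure//; apply: le_measure; rewrite ?inE//.
by apply: subset_itv; rewrite ?bnd_simp// lerN2.
Qed.

Hypothesis G_subexp : subexponential G.

Lemma ftail_gt0 x : 0 < ftail x.
Proof.
have [[pos _] _] := G_subexp.
have h y : 0 < y -> 0 < ftail y by move=> y0; rewrite -lte_fin -tail_fin pos.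
apply: lt_le_trans (h (Num.max x 1) _) (ftail_nonincreasing _).
  by rewrite lt_max ltr01 orbT.
by rewrite le_max lexx.
Qed.

Lemma ftail_shift K e : 0 <= K -> 0 < e ->
  exists x0, forall x, x0 <= x -> (1 - e) * ftail x <= ftail (x + K).
Proof.
move=> K0 e0; move: K0; rewrite le_eqVlt => /predU1P[<-|K0].
  by exists 0 => x _; rewrite addr0 ler_piMl ?ftail_ge0//; lra.
have [[_ /(_ _ K0) lt] _] := G_subexp.
have : 1 - e < 1 by rewrite ltrBlDr ltrDl.
move=> /(cvgr_ge _ lt)[M [_ H]].
exists (M + 1) => x Mx; have /H : M < x by lra.
by rewrite ler_pdivlMr// ftail_gt0.
Qed.

Lemma ftail_shiftB K e : 0 <= K -> 0 < e ->
  exists x0, forall x, x0 <= x -> ftail (x - K) <= (1 + e) * ftail x.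
Proof.
move=> K0 e0; pose e' := e / (1 + e).
have e'0 : 0 < e' by rewrite divr_gt0//; lra.
have [x0 H] := ftail_shift K0 e'0; exists (x0 + K) => x xx.
have := H (x - K); rewrite subrK => /(_ _)H'.
have {}H' := H' ltac:(lra); move: H'.
have -> : 1 - e' = (1 + e)^-1 by rewrite /e'; field; lra.
by rewrite ler_pdivrMl//; lra.
Qed.

(** Probability that two independent variables of law [G] have a sum above [x] while
    the first one lies between [K] and [x - K]; see [middleE]. *)
Definition middle K x : \bar R :=
  (\int[G]_(y in [set` `]K, x - K]%R]) tail G (x - y)%R)%E.

Let S x : set (RR * RR) := [set z | x < z.1 + z.2].

Lemma measurable_sum_gt x : measurable (S x).
Proof.
have mD : measurable_fun setT (fun z : RR * RR => z.1 + z.2 : R).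
  by apply: measurable_funD; [exact: measurable_fst|exact: measurable_snd].
rewrite (_ : S x = (fun z : RR * RR => z.1 + z.2 : R) @^-1` `]x, +oo[%classic); last first.
  by apply/seteqP; split => z; rewrite /S /= in_itv/= andbT.
by rewrite -[_ @^-1` _]setTI; apply: mD => //; exact: measurable_itv.
Qed.

Let A K x : set (RR * RR) := (`]K, x - K]%classic `*` setT) `&` S x.

Let measurable_A K x : measurable (A K x).
Proof.
apply: measurableI; last exact: measurable_sum_gt.
by apply: measurableX => //; exact: measurable_itv.
Qed.

Let prod_fin (X : set (RR * RR)) : measurable X -> (G \x G)%E X \is a fin_num.
Proof.
move=> mX; rewrite ge0_fin_numE//; apply: (@le_lt_trans _ _ ((G \x G)%E setT)).
  by apply: le_measure; rewrite ?inE.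
rewrite -setXTT product_measure1E//.
by rewrite ltey_eq fin_numM// fin_num_measure.
Qed.

Lemma middleE K x : middle K x = (G \x G)%E (A K x).
Proof.
rewrite /middle integral_mkcond /product_measure1; apply: eq_integral => y _.
rewrite patchE /=; case: ifPn => [|] yK.
  congr (G _); apply/seteqP; split => z /=; rewrite /xsection /A /S /= in_itv/= andbT.
    move=> h; rewrite inE /=; split; first by split => //; rewrite inE in yK.
    lra.
  by rewrite inE/= => -[_ h]; lra.
rewrite (_ : xsection _ _ = set0) ?measure0//.
rewrite -subset0 => z /=; rewrite /xsection /A /S /= inE/= => -[[h _] _].
by move: yK; rewrite notin_setE; apply.
Qed.

Let J K : set RR := `[- K, K]%classic.

(** The middle range competes with two disjoint configurations: one variable at
    most [K] in absolute value, the other above [x + K]. *)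
Lemma middle_le K x : 0 <= K -> 0 <= x ->
  (middle K x + 2%:E * (G (J K) * tail G (x + K)%R) <= conv_tail G x)%E.
Proof.
move=> K0 x0; rewrite middleE.
pose B : set (RR * RR) := `[- K, K]%classic `*` `]x + K, +oo[%classic.
pose C : set (RR * RR) := `]x + K, +oo[%classic `*` `[- K, K]%classic.
have mI (i : interval R) : measurable ([set` i] : set RR) by exact: measurable_itv.
have mB : measurable B by exact: measurableX.
have mC : measurable C by exact: measurableX.
have -> : (2%:E * (G (J K) * tail G (x + K)%R) = (G \x G) B + (G \x G) C)%E.
  rewrite product_measure1E// product_measure1E// [X in (_ + X)%E]muleC.
  by rewrite -mule2n mule_natl.
have AB : (G \x G)%E (A K x `|` (B `|` C)) = ((G \x G) (A K x) + ((G \x G) B + (G \x G) C))%E.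
  rewrite measureU//; last 2 first.
  - exact: measurableU.
  - rewrite -subset0 => -[u v] [] [[/= + _] _] []; rewrite /B /C /= !in_itv/= => h [h1 h2]; lra.
  congr (_ + _)%E; rewrite measureU//.
  rewrite -subset0 => -[u v] []; rewrite /B /C /= !in_itv/= => -[h1 h2] [h3 h4]; lra.
rewrite -AB; apply: le_measure; rewrite ?inE//.
- by apply: measurableU => //; exact: measurableU.
- exact: measurable_sum_gt.
move=> [u v] [|[]]; rewrite /A /B /C /S /= ?in_itv/=.
- by case.
- by move=> [h1 h2]; lra.
- by move=> [h1 h2]; lra.
Qed.

(** The two configurations of [middle_le] already have probability close to
    [2 * f x], which is all that subexponentiality grants to the sum. *)
Lemma middle_small e : 0 < e -> exists2 K0, 0 <= K0 & forall K, K0 <= K ->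
  exists x0, forall x, x0 <= x -> (middle K x <= (e * ftail x)%:E)%E.
Proof.
move=> e0; pose h := Num.min (e / 6) 1.
have h0 : 0 < h by rewrite lt_min ltr01 andbT; lra.
have he : 6 * h <= e.
  have : h <= e / 6 by rewrite ge_min lexx.
  lra.
have h1 : h <= 1 by rewrite ge_min lexx orbT.
have [K0 K00 HK0] := centered_interval_prob h0.
exists K0 => // K K0K; have K_ge0 : 0 <= K by exact: le_trans K0K.
have [_ conv] := G_subexp.
have [M [_ HM]] : \forall x \near +oo,
    fine (conv_tail G x) / fine (2%:E * tail G x)%E <= 1 + h.
  by apply: (cvgr_le _ conv); rewrite ltrDl.
have [x1 Hx1] := ftail_shift K_ge0 h0.
exists (Num.max 0 (Num.max (M + 1) x1)) => x.
rewrite !ge_max => /and3P[x0 Mx x1x].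
have cfin : conv_tail G x \is a fin_num.
  by rewrite /conv_tail; apply: prod_fin; exact: measurable_sum_gt.
have f0 := ftail_gt0 x.
have := HM x ltac:(lra); rewrite tail_fin -EFinM /= ler_pdivrMr; last by rewrite mulr_gt0.
move=> conv_le.
have p0 := HK0 _ K0K.
have pfin : G `[- K, K]%classic \is a fin_num.
  by apply: fin_num_measure; exact: measurable_itv.
have := middle_le K_ge0 x0.
have mfin : middle K x \is a fin_num by rewrite middleE; exact: prod_fin.
rewrite -(fineK mfin) -(fineK cfin) -(fineK pfin) tail_fin -!EFinM -EFinD !lee_fin.
set p := fine (G _) in p0 *; set q := ftail (x + K) => mid.
have := Hx1 _ x1x; rewrite -/q => qf.
have pq : (1 - h) * ((1 - h) * ftail x) <= p * q.
  by apply: ler_pM => //; [lra|rewrite mulr_ge0//; [lra|exact: ltW]].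
have hf : 0 <= h * h * ftail x by rewrite !mulr_ge0// ltW.
have ef : 6 * h * ftail x <= e * ftail x by rewrite ler_pM2r.
nra.
Qed.

End tails.

(** * The tail of the maximum along one ray *)

Section ray_asymptotics.
Context (R : realType) (c : R) (nu : probability R R).
Context (G : probability (measurableTypeR R) R).
Notation RR := (measurableTypeR R).
Hypothesis nu_integrable : nu.-integrable setT (fun t : R => t%:E).
Hypothesis nu_mean0 : (\int[nu]_t t%:E = 0)%E.
Hypothesis c0 : 0 < c.
Hypothesis G_subexp : subexponential G.
Variable Ks : R.
Hypothesis Ks0 : 0 <= Ks.
Hypothesis overshoot_tail : forall r, Ks <= r -> overshoot nu r = tail G r.
Implicit Types (x y z r K B e : R) (n : nat).
Notation lam n := (walk_law c nu n).
Notation Phi := (overshoot nu).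
Notation f := (ftail G).
Notation hit := (hit c nu).
Notation hitE := (hitE c nu).
Let mu : R := fine (Phi c).

Local Open Scope ereal_scope.

Let mu_ge0 : (0 <= mu)%R.
Proof. by rewrite fine_ge0//; exact: overshoot_ge0. Qed.

Lemma measurable_hitE n x : measurable_fun setT (fun y : RR => hitE n (x - y)%R).
Proof.
pose A : set (R * RR) := [set z | (x < z.1 + z.2)%R].
have mA : measurable A.
  have mD : measurable_fun setT (fun z : R * RR => z.1 + z.2 : R)%R.
    by apply: measurable_funD; [exact: measurable_fst|exact: measurable_snd].
  rewrite (_ : A = (fun z : R * RR => (z.1 + z.2)%R : R) @^-1` `]x, +oo[%classic); last first.
    by apply/seteqP; split => z; rewrite /A /= in_itv/= andbT.
  by rewrite -[_ @^-1` _]setTI; apply: mD => //; exact: measurable_itv.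
have := measurable_fun_ysection (lam n) mA.
apply: eq_measurable_fun => y _ /=; rewrite /hitE; congr (lam n _).
apply/seteqP; split => z; rewrite /ysection /=.
  by rewrite inE /A /= in_itv/= andbT => h; rewrite ltrBlDr.
by rewrite in_itv/= andbT inE /A /= => h; rewrite -ltrBlDr.
Qed.

(** The overshoot above a high level is the probability that a variable [y] of law
    [G] exceeds it.  After an exchange of integrals the walk has to cover the
    remaining distance [x - y] to [x]. *)
Lemma far_overshoot_le n K x : (Ks <= K)%R -> (0 <= K)%R ->
  far_overshoot c nu n K x <=
  tail G (x - K)%R + \int[G]_(y in [set` `]K, x - K]%R]) hitE n (x - y)%R.
Proof.
move=> KsK K0.
pose g (z : R * RR) := (\1_`]K, +oo[ z.2 * \1_`]x, +oo[ (z.1 + z.2))%R%:E : \bar R.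
have mg : measurable_fun setT g.
  apply/measurable_EFinP; apply: measurable_funM.
    exact: (measurableT_comp (measurable_indic (measurable_itv `]K, +oo[)) measurable_snd).
  have mD : measurable_fun setT (fun z : R * RR => z.1 + z.2 : R)%R.
    by apply: measurable_funD; [exact: measurable_fst|exact: measurable_snd].
  exact: (measurableT_comp (measurable_indic (measurable_itv `]x, +oo[)) mD).
have g0 (z : R * RR) : 0 <= g z by rewrite lee_fin mulr_ge0// indicE.
have inner1 m : \int[G]_y g (m, y) = tail G (Num.max (x - m) K)%R.
  transitivity (\int[G]_y (\1_([set` `](Num.max (x - m) K), +oo[%R] : set RR) y)%:E).
    2: by rewrite integral_indic ?setIT//; exact: measurable_itv.
  apply: eq_integral => y _; congr (_%:E).
  rewrite /g /= !indicE -natrM mulnb; congr ((_ : bool)%:R).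
  rewrite !mem_setE !in_itv/= !andbT gt_max andbC; congr (_ && _).
  by apply/idP/idP => ?; lra.
have inner2 y : \int[lam n]_m g (m, y) = (\1_`]K, +oo[ y)%:E * hitE n (x - y)%R.
  have -> : hitE n (x - y)%R
      = \int[lam n]_m (\1_([set` `](x - y), +oo[%R] : set R) m)%:E.
    by rewrite integral_indic ?setIT.
  rewrite -ge0_integralZl//; last first.
  - by apply/measurable_EFinP; exact: measurable_indic.
  apply: eq_integral => m _; rewrite /g /= EFinM; congr (_ * _%:E).
  rewrite !indicE; congr ((_ : bool)%:R); rewrite !mem_setE !in_itv/= !andbT.
  by apply/idP/idP => ?; lra.
have swap : \int[lam n]_m \int[G]_y g (m, y) = \int[G]_y \int[lam n]_m g (m, y).
  exact: (@fubini_tonelli _ _ _ _ _ (lam n) G g mg g0).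
apply: (@le_trans _ _ (\int[lam n]_m \int[G]_y g (m, y))).
  apply: ge0_le_integral => //.
  - by move=> m _; exact: overshoot_ge0.
  - have mfar : measurable_fun setT
        (fun z : R * R => (jump_up (c + Num.max (x - z.1) K) z.2)%:E)%R.
      apply/measurable_EFinP; apply: measurable_maxr => //; apply: measurable_funB => //.
      apply: measurable_funD; first exact: measurable_cst.
      apply: measurable_maxr; last exact: measurable_cst.
      by apply: measurable_funB => //; exact: measurable_cst.
    have := @measurable_fun_fubini_tonelli_F _ _ _ _ _ nu _ mfar; apply => z.
    by rewrite lee_fin jump_up_ge0.
  - by have := @measurable_fun_fubini_tonelli_F _ _ _ _ _ G g mg; apply.
  - move=> m _; rewrite inner1 -overshoot_tail; last by rewrite le_max KsK orbT.
    by apply: overshoot_nonincreasing => //; rewrite lerDr ltW.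
rewrite swap; under eq_integral do rewrite inner2.
have mI : measurable ([set` `]K, x - K]%R] : set RR) by exact: measurable_itv.
have mJ : measurable (`](x - K)%R, +oo[%classic : set RR) by exact: measurable_itv.
have mh := measurable_hitE n x.
have mhI := (measurable_restrictT _ mI).1 (measurable_funTS mh).
have mIK : measurable_fun setT (fun y : RR => (\1_`]K, +oo[ y)%:E : \bar R).
  apply/measurable_EFinP; apply: measurable_indic; exact: measurable_itv.
have mIx : measurable_fun setT (fun y : RR => (\1_`](x - K)%R, +oo[ y)%:E : \bar R).
  apply/measurable_EFinP; apply: measurable_indic; exact: measurable_itv.
have -> : tail G (x - K)%R = \int[G]_y (\1_`](x - K)%R, +oo[ y)%:E.
  by rewrite integral_indic// setIT.
rewrite [X in _ <= _ + X]integral_mkcond -ge0_integralD//; last first.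
  by move=> y _; apply: erestrict_ge0.
apply: ge0_le_integral => //.
- by move=> y _; rewrite mule_ge0// lee_fin indicE.
- exact: emeasurable_funM.
- exact: emeasurable_funD.
- move=> y _; rewrite patchE !indicE !mem_setE !in_itv/= !andbT.
  have [Ky|Ky] := ltP K y; last first.
    by rewrite mul0e adde_ge0// lee_fin.
  rewrite mul1e; have [xy|xy] := leP y (x - K)%R; first by rewrite add0e.
  by rewrite adde0; exact: probability_le1.
Qed.

Lemma far_overshoot_middle n K x B : (Ks <= K)%R -> (0 <= K)%R -> (0 <= B)%R ->
  (forall z, K <= z -> z <= x - K -> hit n z <= B * f z)%R ->
  far_overshoot c nu n K x <= (f (x - K)%R)%:E + B%:E * middle G K x.
Proof.
move=> KsK K0 B0 H; apply: le_trans (far_overshoot_le n x KsK K0) _.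
rewrite tail_fin leeD2l// /middle.
have mI : measurable ([set` `]K, x - K]%R] : set RR) by exact: measurable_itv.
have mt : measurable_fun setT (fun y : RR => tail G (x - y)%R).
  pose A : set (RR * RR) := [set u | (x < u.1 + u.2)%R].
  have mA : measurable A by exact: measurable_sum_gt.
  have := measurable_fun_ysection G mA.
  apply: eq_measurable_fun => y _ /=; rewrite /tail; congr (G _).
  apply/seteqP; split => u; rewrite /ysection /=.
    by rewrite inE /A /= in_itv/= andbT => h; rewrite ltrBlDr.
  by rewrite in_itv/= andbT inE /A /= => h; rewrite -ltrBlDr.
rewrite -ge0_integralZl//; last exact: measurable_funTS.
apply: ge0_le_integral => //.
- by apply: measurable_funTS; exact: measurable_hitE.
- by apply: measurable_funTS; apply: emeasurable_funM => //; exact: measurable_cst.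
- move=> y /=; rewrite in_itv/= => /andP[Ky yx].
  rewrite hitE_fin tail_fin -EFinM lee_fin.
  have [xy|xy] := leP K (x - y)%R; last by lra.
  by apply: H => //; lra.
Qed.

Local Close Scope ereal_scope.

(** A bound [hit n <= B * f] between the levels [K] and [x - K] propagates to
    [x + K] with [B] replaced by about [(B * mu + 1) / (mu + c)].  The
    horizon [n] and the bound [B] come last: the thresholds do not depend on them,
    which makes induction on the level possible. *)
Lemma hit_recursion e : 0 < e -> e <= 1 -> exists2 K0, 0 <= K0 &
  forall K, K0 <= K -> exists x1, forall x, x1 <= x -> forall n B, 0 <= B ->
  (forall z, K <= z -> z <= x - K -> hit n z <= B * f z) ->
  hit n (x - K) <= B * f (x - K) ->
  hit n (x + K) * (mu + c - e) <= (1 + e) * (B * mu + 1 + B * e) * f (x + K)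
  /\ hit n (x - K) * mu + fine (far_overshoot c nu n K x)
     <= (1 + e) * (B * mu + 1 + B * e) * f (x + K).
Proof.
move=> e0 e1.
have [K1 K10 HK1] := down_trunc_cvg c nu_integrable nu_mean0 e0.
have [K2 K20 HK2] := middle_small G_subexp e0.
exists (Num.max Ks (Num.max K1 K2)); first by rewrite le_max Ks0.
move=> K; rewrite !ge_max => /and3P[KsK K1K K2K].
have K0 : 0 <= K by exact: le_trans KsK.
have [x1 Hx1] := HK2 _ K2K.
have KK0 : 0 <= 2 * K by rewrite mulr_ge0.
have [x2 Hx2] := ftail_shiftB G_subexp KK0 e0.
exists (Num.max 0 (Num.max x1 (x2 - K))) => x.
rewrite !ge_max => /and3P[x0 x1x x2x] n B B0 HB HBK.
have mid := Hx1 _ x1x.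
have fxK : f (x - K) <= (1 + e) * f (x + K).
  by have := Hx2 (x + K) ltac:(lra); rewrite (_ : x + K - 2 * K = x - K); last ring.
have fx : f x <= (1 + e) * f (x + K).
  by apply: le_trans fxK; apply: ftail_nonincreasing; lra.
have far : fine (far_overshoot c nu n K x) <= f (x - K) + B * (e * f x).
  rewrite -lee_fin fineK; last exact: far_overshoot_fin.
  apply: le_trans (far_overshoot_middle KsK K0 B0 HB) _.
  by rewrite EFinD leeD2l// EFinM lee_wpmul2l// lee_fin.
have rec := hit_upper_recursion c nu_integrable nu_mean0 n x0 K0.
have dt := HK1 _ K1K.
have h0 := hit_ge0 c nu n (x + K).
have up : hit n (x - K) * mu + fine (far_overshoot c nu n K x)
    <= (1 + e) * (B * mu + 1 + B * e) * f (x + K).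
  have b1 : hit n (x - K) * mu <= B * f (x - K) * mu by rewrite ler_wpM2r.
  have b2 : B * mu * f (x - K) <= B * mu * ((1 + e) * f (x + K)).
    by rewrite ler_wpM2l// mulr_ge0.
  have b3 : B * e * f x <= B * e * ((1 + e) * f (x + K)).
    by rewrite ler_wpM2l// mulr_ge0// ltW.
  nra.
split=> //; apply: le_trans up; apply: le_trans rec.
by rewrite ler_wpM2l//.
Qed.

End ray_asymptotics.

Section veraverbeke.
Context (R : realType) (c : R) (nu : probability R R).
Context (G : probability (measurableTypeR R) R).
Hypothesis nu_integrable : nu.-integrable setT (fun t : R => t%:E).
Hypothesis nu_mean0 : (\int[nu]_t t%:E = 0)%E.
Hypothesis c0 : 0 < c.
Hypothesis G_subexp : subexponential G.
Variable Ks : R.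
Hypothesis Ks0 : 0 <= Ks.
Hypothesis overshoot_tail : forall r, Ks <= r -> overshoot nu r = tail G r.
Implicit Types (x y z r K B e : R) (n : nat).
Notation Phi := (overshoot nu).
Notation f := (ftail G).
Notation hit := (hit c nu).
Let mu : R := fine (Phi c).

Let mu_ge0 : 0 <= mu.
Proof. by rewrite fine_ge0//; exact: overshoot_ge0. Qed.

Let rec := hit_recursion nu_integrable nu_mean0 c0 G_subexp Ks0 overshoot_tail.

(** The map from [B] to [(B * mu + 1) / (mu + c)] has fixed point [1 / c], so that
    the propagation of [hit_recursion] preserves any [B] well above [1 / c], despite
    the errors.  Low levels are covered by taking [B] large, higher ones by
    induction in steps of [K]. *)
Lemma hit_bounded : exists2 B, 0 < B & forall n z, hit n z <= B * f z.
Proof.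
have m0 : 0 <= mu by exact: mu_ge0.
have cpos : 0 < c by exact: c0.
have [e [e0 e1 ee]] : exists e : R, [/\ 0 < e, e <= 1 & e * (3 + mu) <= c / 2].
  exists (Num.min 1 (c / 2 / (3 + mu))); split.
  - by rewrite lt_min ltr01 divr_gt0//; lra.
  - by rewrite ge_min lexx.
  - have h3 : 0 < 3 + mu by lra.
    by rewrite -ler_pdivlMr// ge_min lexx orbT.
have [K0 K00 HK] := rec e0 e1.
have [x1 Hx1] := HK (K0 + 1) ltac:(lra).
set K := K0 + 1 in Hx1; have Kgt0 : 0 < K by rewrite /K; lra.
pose B := Num.max (4 / c) (1 / f (x1 + K)).
have B0 : 0 < B by rewrite lt_max divr_gt0.
have B4 : 4 / c <= B by rewrite le_max lexx.
exists B => //.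
have base n z : z <= x1 + K -> hit n z <= B * f z.
  move=> zx; apply: le_trans (hit_le1 _ _ _ _) _.
  apply: le_trans (_ : B * f (x1 + K) <= _); last first.
    by rewrite ler_wpM2l ?ftail_nonincreasing// ltW.
  by rewrite -ler_pdivrMr ?ftail_gt0// le_max lexx orbT.
have ind k : forall n z, z <= x1 + K + k%:R * K -> hit n z <= B * f z.
  elim: k => [|k IH] n z; first by rewrite mul0r addr0; exact: base.
  rewrite -natr1 mulrDl mul1r => zk.
  have [zx|xz] := leP z (x1 + K); first exact: base.
  have [||h _] := Hx1 (z - K) ltac:(lra) n B (ltW B0).
  - by move=> w _ wz; apply: IH; lra.
  - by apply: IH; lra.
  move: h; rewrite subrK => h.
  have Bc : 4 <= B * c by rewrite -ler_pdivrMr.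
  have Be : B * e * (3 + mu) <= B * (c / 2) by rewrite -mulrA ler_wpM2l// ltW.
  have coef : (1 + e) * (B * mu + 1 + B * e) <= B * (mu + c - e).
    have e2 : B * e * e <= B * e * 1 by rewrite ler_wpM2l// mulr_ge0// ltW.
    nra.
  have d0 : 0 < mu + c - e by nra.
  have := le_trans h (ler_wpM2r (ftail_ge0 G z) coef).
  by rewrite -[B * _ * f z]mulrAC ler_pM2r.
move=> n z; apply: (ind (Num.truncn (`|z - (x1 + K)| / K)).+1).
have := truncnS_gt (`|z - (x1 + K)| / K); rewrite ltr_pdivrMr// => h.
have := ler_norm (z - (x1 + K)); lra.
Qed.

Definition eventual_bound B :=
  0 <= B /\ exists z0, forall z, z0 <= z -> forall n, hit n z <= B * f z.

(** [hit_recursion] lowers [B] by [(B * c - 1) / (mu + c)] up to arbitrarily small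
    errors, of which half is kept. *)
Lemma eventual_bound_improve B : eventual_bound B -> 1 < B * c ->
  eventual_bound (B - (B * c - 1) / (2 * (mu + c))).
Proof.
move=> [B0 [z0 Hz0]] Bc.
have m0 : 0 <= mu by exact: mu_ge0.
have cpos : 0 < c by exact: c0.
have mc : 0 < mu + c by lra.
pose s := (B * c - 1) / 2; have s0 : 0 < s by rewrite /s; lra.
pose B' := B - (B * c - 1) / (2 * (mu + c)).
have B'E : B' * (mu + c) = B * mu + 1 + s by rewrite /B' /s; field; lra.
have B'B : B' <= B.
  by rewrite /B' gerBl divr_ge0 ?mulr_ge0 ?subr_ge0 ?ltW//.
have B'0 : 0 <= B'.
  by rewrite -(pmulr_lge0 _ mc) B'E; nra.
have [e [e0 e1 ee]] : exists e : R, [/\ 0 < e, e <= 1 & e * (B * mu + 1 + 3 * B) <= s].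
  have h3 : 0 < B * mu + 1 + 3 * B by nra.
  exists (Num.min 1 (s / (B * mu + 1 + 3 * B))); split.
  - by rewrite lt_min ltr01 divr_gt0.
  - by rewrite ge_min lexx.
  - by rewrite -ler_pdivlMr// ge_min lexx orbT.
split=> //.
have [K0 K00 HK] := rec e0 e1.
have [x1 Hx1] := HK (Num.max K0 z0) ltac:(by rewrite le_max lexx).
set K := Num.max K0 z0 in Hx1.
have zK : z0 <= K by rewrite le_max lexx orbT.
have K_ge0 : 0 <= K by rewrite le_max K00.
exists (Num.max (x1 + K) (z0 + 2 * K)) => z; rewrite ge_max => /andP[xz zz] n.
have [||h _] := Hx1 (z - K) ltac:(lra) n B B0.
- by move=> w Kw _; apply: Hz0; lra.
- by apply: Hz0; lra.
move: h; rewrite subrK => h.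
have coef : (1 + e) * (B * mu + 1 + B * e) <= B' * (mu + c - e).
  have e2 : B * e * e <= B * e * 1 by rewrite ler_wpM2l// mulr_ge0// ltW.
  have e3 : B' * e <= B * e by rewrite ler_wpM2r// ltW.
  nra.
have d0 : 0 < mu + c - e.
  have : 0 < (1 + e) * (B * mu + 1 + B * e).
    apply: mulr_gt0; first lra.
    by have := mulr_ge0 B0 m0; have := mulr_ge0 B0 (ltW e0); lra.
  move=> /lt_le_trans/(_ coef) h1.
  by move: B'0 h1; rewrite le_eqVlt => /predU1P[<-|B'0]; rewrite ?mul0r ?ltxx// pmulr_rgt0.
have := le_trans h (ler_wpM2r (ftail_ge0 G z) coef).
by rewrite -[B' * _ * f z]mulrAC ler_pM2r.
Qed.

(** The infimum [q] of the eventual bounds is at most [1 / c]: otherwise a bound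
    close to [q] could be improved below [q]. *)
Lemma hit_upper e : 0 < e -> exists x0, forall x, x0 <= x -> forall n,
  hit n x <= (c^-1 + e) * f x.
Proof.
move=> e0; have m0 : 0 <= mu by exact: mu_ge0.
have cpos : 0 < c by exact: c0.
have mc : 0 < mu + c by lra.
pose E : set R := [set B | eventual_bound B].
have EB : has_inf E.
  split; last by exists 0 => B [].
  have [B B0 HB] := hit_bounded; exists B; split; first exact: ltW.
  by exists 0 => z _ n; exact: HB.
pose q := inf E.
have qc : q <= c^-1.
  rewrite leNgt; apply/negP => cq.
  have qc1 : 1 < q * c by rewrite -ltr_pdivrMr// mul1r.
  pose h := (q * c - 1) / (2 * (mu + c)).
  have h0 : 0 < h by rewrite divr_gt0 ?mulr_gt0//; lra.
  have [B EB' Bq] := inf_adherent h0 EB.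
  have qB : q <= B by apply: ge_inf => //; case: EB.
  have Bc : q * c <= B * c by rewrite ler_pM2r.
  have /(ge_inf EB.2) : E (B - (B * c - 1) / (2 * (mu + c))).
    by apply: eventual_bound_improve => //; lra.
  have : h <= (B * c - 1) / (2 * (mu + c)).
    by rewrite ler_pM2r ?invr_gt0 ?mulr_gt0//; lra.
  rewrite -/q; lra.
have [B [B0 [z0 H]] Bq] := inf_adherent e0 EB.
exists z0 => x zx n; apply: le_trans (H _ zx n) _.
rewrite ler_wpM2r ?ftail_ge0//; rewrite -/q in Bq; lra.
Qed.

(** Otherwise the bounded sequence would grow linearly. *)
Lemma nondecreasing_small_increment (u : nat -> R) M e : 0 < e ->
  (forall n, u n <= u n.+1) -> (forall n, u n <= M) -> 0 <= u 0%N ->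
  exists n, u n.+1 - u n <= e.
Proof.
move=> e0 uS uM u0; apply: contrapT => /forallNP H.
have ge n : n%:R * e <= u n.
  elim: n => [|n IH]; first by rewrite mul0r.
  have := H n => /negP; rewrite -ltNge -natr1 => h; nra.
have := truncnS_gt (`|M| / e); rewrite ltr_pdivrMr// => h.
have := ge (Num.truncn (`|M| / e)).+1; have := uM (Num.truncn (`|M| / e)).+1.
have := ler_norm M; lra.
Qed.

(** [hit_lower_recursion] is used at one step [n] only, after which [hit] can only
    increase. *)
Lemma hit_lower e : 0 < e -> exists x0, forall x, x0 <= x ->
  exists n0, forall n, (n0 <= n)%N -> (c^-1 - e) * f x <= hit n x.
Proof.
move=> e0; have m0 : 0 <= mu by exact: mu_ge0.
have cpos : 0 < c by exact: c0.
have [h [h0 h1 hh]] : exists h : R, [/\ 0 < h, h <= 1 & 4 * h <= c * e].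
  exists (Num.min 1 (c * e / 4)); split.
  - by rewrite lt_min ltr01 divr_gt0// mulr_gt0.
  - by rewrite ge_min lexx.
  - have : Num.min 1 (c * e / 4) <= c * e / 4 by rewrite ge_min lexx orbT.
    lra.
have [B B0 HB] := hit_bounded.
have Bh0 : 0 < h / B by rewrite divr_gt0.
have [x1 Hx1] := ftail_cvg0 G Bh0.
have [x2 Hx2] := ftail_shift G_subexp (ltW c0) h0.
exists (Num.max 0 (Num.max Ks (Num.max x1 x2))) => x.
rewrite !ge_max => /and4P[x0 Kx x1x x2x].
have f0 := ftail_gt0 G_subexp x.
(* The excess over [x] is cut at a remote level [y].  Its part below [y] is bounded
   and nondecreasing in [n], so that it has a small increment; the flow through [y]
   is small for every [n] because [f y] is. *)
have [n0 Hn0] : exists n, fine (excess c nu n.+1 x) - fine (excess c nu n x) <= 2 * h * f x.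
  have [K0 K00 HK] := rec ltr01 (lexx 1).
  have [y1 Hy1] := HK _ (lexx K0).
  pose D := (1 + 1) * (B * mu + 1 + B * 1).
  have D0 : 0 < D by rewrite /D; nra.
  have hfD : 0 < h * f x / D by rewrite divr_gt0// mulr_gt0.
  have [y2 Hy2] := ftail_cvg0 G hfD.
  pose y := Num.max x (Num.max y1 y2).
  have xy : x <= y by rewrite le_max lexx.
  have y1y : y1 <= y by rewrite !le_max lexx orbT.
  have y2y : y2 <= y by rewrite !le_max lexx !orbT.
  have hf0 : 0 < h * f x by rewrite mulr_gt0.
  have [n Hn] := @nondecreasing_small_increment (fun n => fine (capped c nu n x y))
     (y - x) (h * f x) hf0
     (fun n => fine_le (capped_fin c nu n xy) (capped_fin c nu n.+1 xy)
        (capped_nondecreasing c nu n xy))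
     ltac:(by move=> n; rewrite -lee_fin fineK ?capped_fin// capped_le)
     ltac:(by rewrite fine_ge0// capped_ge0).
  exists n.
  have [|//|_ up] := Hy1 y y1y n B (ltW B0); first by move=> z _ _; exact: HB.
  have inc := excess_increment_le c nu_integrable nu_mean0 n x0 xy K00.
  have : D * f (y + K0) <= h * f x.
    rewrite mulrC -ler_pdivlMr// ltW//.
    by apply: Hy2; lra.
  by move=> hD; have := le_trans up hD; have := inc; have := Hn; lra.
exists n0 => n n0n.
have mono : hit n0 x <= hit n x.
  elim: n n0n => [|n IH]; first by rewrite leqn0 => /eqP ->.
  rewrite leq_eqVlt => /predU1P[<-//|]; rewrite ltnS => /IH h'.
  exact: le_trans h' (hit_nondecreasing _ _ _ _).
apply: le_trans mono.
have low := hit_lower_recursion c nu_integrable nu_mean0 n0 x0.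
have PhiE : fine (Phi (x + c)) = f (x + c).
  by rewrite overshoot_tail//; lra.
rewrite PhiE in low.
have hx1 : hit n0 x <= h.
  apply: le_trans (HB _ _) _; rewrite mulrC -ler_pdivlMr// ltW//; exact: Hx1.
have sh := Hx2 _ x2x.
have hx0 := hit_ge0 c nu n0 x.
have a1 : (1 - h) * ((1 - h) * f x) <= (1 - hit n0 x) * f (x + c).
  have h1' : 0 <= 1 - h by lra.
  by apply: ler_pM => //; [rewrite mulr_ge0// ltW|lra].
have a2 : 0 <= h * h * f x by rewrite !mulr_ge0// ltW.
have a3 : 4 * h * f x <= c * e * f x by rewrite ler_pM2r.
rewrite -(ler_pM2l c0) mulrA mulrBr divff ?gt_eqF//.
nra.
Qed.

End veraverbeke.

(** * The integrated tail and sums of the tail over a lattice *)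

Section integrated_tail_overshoot.
Context (R : realType) (nu : probability R R) (F : R -> R).
Notation RR := (measurableTypeR R).
Hypothesis nuF : forall x, nu `]-oo, x]%classic = (F x)%:E.
Implicit Types x y s t : R.
Local Open Scope ereal_scope.

Lemma survivalE x : nu `]x, +oo[%classic = (1 - F x)%:E.
Proof. by rewrite -setCitvl probability_setC// nuF EFinB. Qed.

Lemma survival_ge0 x : (0 <= 1 - F x)%R.
Proof. by rewrite -lee_fin -survivalE. Qed.

(** Tonelli's theorem on the set of pairs [x <= s < t]. *)
Lemma integral_survival x :
  \int[@lebesgue_measure R]_(y in `[x, +oo[%classic) (1 - F y)%:E
  = overshoot nu x.
Proof.
pose A : set (R * RR) := [set z | (x <= z.2)%R && (z.2 < z.1)%R].
have m2 : measurable_fun setT (fun z : R * RR => z.2 : R) by exact: measurable_snd.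
have m1 : measurable_fun setT (fun z : R * RR => z.1 : R) by exact: measurable_fst.
have mA : measurable A.
  have mb : measurable_fun setT (fun z : R * RR => (x <= z.2)%R && (z.2 < z.1)%R).
    apply: measurable_and; first exact: measurable_fun_ler.
    exact: measurable_fun_ltr.
  have := mb measurableT [set true]; rewrite setTI; exact.
pose g (z : R * RR) := (\1_A z)%:E : \bar R.
have mg : measurable_fun setT g by apply/measurable_EFinP; exact: measurable_indic.
have g0 (z : R * RR) : 0 <= g z by rewrite lee_fin.
have := @fubini_tonelli _ _ _ _ _ nu (@lebesgue_measure R) g mg g0.
have -> : \int[nu]_t \int[@lebesgue_measure R]_s g (t, s) = overshoot nu x.
  apply: eq_integral => t _.
  transitivity (\int[@lebesgue_measure R]_s (\1_(`[x, t[%classic : set R) s)%:E).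
    apply: eq_integral => s _; rewrite /g !indicE; congr ((_ : bool)%:R%:E).
  rewrite integral_indic// setIT.
  have := lebesgue_measure_itv (`[x, t[%R : interval R).
  rewrite /= lte_fin => ->; rewrite /jump_up.
  have [xt|tx] := ltP x t; first by rewrite max_r ?subr_ge0 ?ltW// EFinB.
  by rewrite max_l// subr_le0.
move=> ->; rewrite integral_mkcond; apply: eq_integral => s _.
rewrite patchE; case: ifPn => xs.
  have xs' : (x <= s)%R by move: xs; rewrite inE/= in_itv/= andbT.
  rewrite -survivalE -[X in nu X]setIT -integral_indic//.
  apply: eq_integral => t _; rewrite /g !indicE; congr ((_ : bool)%:R%:E).
  apply/idP/idP; rewrite !inE /A /= in_itv/= andbT xs' //=.
symmetry; apply: integral0_eq => t _; rewrite /g indicE memNset//.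
move=> /andP[/= h _]; move: xs; rewrite notin_setE/= in_itv/= andbT; exact.
Qed.

End integrated_tail_overshoot.

Section lattice_sums.
Context (R : realType) (c : R) (nu : probability R R) (F : R -> R).
Hypothesis nu_integrable : nu.-integrable setT (fun t : R => t%:E).
Hypothesis nuF : forall x, nu `]-oo, x]%classic = (F x)%:E.
Hypothesis c0 : 0 < c.
Implicit Types x y e : R.
Let Phi x : R := fine (overshoot nu x).
Let q x : R := 1 - F x.
Hypothesis Phi_cvg0 : forall e, 0 < e -> exists x0, forall x, x0 <= x -> Phi x < e.

Let PhiE x : overshoot nu x = (Phi x)%:E.
Proof. by rewrite /Phi fineK//; exact: overshoot_fin. Qed.

Let q_ge0 x : 0 <= q x.
Proof. exact: survival_ge0 nuF x. Qed.

Let Phi_ge0 x : 0 <= Phi x.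
Proof. by rewrite fine_ge0//; exact: overshoot_ge0. Qed.

(** The difference of [(t - x)^+] and [(t - x - c)^+] lies between [c] times the
    indicators of [t > x + c] and of [t > x]. *)
Local Lemma overshoot_increment x :
  c * q (x + c) <= Phi x - Phi (x + c) /\ Phi x - Phi (x + c) <= c * q x.
Proof.
have mI (a : R) : measurable_fun setT (\1_`]a, +oo[ : R -> R).
  exact: measurable_indic.
have iE (a : R) : (c * q a)%:E = (\int[nu]_t (c * \1_`]a, +oo[ t)%:E)%E.
  rewrite EFinM -(survivalE nuF) -[X in nu X]setIT -integral_indic//.
  rewrite -ge0_integralZl//; first exact/measurable_EFinP.
  by rewrite lee_fin ltW.
have m_c a : measurable_fun setT (fun t : R => (c * \1_`]a, +oo[ t)%:E).
  by apply/measurable_EFinP; apply: measurable_funM => //; exact: measurable_cst.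
have mu a : measurable_fun setT (fun t : R => (jump_up a t)%:E).
  by apply/measurable_EFinP; exact: measurable_jump_up.
have u0 (a t : R) : (0 <= (jump_up a t)%:E)%E by rewrite lee_fin jump_up_ge0.
have i0 (a t : R) : (0 <= (c * \1_`]a, +oo[ t)%:E)%E.
  by rewrite lee_fin mulr_ge0// ?ltW// indicE.
split.
- rewrite lerBrDl -lee_fin EFinD iE -!PhiE /overshoot -ge0_integralD//.
  apply: ge0_le_integral => //.
  + by move=> t _; rewrite adde_ge0.
  + exact: emeasurable_funD.
  + move=> t _; rewrite -EFinD lee_fin indicE mem_setE in_itv/= andbT /jump_up.
    by case: ltP => ? /=; rewrite ?mulr1 ?mulr0; minmax_lra.
- rewrite lerBlDl -lee_fin EFinD iE -!PhiE /overshoot -ge0_integralD//.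
  apply: ge0_le_integral => //.
  + exact: emeasurable_funD.
  + move=> t _; rewrite -EFinD lee_fin indicE mem_setE in_itv/= andbT /jump_up.
    have cpos := c0.
    by case: ltP => ? /=; rewrite ?mulr1 ?mulr0; minmax_lra.
Qed.

Lemma lattice_sum_upper x N :
  c * \sum_(1 <= n < N) q (x + c * n%:R) <= Phi x.
Proof.
suff : c * \sum_(1 <= n < N.+1) q (x + c * n%:R) <= Phi x - Phi (x + c * N%:R).
  have := Phi_ge0 (x + c * N%:R) => h1 h2.
  case: N h1 h2 => [|N] h1 h2; first by rewrite big_geq// mulr0.
  apply: le_trans (_ : Phi x - Phi (x + c * N.+1%:R) <= _); last lra.
  apply: le_trans h2; rewrite ler_pM2l// [leRHS]big_nat_recr//=.
  by rewrite lerDl.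
elim: N => [|N IH]; first by rewrite big_geq// !mulr0 addr0 subrr.
rewrite big_nat_recr//= mulrDr.
have [+ _] := overshoot_increment (x + c * N%:R).
have -> : x + c * N%:R + c = x + c * N.+1%:R by rewrite -natr1; ring.
lra.
Qed.

Lemma lattice_sum_lower x n0 N : (n0 <= N)%N ->
  Phi (x + c * n0%:R) - Phi (x + c * N%:R) <= c * \sum_(n0 <= n < N) q (x + c * n%:R).
Proof.
elim: N => [|N IH]; first by rewrite leqn0 => /eqP ->; rewrite big_geq// mulr0 subrr.
rewrite leq_eqVlt => /predU1P[->|]; first by rewrite big_geq// mulr0 subrr.
rewrite ltnS => n0N; have := IH n0N; rewrite big_nat_recr//= mulrDr.
have [_] := overshoot_increment (x + c * N%:R).
have -> : x + c * N%:R + c = x + c * N.+1%:R by rewrite -natr1; ring.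
lra.
Qed.

Variables (m : nat -> R) (L : R).
Hypothesis m_ge0 : forall n, 0 <= m n.
Hypothesis m_le : forall n, m n <= L.
Hypothesis m_lim : forall e, 0 < e -> exists n0, forall n, (n0 <= n)%N -> L - e <= m n.

Definition weighted_tail x : \bar R :=
  (\sum_(1 <= n <oo) (m n)%:E * (1 - F (x + c * n%:R))%:E)%E.

Let term_ge0 x n : (0 <= (m n)%:E * (1 - F (x + c * n%:R))%:E)%E.
Proof. by rewrite mule_ge0// lee_fin; [exact: m_ge0|exact: q_ge0]. Qed.

Lemma weighted_tail_upper x : (weighted_tail x <= (L / c * Phi x)%:E)%E.
Proof.
apply: lime_le; first by apply: is_cvg_nneseries => n _ _; exact: term_ge0.
apply: nearW => N; under eq_bigr do rewrite -EFinM.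
rewrite sumEFin lee_fin.
apply: le_trans (_ : L * \sum_(1 <= n < N) q (x + c * n%:R) <= _).
  by rewrite mulr_sumr; apply: ler_sum => n _; rewrite ler_wpM2r ?m_le ?q_ge0.
have L0 : 0 <= L by exact: le_trans (m_ge0 0) (m_le 0).
rewrite -mulrA ler_wpM2l// -(ler_pM2l c0) mulrA divff ?gt_eqF// mul1r.
exact: lattice_sum_upper.
Qed.

(** Only finitely many weights are below [L - e]; their omission shifts [x] by a
    multiple of [c]. *)
Lemma weighted_tail_lower e : 0 < e -> exists n0, forall x,
  (((L - e) / c * Phi (x + c * n0%:R))%:E <= weighted_tail x)%E.
Proof.
move=> e0; have [n0 Hn0] := m_lim e0; exists n0.+1 => x.
have [Le|Le] := leP (L - e) 0.
  apply: (@le_trans _ _ 0%E).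
    by rewrite lee_fin mulr_le0_ge0// mulr_le0_ge0// invr_ge0 ltW.
  by apply: nneseries_ge0 => n _ _; exact: term_ge0.
apply/lee_addgt0Pr => d d0.
have d0' : 0 < d * c / (L - e) by rewrite divr_gt0// mulr_gt0.
have [y0 Hy0] := Phi_cvg0 d0'.
pose N := (n0 + Num.truncn (`|y0 - x| / c)).+2.
have NN : y0 <= x + c * N%:R.
  have := truncnS_gt (`|y0 - x| / c); rewrite ltr_pdivrMr// => h.
  have := ler_norm (y0 - x) => h'.
  have : (Num.truncn (`|y0 - x| / c)).+1%:R <= N%:R :> R.
    by rewrite ler_nat /N ltnS (leq_trans (leq_addl n0 _)).
  move=> /(ler_wpM2l (ltW c0)) h2.
  rewrite mulrC in h; lra.
have n0N : (n0.+1 <= N)%N by rewrite /N ltnS leqW// leq_addr.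
apply: (@le_trans _ _ (\sum_(1 <= n < N) (m n)%:E * (1 - F (x + c * n%:R))%:E + d%:E)%E); last first.
  by rewrite leeD2r//; apply: nneseries_lim_ge => n _ _; exact: term_ge0.
under eq_bigr do rewrite -EFinM.
rewrite sumEFin -EFinD lee_fin.
apply: le_trans (_ : (L - e) * \sum_(n0.+1 <= n < N) q (x + c * n%:R) + d <= _); last first.
  rewrite lerD2r (@big_cat_nat _ _ _ n0.+1 1 N)//=.
  rewrite -[leLHS]add0r lerD//.
    by apply: sumr_ge0 => n _; apply: mulr_ge0; [exact: m_ge0|exact: q_ge0].
  rewrite mulr_sumr; apply: ler_sum_nat => n /andP[n0n _].
  by rewrite ler_wpM2r ?Hn0 ?q_ge0// ltnW.
have low := lattice_sum_lower x n0N.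
have := Hy0 _ NN; rewrite ltr_pdivlMr// => small.
rewrite mulrAC ler_pdivrMr//.
have := ler_wpM2l (ltW Le) low.
lra.
Qed.

End lattice_sums.

(** * Independence *)

Lemma eq_probability_rays (R : realType) (mu nu : probability R R) :
  (forall x, mu `]x, +oo[%classic = nu `]x, +oo[%classic) ->
  forall A, measurable A -> mu A = nu A.
Proof.
move=> H A mA; pose g (n : nat) : set R := `](- n%:R)%R, +oo[%classic.
apply: (@measure_unique _ _ _ (@RGenOInfty.G R) g) => //.
- exact: RGenOInfty.measurableE.
- move=> _ _ [x ->] [y ->]; exists (Num.max x y).
  by apply/seteqP; split => z /=; rewrite !in_itv/= !andbT gt_max => /andP.
- by move=> n; eexists.
- rewrite -subTset => x _; exists (Num.truncn `|x|).+1 => //=.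
  rewrite /g /= in_itv/= andbT ltrNl.
  by apply: le_lt_trans (truncnS_gt `|x|); rewrite -normrN ler_norm.
- by move=> _ [x ->]; exact: H.
- by move=> n; rewrite ltey_eq fin_num_measure//; exact: measurable_itv.
Qed.

Section independence.
Context d (T : measurableType d) (R : realType) (P : probability T R).
Local Open Scope ereal_scope.

Definition indep_events (A B : set T) := P (A `&` B) = P A * P B.

(** The events independent of [B] form a Dynkin system. *)
Lemma indep_sigma_algebra (Pi : set (set T)) (B : set T) :
  setI_closed Pi -> Pi `<=` measurable -> measurable B ->
  (forall A, Pi A -> indep_events A B) ->
  forall A, <<s Pi >> A -> indep_events A B.
Proof.
move=> PiI Pim mB PiB A.
rewrite -(setI_closed_g_dynkin_g_sigma_algebra PiI).
suff : <<d Pi >> `<=` [set A | measurable A /\ indep_events A B].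
  by move=> /[apply] -[].
apply: smallest_sub; last by move=> C PiC; split; [exact: Pim|exact: PiB].
split.
- split; first exact: measurableT.
  rewrite /indep_events setTI.
  by rewrite [X in _ = X * _](_ : _ = 1) ?mul1e//; exact: probability_setT.
- move=> C [mC CB]; split; first exact: measurableC.
  have PBoo : P B < +oo by rewrite ltey_eq fin_num_measure.
  rewrite /indep_events setIC -setDE measureD//.
  rewrite [X in _ - X](_ : _ = P C * P B); last by rewrite setIC; exact: CB.
  rewrite probability_setC//.
  have E (x y : \bar R) : x \is a fin_num -> y \is a fin_num ->
      y - x * y = (1 - x) * y.
    case: x => [x| |]//; case: y => [y| |]// _ _.
    by rewrite -!EFinM -!EFinB; congr (_%:E); ring.
  by apply: E; exact: fin_num_measure.
- move=> F tF FP; split; first by apply: bigcupT_measurable => k; case: (FP k).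
  have mF k : measurable (F k) by case: (FP k).
  rewrite /indep_events setI_bigcupl measure_bigcup//; last 2 first.
  - by move=> k _; exact: measurableI.
  - exact: trivIset_setIr.
  rewrite measure_bigcup//.
  have [b Eb] : exists b, P B = b%:E.
    by exists (fine (P B)); rewrite fineK ?fin_num_measure.
  rewrite Eb muleC -nneseriesZl//.
  by apply: eq_eseriesr => k _; rewrite muleC -Eb; case: (FP k).
Qed.

End independence.

Section grouping.
Context d (T : measurableType d) (R : realType) (P : probability T R).
Context (I : choiceType) (C : I -> set (set T)).
Hypothesis C_meas : forall i, C i `<=` measurable.
Hypothesis C_I : forall i, setI_closed (C i).
Hypothesis C_T : forall i, C i setT.
Hypothesis C_indep : mutually_independent P C.
Local Open Scope ereal_scope.

Definition generated (J : set I) : set (set T) := <<s \bigcup_(i in J) C i >>.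

Definition cylinders (J : set I) : set (set T) :=
  [set A | exists (s : seq I) (f : I -> set T),
     [/\ uniq s, forall i, i \in s -> J i /\ C i (f i)
       & A = \bigcap_(i in [set` s]) f i]].

Lemma cylinders_measurable J : cylinders J `<=` measurable.
Proof.
move=> _ [s [f [_ sJ ->]]]; rewrite bigcap_seq; elim: s sJ => [|i s IH] sJ.
  by rewrite big_nil; exact: measurableT.
rewrite big_cons; apply: measurableI.
  by have [|_] := sJ i; [exact: mem_head|exact: C_meas].
by apply: IH => j js; apply: sJ; rewrite inE js orbT.
Qed.

Lemma cylinders_setI J : setI_closed (cylinders J).
Proof.
move=> _ _ [s [f [us sJ ->]]] [s' [f' [us' sJ' ->]]].
pose g i := (if i \in s then f i else setT) `&` (if i \in s' then f' i else setT).
exists (undup (s ++ s')), g; split; first exact: undup_uniq.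
- move=> i; rewrite mem_undup mem_cat => iss; split.
    by move: iss => /orP[/sJ|/sJ'] [].
  apply: C_I; first by case: ifPn => [/sJ[]|_].
  by case: ifPn => [/sJ'[]|_].
- apply/seteqP; split => w.
    move=> [h h'] i _; split; first by case: ifPn => // ins; exact: h.
    by case: ifPn => // ins; exact: h'.
  move=> h; split => i /= ins.
    have [] := h i; first by rewrite /= mem_undup mem_cat ins.
    by rewrite ins.
  have [] := h i; first by rewrite /= mem_undup mem_cat ins orbT.
  by rewrite ins.
Qed.

Lemma cylinders_generate J : \bigcup_(i in J) C i `<=` cylinders J.
Proof.
move=> A [i Ji CA]; exists [:: i], (fun=> A); split => //.
- by move=> j; rewrite inE => /eqP ->.
- by rewrite bigcap_seq big_seq1.
Qed.

Lemma cylinders_indep J1 J2 A B : [disjoint J1 & J2] ->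
  cylinders J1 A -> cylinders J2 B -> indep_events P A B.
Proof.
move=> dJ [s [f [us sJ ->]]] [s' [f' [us' sJ' ->]]].
have dis i : i \in s -> i \in s' -> False.
  move=> /sJ[J1i _] /sJ'[J2i _].
  have : (J1 `&` J2) i by split.
  by move/disj_setPS : dJ => /[apply].
pose g i := if i \in s then f i else f' i.
have gs' i : i \in s' -> g i = f' i.
  by move=> ins'; rewrite /g; case: ifPn => // ins; case: (dis i).
have gs i : i \in s -> g i = f i by rewrite /g => ->.
have PA : P (\bigcap_(i in [set` s]) f i) = \prod_(i <- s) P (g i).
  rewrite C_indep// => [|i /sJ[]//].
  by rewrite big_seq [RHS]big_seq; apply: eq_bigr => i ins; rewrite gs.
have PB : P (\bigcap_(i in [set` s']) f' i) = \prod_(i <- s') P (g i).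
  rewrite C_indep// => [|i /sJ'[]//].
  by rewrite big_seq [RHS]big_seq; apply: eq_bigr => i ins; rewrite gs'.
rewrite /indep_events PA PB -big_cat/= -C_indep//.
- congr (P _); apply/seteqP; split => w.
    move=> [h h'] i /=; rewrite mem_cat => /orP[ins|ins].
      by rewrite gs//; exact: h.
    by rewrite gs'//; exact: h'.
  move=> h; split => i /= ins.
    by rewrite -gs//; apply: h; rewrite /= mem_cat ins.
  by rewrite -gs'//; apply: h; rewrite /= mem_cat ins orbT.
- rewrite cat_uniq us us' andbT/=; apply/hasPn => i ins'.
  by apply/negP => /= ins; exact: (dis i).
- move=> i; rewrite mem_cat => /orP[ins|ins].
    by rewrite gs//; case: (sJ i ins).
  by rewrite gs'//; case: (sJ' i ins).
Qed.

Lemma generated_cylinders J : generated J `<=` <<s cylinders J >>.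
Proof. by apply: sub_smallest2r; [exact: smallest_sigma_algebra|exact: cylinders_generate]. Qed.

Lemma cylinders_sigma_measurable J : <<s cylinders J >> `<=` measurable.
Proof.
by apply: smallest_sub; [exact: sigma_algebra_measurable|exact: cylinders_measurable].
Qed.

Lemma generated_measurable J : generated J `<=` measurable.
Proof. exact: subset_trans (@generated_cylinders J) (@cylinders_sigma_measurable J). Qed.

(** [indep_sigma_algebra] extends the product rule from cylinders to one generated
    sigma-algebra, then to the other. *)
Lemma grouping J1 J2 A B : [disjoint J1 & J2] ->
  generated J1 A -> generated J2 B -> P (A `&` B) = P A * P B.
Proof.
move=> dJ /generated_cylinders GA GB.
have mB := generated_measurable GB.
apply: (indep_sigma_algebra (@cylinders_setI J1) (@cylinders_measurable J1) mB _ GA).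
move=> A' CA'.
have mA' := cylinders_measurable CA'.
suff : indep_events P B A' by rewrite /indep_events setIC muleC.
move/generated_cylinders : GB => GB.
apply: (indep_sigma_algebra (@cylinders_setI J2) (@cylinders_measurable J2) mA' _ GB).
move=> B' CB'; rewrite /indep_events setIC muleC.
exact: cylinders_indep dJ CA' CB'.
Qed.

End grouping.

Section sigma_rv_lemmas.
Context d (T : measurableType d) d' (U : measurableType d') (R : realType)
  (P : probability T R) (I : choiceType) (X : I -> {RV P >-> U}).

Lemma sigma_rv_measurable i : sigma_rv (X i) `<=` measurable.
Proof. by move=> _ [B mB <-]; exact: measurable_funP. Qed.

Lemma sigma_rv_setI i : setI_closed (sigma_rv (X i)).
Proof.
move=> _ _ [B mB <-] [B' mB' <-]; exists (B `&` B'); first exact: measurableI.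
by rewrite !setTI preimage_setI.
Qed.

Lemma sigma_rv_setT i : sigma_rv (X i) setT.
Proof. by exists setT => //; rewrite preimage_setT setTI. Qed.

Lemma generated_preimage (J : set I) i B : J i -> measurable B ->
  generated (fun i => sigma_rv (X i)) J (X i @^-1` B).
Proof.
move=> Ji mB; apply: sub_gen_smallest; exists i => //; exists B => //.
by rewrite setTI.
Qed.

Lemma generated_rv_measurable J :
  generated (fun i => sigma_rv (X i)) J `<=` measurable.
Proof. exact: (generated_measurable sigma_rv_measurable). Qed.

Hypothesis X_indep : mutually_independent P (fun i => sigma_rv (X i)).

Lemma grouping_rv J1 J2 A B : [disjoint J1 & J2] ->
  generated (fun i => sigma_rv (X i)) J1 A ->
  generated (fun i => sigma_rv (X i)) J2 B -> (P (A `&` B) = P A * P B)%E.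
Proof.
exact: (grouping sigma_rv_measurable sigma_rv_setI sigma_rv_setT X_indep).
Qed.

End sigma_rv_lemmas.

Section reflected_walk.
Context d (T : measurableType d) (R : realType) (P : probability T R).
Context (I : choiceType) (X : I -> {RV P >-> R}) (c : R) (nu : probability R R).
Hypothesis X_indep : mutually_independent P (fun i => sigma_rv (X i)).
Hypothesis X_law : forall i B, measurable B -> P (X i @^-1` B) = nu B.

(** Folding from the last edge back to the root yields the maximum over initial
    segments ([reflected_ge], [reflected_attained]). *)
Definition reflected (s : seq R) : R := foldr (fun a m => reflect_step c (m, a)) 0 s.

Notation gen J := (generated (fun i => sigma_rv (X i)) J).

Lemma generated_reflected (J : set I) (es : seq I) (B : set R) :
  (forall i, i \in es -> J i) -> measurable B ->
  gen J ((fun w => reflected [seq X i w | i <- es]) @^-1` B).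
Proof.
move=> esJ mB.
pose TJ := g_sigma_algebraType (\bigcup_(i in J) sigma_rv (X i)).
have mX i : J i -> measurable_fun (setT : set TJ) (X i : TJ -> R).
  by move=> Ji _ Y mY; rewrite setTI; exact: generated_preimage.
suff : measurable_fun (setT : set TJ) (fun w => reflected [seq X i w | i <- es]).
  by move=> /(_ measurableT _ mB); rewrite setTI.
elim: es esJ => [|i es IH] esJ /=; first exact: measurable_cst.
have {}IH := IH (fun j js => esJ j (@mem_behead _ (i :: es) j js)).
have mi : measurable_fun (setT : set TJ) (X i : TJ -> R).
  by apply: mX; apply: esJ; exact: mem_head.
exact: (measurableT_comp (measurable_reflect_step c) (measurable_fun_pair IH mi)).
Qed.

(** The first increment is independent of the reflected walk of the others, so that
    each edge contributes one step of [walk_law]; only the number of edges counts. *)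
Lemma reflected_law (es : seq I) (B : set R) : uniq es -> measurable B ->
  P ((fun w => reflected [seq X i w | i <- es]) @^-1` B) = walk_law c nu (size es) B.
Proof.
elim: es B => [|i es IH] B /=.
  move=> _ mB; rewrite diracE; case: (boolP (0 \in B)) => [|] h0.
    rewrite [X in P X](_ : _ = setT) ?probability_setT//.
    by rewrite -subTset => w _; rewrite /= inE in h0.
  rewrite [X in P X](_ : _ = set0) ?measure0//.
  by rewrite -subset0 => w /=; rewrite notin_setE in h0.
move=> /andP[ies ues] mB.
have mf : measurable_fun setT (fun w => reflected [seq X j w | j <- es]).
  move=> _ Y mY; rewrite setTI.
  by apply: (@generated_rv_measurable _ _ _ _ _ P _ X setT); exact: generated_reflected.
pose pr w := (reflected [seq X j w | j <- es], X i w).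
have mpr : measurable_fun setT pr.
  by apply: measurable_fun_pair => //; exact: measurable_funP.
pose prm : {mfun T >-> (R * R)%type} := mfun_Sub (mem_set mpr : pr \in mfun).
have joint A : measurable A -> (walk_law c nu (size es) \x nu)%E A = distribution P prm A.
  apply: product_measure_unique => Y Z mY mZ.
  transitivity (P ((fun w => reflected [seq X j w | j <- es]) @^-1` Y)
                * P (X i @^-1` Z))%E; last first.
    by congr (_ * _)%E; [exact: IH|exact: X_law].
  rewrite /distribution /pushforward.
  rewrite -(@grouping_rv _ _ _ _ _ _ _ _ X_indep [set` es] [set i]).
  - congr (P _).
  - by rewrite disj_set2E; apply/eqP; rewrite -subset0 => j [/= + ji]; rewrite ji (negbTE ies).
  - by apply: generated_reflected.
  - by apply: generated_preimage.
rewrite /= /distribution /pushforward joint.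
  by [].
rewrite -[X in measurable X]setTI; exact: (measurable_reflect_step c).
Qed.

End reflected_walk.

(** * Countably valued choices *)

Section sigma_closure.
Context d (T : measurableType d) (G : set (set T)).
Let TG := g_sigma_algebraType G.

Lemma gsigmaC (A : set T) : <<s G >> A -> <<s G >> (~` A).
Proof. by move=> GA; exact: (@measurableC _ TG A GA). Qed.

Lemma gsigmaU (A B : set T) : <<s G >> A -> <<s G >> B -> <<s G >> (A `|` B).
Proof. by move=> GA GB; exact: (@measurableU _ TG A B GA GB). Qed.

Lemma gsigmaI (A B : set T) : <<s G >> A -> <<s G >> B -> <<s G >> (A `&` B).
Proof. by move=> GA GB; exact: (@measurableI _ TG A B GA GB). Qed.

Lemma gsigmaT : <<s G >> setT.
Proof. exact: (@measurableT _ TG). Qed.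

Lemma gsigma_bigcup (V : countType) (F : V -> set T) :
  (forall v, <<s G >> (F v)) -> <<s G >> (\bigcup_v F v).
Proof.
move=> GF; apply: (@countable_bigcupT_measurable _ TG V F _ GF).
exact: countableP.
Qed.

Lemma gsigma_bigcap (V : countType) (F : V -> set T) :
  (forall v, <<s G >> (F v)) -> <<s G >> (\bigcap_v F v).
Proof.
move=> GF; rewrite -[X in <<s G >> X]setCK setC_bigcap; apply: gsigmaC.
by apply: gsigma_bigcup => v; exact: gsigmaC.
Qed.

Lemma gsigma_cst (p : Prop) : <<s G >> [set w | p].
Proof.
have [h|h] := pselect p.
  by rewrite (_ : [set _ | _] = setT); [exact: gsigmaT|apply/seteqP; split].
rewrite (_ : [set _ | _] = ~` setT); first exact: gsigmaC gsigmaT.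
by rewrite setCT; apply/seteqP; split.
Qed.

(** Choosing the admissible value of least code keeps the choice measurable. *)
Lemma measurable_selection (V : countType) (Q : V -> set T) :
  (forall v, <<s G >> (Q v)) -> (forall w, exists v, Q v w) ->
  exists f : T -> V, (forall w, Q (f w) w) /\
    forall v, <<s G >> [set w | f w = v].
Proof.
move=> mQ exQ.
have /choice[f Hf] : forall w, exists v, Q v w /\
    forall u, Q u w -> (pickle v <= pickle u)%N.
  move=> w; have [v0 Qv0] := exQ w.
  have exP : exists n, `[< exists2 v, pickle v = n & Q v w >].
    by exists (pickle v0); apply/asboolP; exists v0.
  case: (ex_minnP exP) => n /asboolP[v vn Qv] min.
  exists v; split=> // u Qu; rewrite vn; apply: min.
  by apply/asboolP; exists u.
exists f; split; first by move=> w; case: (Hf w).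
move=> v; rewrite (_ : [set w | f w = v] = Q v `&`
    \bigcap_u (~` (Q u `&` [set _ | (pickle u < pickle v)%N]))).
  apply: gsigmaI => //; apply: gsigma_bigcap => u; apply: gsigmaC.
  by apply: gsigmaI => //; exact: gsigma_cst.
apply/seteqP; split => w.
  move=> <-; have [Qf min] := Hf w; split => // u _ [/min].
  by rewrite leqNgt => /negP.
move=> [Qv /(_ (f w) I) nlt]; have [Qf min] := Hf w.
apply: (pcan_inj (@pickleK V)); apply/eqP; rewrite eqn_leq min//=.
by rewrite leqNgt; apply/negP => lt; exact: nlt.
Qed.

End sigma_closure.

Section freezing.
Context d (T : measurableType d) (R : realType) (P : probability T R).
Context (V : countType) (f : T -> V) (B : V -> set T).
Hypothesis mf : forall v, measurable [set w | f w = v].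
Hypothesis mB : forall v, measurable (B v).
Hypothesis fB : forall v, (P ([set w | f w = v] `&` B v) = P [set w | f w = v] * P (B v))%E.
Local Open Scope ereal_scope.

Let D n : set T := [set w | pickle (f w) = n].

Let DE n : D n = if pickle_inv n is Some v then [set w | f w = v] else set0.
Proof.
have := @pickle_invK V n; case e: (pickle_inv n) => [v|] /= h.
  rewrite -h; apply/seteqP; split => w /=; rewrite /D /=; last by move=> ->.
  exact: (pcan_inj (@pickleK V)).
by rewrite -subset0 => w; rewrite /D /= => en; move: e; rewrite -en pickleK_inv.
Qed.

Let mD n : measurable (D n).
Proof. by rewrite DE; case: pickle_inv. Qed.

Let D_triv : trivIset setT D.
Proof. by move=> i j _ _ [w [/= <- <-]]. Qed.

Let D_cover : \bigcup_n D n = setT.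
Proof. by rewrite -subTset => w _; exists (pickle (f w)). Qed.

Let BD n : D n `&` [set w | B (f w) w] =
  if pickle_inv n is Some v then [set w | f w = v] `&` B v else set0.
Proof.
rewrite DE; case: pickle_inv => [v|]; last by rewrite set0I.
by apply/seteqP; split => w /= [<-].
Qed.

Let mBD n : measurable (D n `&` [set w | B (f w) w]).
Proof. by rewrite BD; case: pickle_inv => [v|//]; exact: measurableI. Qed.

Let B_cover : [set w | B (f w) w] = \bigcup_n (D n `&` [set w | B (f w) w]).
Proof. by rewrite -setI_bigcupl D_cover setTI. Qed.

Lemma measurable_freeze : measurable [set w | B (f w) w].
Proof. by rewrite B_cover; exact: bigcupT_measurable. Qed.

Lemma measurable_fun_discrete (g : V -> \bar R) :
  measurable_fun setT (fun w => g (f w)).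
Proof.
move=> _ Y mY; rewrite setTI.
rewrite (_ : _ @^-1` _ = \bigcup_(v in [set v | Y (g v)]) [set w | f w = v]).
  rewrite bigcup_mkcond; apply: countable_bigcupT_measurable; first exact: countableP.
  by move=> v; case: ifPn.
by apply/seteqP; split => [w /= Yw|w /= [v Yv ->]] //; exists (f w).
Qed.

(** Split according to the value of [f], independent of each of the events [B v]. *)
Lemma freeze : P [set w | B (f w) w] = \int[P]_w P (B (f w)).
Proof.
rewrite {1}B_cover measure_bigcup//; last exact: trivIset_setIr.
rewrite -[X in \int[P]_(_ in X) _]D_cover ge0_integral_bigcup//; last first.
  by apply: measurable_funTS; exact: (measurable_fun_discrete (fun v => P (B v))).
rewrite (eq_eseriesl (Q := xpredT)); last by move=> i; rewrite in_setT.
apply: eq_eseriesr => n _; rewrite BD DE; case: pickle_inv => [v|]; last first.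
  by rewrite measure0 integral_set0.
rewrite (eq_integral (cst (P (B v)))); last by move=> w; rewrite inE => <-.
by rewrite integral_cst// muleC; exact: fB.
Qed.

End freezing.

(** * Combinatorics and measurability of the tree *)

Section tree_combinatorics.
Variable z : nat -> nat -> nat.
Implicit Types (n i j k : nat) (v : seq nat).
Local Open Scope nat_scope.

Notation vertex v k := (nth 0 (0 :: v) k).

Definition path_edges v : seq (nat * nat) :=
  [seq (nth 0 v k, k.+1) | k <- iota 0 (size v)].

Lemma leq_partial_sums (f : nat -> nat) (a b : nat) :
  a <= b -> \sum_(l < a) f l <= \sum_(l < b) f l.
Proof.
move=> ab; rewrite -!(big_mkord xpredT) [leqRHS](big_cat_nat (n := a))//=.
exact: leq_addr.
Qed.

Lemma is_child_inj n j j' i : is_child z n j i -> is_child z n j' i -> j = j'.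
Proof.
rewrite /is_child => /andP[h1 h2] /andP[h3 h4].
have [jj|jj|//] := ltngtP j j'.
  by have := leq_partial_sums (z n) jj; lia.
by have := leq_partial_sums (z n) jj; lia.
Qed.

Lemma parent_exists n i : i < gen_size z n.+1 ->
  exists2 j, j < gen_size z n & is_child z n j i.
Proof.
rewrite /=; elim: (gen_size z n) => [|m IH]; first by rewrite big_ord0.
move=> h; have [lt|ge] := ltnP i (\sum_(j < m) z n j).
  by have [j jm ch] := IH lt; exists j => //; exact: ltnW.
by exists m => //; rewrite /is_child ge h.
Qed.

Lemma child_lt n i j : i < gen_size z n -> is_child z n i j -> j < gen_size z n.+1.
Proof.
move=> i_n /andP[_ h]; apply: leq_trans h _ => /=.
exact: (leq_partial_sums (z n) i_n).
Qed.

Lemma root_path_rcons v i : root_path z v ->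
  i < gen_size z (size v).+1 -> is_child z (size v) (vertex v (size v)) i ->
  root_path z (rcons v i).
Proof.
move=> rv ilt ch k; rewrite size_rcons ltnS leq_eqVlt => /predU1P[->|kv].
  rewrite nth_rcons ltnn eqxx; split=> //.
  rewrite (_ : nth 0 (0 :: rcons v i) (size v) = vertex v (size v))//.
  by rewrite -rcons_cons nth_rcons /= ltnS leqnn.
have [h1 h2] := rv k kv; rewrite nth_rcons kv; split=> //.
rewrite (_ : nth 0 (0 :: rcons v i) k = vertex v k)//.
by rewrite -rcons_cons nth_rcons /= ltnS ltnW.
Qed.

Lemma root_path_take v k : root_path z v -> root_path z (take k v).
Proof.
move=> rv j; rewrite size_take_min => jlt.
have [h1 h2] := rv j ltac:(lia).
rewrite nth_take; last lia.
rewrite -[0 :: take k v]/(take k.+1 (0 :: v)) nth_take; last lia.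
by [].
Qed.

Lemma root_path_vertex_lt v : root_path z v -> vertex v (size v) < gen_size z (size v).
Proof.
case: v => [//|a v] rv; have [] := rv (size v) (leqnn _).
by [].
Qed.

Lemma root_path_to n i : i < gen_size z n ->
  exists v, [/\ root_path z v, size v = n & vertex v n = i].
Proof.
elim: n i => [|n IH] i; first by rewrite ltnS leqn0 => /eqP ->; exists [::].
move=> ilt; have [j jn ch] := parent_exists ilt.
have [v [rv sv vj]] := IH j jn; exists (rcons v i); split.
- by apply: root_path_rcons => //; rewrite sv// vj.
- by rewrite size_rcons sv.
- by rewrite -rcons_cons -sv nth_rcons /= ltnn eqxx.
Qed.

(** The children of successive vertices are numbered consecutively, so that a vertex
    has only one parent. *)
Lemma root_path_meet v v' k : root_path z v -> root_path z v' ->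
  k <= size v -> k <= size v' -> vertex v k = vertex v' k ->
  forall j, j <= k -> vertex v j = vertex v' j.
Proof.
move=> rv rv'; elim: k => [|k IH] kv kv' e j; first by rewrite leqn0 => /eqP ->.
rewrite leq_eqVlt => /predU1P[->//|]; rewrite ltnS => jk.
apply: IH => //; [exact: ltnW|exact: ltnW|].
have [_ c1] := rv k kv; have [_ c2] := rv' k kv'.
by apply: is_child_inj c1 _; move: e => /= ->.
Qed.

Lemma root_path_eq v v' : root_path z v -> root_path z v' ->
  size v = size v' -> vertex v (size v) = vertex v' (size v) -> v = v'.
Proof.
move=> rv rv' ss e; apply: (@eq_from_nth _ 0) => // i iv.
by apply: (root_path_meet rv rv' (leqnn _) _ e iv); rewrite ss.
Qed.

Lemma root_path_list n : exists V : seq (seq nat),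
  size V = gen_size z n /\ forall v, root_path z v -> size v = n -> v \in V.
Proof.
have /choice[p Hp] : forall i, exists v, i < gen_size z n ->
    [/\ root_path z v, size v = n & vertex v n = i].
  move=> i; have [/root_path_to[v ?]|ge] := ltnP i (gen_size z n); first by exists v.
  by exists [::].
exists [seq p i | i <- iota 0 (gen_size z n)]; split.
  by rewrite size_map size_iota.
move=> v rv sv; have ilt := root_path_vertex_lt rv; rewrite sv in ilt.
have [r1 s1 e1] := Hp _ ilt.
rewrite (_ : v = p (vertex v n)); last by apply: root_path_eq; rewrite // sv.
by apply: map_f; rewrite mem_iota.
Qed.

Hypothesis z_gt0 : forall n j, 0 < z n j.

Lemma root_path_extend v : root_path z v -> exists i, root_path z (rcons v i).
Proof.
move=> rv; pose j := vertex v (size v).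
exists (\sum_(l < j) z (size v) l).
have ch : is_child z (size v) j (\sum_(l < j) z (size v) l).
  rewrite /is_child leqnn big_ord_recr/=.
  by rewrite -[X in X < _]addn0 ltn_add2l.
by apply: root_path_rcons => //; apply: child_lt ch; exact: root_path_vertex_lt.
Qed.

Lemma root_path_extend_to v n : root_path z v -> size v <= n ->
  exists v', [/\ root_path z v', size v' = n & take (size v) v' = v].
Proof.
move=> rv; elim: n => [|n IH].
  by rewrite leqn0 => /eqP s0; exists v; rewrite take_size.
rewrite leq_eqVlt => /predU1P[<-|]; first by exists v; rewrite take_size.
rewrite ltnS => /[dup] vn /IH[v' [rv' sv' tv']].
have [i rvi] := root_path_extend rv'; exists (rcons v' i); split => //.
  by rewrite size_rcons sv'.
by rewrite -cats1 takel_cat// sv'.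
Qed.

Lemma gen_size_leqS n : gen_size z n <= gen_size z n.+1.
Proof.
rewrite /=; apply: (@leq_trans (\sum_(j < gen_size z n) 1)).
  by rewrite sum1_card card_ord.
by apply: leq_sum => i _; exact: z_gt0.
Qed.

(** Distinctness of the vertices in generation [g] makes the later edges of the
    listed paths disjoint; see [path_edges_disjoint]. *)
Lemma ray_list g n N : exists V : seq (seq nat),
  [/\ size V = minn (gen_size z g) N,
      forall v, v \in V -> root_path z v /\ size v = g + n
    & uniq [seq vertex v g | v <- V]].
Proof.
have /choice[p Hp] : forall i, exists v, i < gen_size z g ->
    [/\ root_path z v, size v = g + n & vertex v g = i].
  move=> i; have [/root_path_to[v [rv sv vi]]|ge] := ltnP i (gen_size z g); last first.
    by exists [::].
  have [|v' [rv' sv' tv']] := @root_path_extend_to v (g + n) rv.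
    by rewrite sv leq_addr.
  exists v' => _; split => //; rewrite -vi -tv' sv.
  by rewrite -[0 :: take g v']/(take g.+1 (0 :: v')) nth_take.
set m := minn _ N; have mg : m <= gen_size z g by exact: geq_minl.
exists [seq p i | i <- iota 0 m]; split.
- by rewrite size_map size_iota.
- move=> v /mapP[i]; rewrite mem_iota add0n => /andP[_ im] ->.
  by have [] := Hp i (leq_trans im mg).
- rewrite -map_comp (_ : map _ _ = iota 0 m) ?iota_uniq//.
  rewrite -[RHS]map_id; apply/eq_in_map => i; rewrite mem_iota add0n => /andP[_ im] /=.
  by have [] := Hp i (leq_trans im mg).
Qed.

Lemma path_edges_uniq v : uniq (path_edges v).
Proof.
rewrite map_inj_uniq ?iota_uniq// => i j [_].
by [].
Qed.

(** A common later edge would end in a common vertex, and give the two paths the same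
    ancestor in generation [g]. *)
Lemma path_edges_disjoint g v v' : root_path z v -> root_path z v' ->
  size v = size v' -> vertex v g <> vertex v' g ->
  forall e, e \in drop g (path_edges v) -> e \notin drop g (path_edges v').
Proof.
move=> rv rv' ss ne e; rewrite /path_edges -!map_drop !drop_iota add0n.
move=> /mapP[k]; rewrite mem_iota => /andP[gk kv] ->.
apply/negP => /mapP[k' _ [e1 e2]]; subst k'; apply: ne.
by apply: (root_path_meet (k := k.+1) rv rv') => //; lia.
Qed.

End tree_combinatorics.

Section tree_measurability.
Context d (T : measurableType d) (R : realType) (P : probability T R).
Variable zeta : nat -> nat -> {RV P >-> nat}.
Notation gen J := (generated (fun nj : nat * nat => sigma_rv (zeta nj.1 nj.2)) J).
Notation tree w := (fun m j => zeta m j w).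
Implicit Types (J : set (nat * nat)) (n m j : nat) (v : seq nat).

Lemma gen_offspring_sum J m k (Y : set nat) : (forall j, J (m, j)) ->
  gen J [set w | Y (\sum_(l < k) zeta m l w)%N].
Proof.
move=> Jm.
pose TJ := g_sigma_algebraType
  (\bigcup_(nj in J) sigma_rv (zeta nj.1 nj.2)).
have mz j : measurable_fun (setT : set TJ) (zeta m j : TJ -> nat).
  by move=> _ B mB; rewrite setTI; exact: (@generated_preimage _ _ _ _ _ _ _ (fun nj => zeta nj.1 nj.2) J (m, j)).
have : measurable_fun (setT : set TJ) (fun w => \sum_(l < k) zeta m l w)%N.
  elim: k => [|k IH].
    rewrite (_ : (fun w => _) = cst 0%N); first exact: measurable_cst.
    by apply/funext => w; rewrite big_ord0.
  rewrite (_ : (fun w => _) = (fun w => (\sum_(l < k) zeta m l w + zeta m k w)%N)).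
    exact: measurable_fun_addn.
  by apply/funext => w; rewrite big_ord_recr.
by move=> /(_ measurableT Y I); rewrite setTI.
Qed.

Lemma gen_gen_size J n (Y : set nat) : (forall m j, (m < n)%N -> J (m, j)) ->
  gen J [set w | Y (gen_size (tree w) n)].
Proof.
elim: n Y => [|n IH] Y Jn; first exact: (@gsigma_cst _ _ _ (Y 1%N)).
rewrite (_ : [set w | _] = \bigcup_k ([set w | [set k] (gen_size (tree w) n)] `&`
   [set w | Y (\sum_(l < k) zeta n l w)%N])).
  apply: gsigma_bigcup => k; apply: gsigmaI.
    by apply: IH => m j mn; apply: Jn; exact: ltnW.
  by apply: gen_offspring_sum => j; exact: Jn.
apply/seteqP; split => w /=; first by move=> Yw; exists (gen_size (tree w) n).
by move=> [k _ [/= -> ]].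
Qed.

Lemma gen_is_child n j i : gen setT [set w | is_child (tree w) n j i].
Proof.
rewrite (_ : [set w | _] =
  [set w | [set s | (s <= i)%N] (\sum_(l < j) zeta n l w)%N] `&`
  [set w | [set s | (i < s)%N] (\sum_(l < j.+1) zeta n l w)%N]).
  by apply: gsigmaI; exact: gen_offspring_sum.
by apply/seteqP; split => w; rewrite /is_child /= => /andP.
Qed.

Lemma gen_root_path v : gen setT [set w | root_path (tree w) v].
Proof.
rewrite (_ : [set w | _] = \bigcap_k (~` [set w | (k < size v)%N] `|`
  ([set w | [set s | (nth 0 v k < s)%N] (gen_size (tree w) k.+1)] `&`
   [set w | is_child (tree w) k (nth 0 (0 :: v) k) (nth 0 v k)]))%N).
  apply: gsigma_bigcap => k; apply: gsigmaU.
    by apply: gsigmaC; exact: gsigma_cst.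
  by apply: gsigmaI; [exact: gen_gen_size|exact: gen_is_child].
apply/seteqP; split => w /= rv.
  move=> k _; have [kv|kv] := boolP (k < size v)%N; last by left => /=; exact/negP.
  by right; have [] := rv k kv.
by move=> k kv; case: (rv k I) => //= -[].
Qed.

End tree_measurability.

(** * Mean and limit of the generation sizes *)

Section branching_means.
Context d (T : measurableType d) (R : realType) (P : probability T R).
Variable offspring : nat -> probability nat R.
Variable zeta : nat -> nat -> {RV P >-> nat}.
Hypothesis zeta_law : forall (n j : nat) (A : set nat),
  distribution P (zeta n j) A = offspring n A.
Hypothesis zeta_seq_indep :
  mutually_independent P (fun n : nat => sigma_family (fun j : nat => zeta n j)).
Hypothesis zeta_ge1 : forall n : nat, {ae P, forall w, (1 <= zeta n 0%N w)%N}.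
Hypothesis L_finite : (mean_product P zeta < +oo)%E.
Notation tree w := (fun m j => zeta m j w).
Notation gen J := (generated (fun nj : nat * nat => sigma_rv (zeta nj.1 nj.2)) J).
Notation Z n := (fun w => gen_size (tree w) n).
Notation mean n := ('E_P[fun w => (zeta n 0%N w)%:R])%E.
Local Open Scope ereal_scope.

Lemma gen_measurable J A : gen J A -> measurable A.
Proof.
move: A; apply: (@generated_rv_measurable _ _ _ _ R P _ (fun nj : nat * nat => zeta nj.1 nj.2)).
Qed.

Lemma nneseries_below (a : nat -> R) (m : nat) : (forall j, 0 <= a j)%R ->
  \sum_(j <oo) ((j < m)%N%:R * a j)%:E = (\sum_(j < m) a j)%R%:E.
Proof.
move=> a0; apply/cvg_lim => //; apply: cvg_near_cst; near=> N.
have mN : (m <= N)%N by near: N; exact: nbhs_infty_ge.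
rewrite sumEFin; congr (_%:E); rewrite (big_cat_nat (n := m))//=.
rewrite [X in (_ + X)%R]big1_seq ?addr0; last first.
  by move=> i /andP[_]; rewrite mem_index_iota => /andP[mi _]; rewrite ltnNge mi mul0r.
rewrite big_mkord; apply: eq_bigr => i _.
by rewrite ltn_ord mul1r.
Unshelve. all: end_near. Qed.

Lemma natr_nneseries (m : nat) : (m%:R)%:E = \sum_(k <oo) (((k < m)%N)%:R : R)%:E.
Proof.
have -> : (m%:R : R)%:E = (\sum_(j < m) (1 : R))%R%:E.
  by rewrite sumr_const card_ord.
rewrite -(@nneseries_below (fun=> 1%R))//; apply: eq_eseriesr => k _.
by rewrite mulr1.
Qed.

Lemma Z_measurable n (A : set nat) : measurable [set w | A (Z n w)].
Proof. by apply: (@gen_measurable setT); exact: gen_gen_size. Qed.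

Lemma measurable_zeta_event n j (A : set nat) : measurable [set w | A (zeta n j w)].
Proof. by have := @measurable_funPTI _ _ _ _ (zeta n j) A; apply. Qed.

Lemma expectation_nat (X : T -> nat) : (forall A : set nat, measurable [set w | A (X w)]) ->
  'E_P[fun w => (X w)%:R] = \sum_(k <oo) P [set w | (k < X w)%N].
Proof.
move=> mX; rewrite unlock.
under eq_integral do rewrite natr_nneseries.
rewrite integral_nneseries//; last first.
  move=> k; apply/measurable_EFinP.
  rewrite (_ : (fun w => _) = \1_[set w | (k < X w)%N]).
    by apply: measurable_indic; exact: (mX [set m | (k < m)%N]).
  by apply/funext => w; rewrite indicE mem_setE.
apply: eq_eseriesr => k _.
rewrite -[X in P X]setIT -integral_indic//; last exact: (mX [set m | (k < m)%N]).
by apply: eq_integral => w _; rewrite indicE mem_setE.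
Qed.

Lemma zeta_tail n j k : P [set w | (k < zeta n j w)%N] = P [set w | (k < zeta n 0 w)%N].
Proof.
by have := zeta_law n j [set m | (k < m)%N]; rewrite -(zeta_law n 0).
Qed.

Lemma generation_indep n A B : gen [set nj | (nj.1 < n)%N] A ->
  gen [set nj | nj.1 = n] B -> P (A `&` B) = P A * P B.
Proof.
pose C n := sigma_family (fun j : nat => zeta n j).
have CE m : C m = generated (fun j => sigma_rv (zeta m j)) setT by [].
have sub J : gen J `<=` generated C [set m | exists j, J (m, j)].
  apply: smallest_sub; first exact: smallest_sigma_algebra.
  move=> D [[m j] Jmj Dm]; apply: sub_gen_smallest; exists m; first by exists j.
  by apply: sub_gen_smallest; exists j.
move=> /sub GA /sub GB.
apply: (grouping _ _ _ zeta_seq_indep _ GA GB).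
- by move=> m; rewrite -/(C m) CE; apply: (@generated_rv_measurable _ _ _ _ R P _ (zeta m)).
- by move=> m D D'; exact: gsigmaI.
- by move=> m; exact: gsigmaT.
- rewrite disj_set2E; apply/eqP; rewrite -subset0 => m [[j /= mn] [j' /= e]].
  by move: mn; rewrite e ltnn.
Qed.

(** Wald's identity.  The generation size and the offspring numbers are expanded
    into indicators, of [j < Z_n] and of [k < zeta n j]; the former depends on
    earlier generations only. *)
Lemma mean_gen_sizeS n : mean n \is a fin_num ->
  'E_P[bp_size R zeta n.+1] = 'E_P[bp_size R zeta n] * mean n.
Proof.
move=> fin; rewrite (expectation_nat (X := Z n)); last exact: Z_measurable.
rewrite muleC -(fineK fin) -nneseriesZl// (fineK fin).
have -> : 'E_P[bp_size R zeta n.+1] = \int[P]_w (bp_size R zeta n.+1 w)%:E by rewrite unlock.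
have E w : (bp_size R zeta n.+1 w)%:E =
    \sum_(j <oo) \sum_(k <oo) ((j < Z n w)%N%:R * (k < zeta n j w)%N%:R)%:E.
  rewrite /bp_size /= natr_sum -(@nneseries_below (fun j => (zeta n j w)%:R))//.
  apply: eq_eseriesr => j _; rewrite EFinM (natr_nneseries (zeta n j w)) -nneseriesZl//.
under eq_integral do rewrite E.
pose A j := [set w | (j < Z n w)%N]; pose B j k := [set w | (k < zeta n j w)%N].
have mA j : measurable (A j) by exact: (Z_measurable n [set m | (j < m)%N]).
have mB j k : measurable (B j k) by exact: (measurable_zeta_event n j [set m | (k < m)%N]).
have indE j k : (fun w => ((j < Z n w)%N%:R * (k < zeta n j w)%N%:R)%:E) =
    (fun w => (\1_(A j `&` B j k) w : R)%:E).
  by apply/funext => w; rewrite indicI /= !indicE !mem_setE.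
have mjk j k : measurable_fun setT
    (fun w => ((j < Z n w)%N%:R * (k < zeta n j w)%N%:R : R)%:E).
  rewrite indE; apply/measurable_EFinP; apply: measurable_indic.
  exact: measurableI.
rewrite integral_nneseries//; last 2 first.
- by move=> j; apply: ge0_emeasurable_sum => // k w _ _; rewrite lee_fin.
- by move=> j w _; apply: nneseries_ge0 => k _ _; rewrite lee_fin.
apply: eq_eseriesr => j _.
rewrite integral_nneseries//.
rewrite (expectation_nat (X := zeta n 0)); last exact: measurable_zeta_event.
have fj : P (A j) \is a fin_num by rewrite fin_num_measure.
rewrite muleC -(fineK fj) -nneseriesZl// (fineK fj).
apply: eq_eseriesr => k _.
rewrite indE integral_indic//; last exact: measurableI.
rewrite setIT.
transitivity (P (A j) * P (B j k)); last by congr (_ * _); exact: zeta_tail.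
apply: (@generation_indep n).
- by apply: (@gen_gen_size _ _ _ _ zeta _ n [set m | (j < m)%N]) => m i.
- exact: (@generated_preimage _ _ _ _ _ P _ (fun nj : nat * nat => zeta nj.1 nj.2)
    _ (n, j) [set m | (k < m)%N]).
Qed.

Definition all_fertile : set T := [set w | forall n j, (0 < zeta n j w)%N].

Lemma all_fertile_ae : {ae P, forall w, all_fertile w}.
Proof.
apply: ae_foralln => n; apply: ae_foralln => j.
have P0 : P [set w | zeta n j w = 0%N] = 0.
  have -> : P [set w | zeta n j w = 0%N] = P [set w | zeta n 0 w = 0%N].
    by have := zeta_law n j [set 0%N]; rewrite -(zeta_law n 0).
  apply: measure_negligible.
    exact: (measurable_zeta_event n 0 [set 0%N]).
  apply: negligibleS (zeta_ge1 n) => w /= -> .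
  by [].
exists [set w | zeta n j w = 0%N]; split => //.
  exact: (measurable_zeta_event n j [set 0%N]).
by move=> w /= /negP; rewrite -eqn0Ngt => /eqP.
Qed.

Lemma gen_all_fertile : gen setT all_fertile.
Proof.
rewrite (_ : all_fertile = \bigcap_n \bigcap_j [set w | [set m | (0 < m)%N] (zeta n j w)]).
  apply: gsigma_bigcap => n; apply: gsigma_bigcap => j.
  exact: (@generated_preimage _ _ _ _ _ P _ (fun nj : nat * nat => zeta nj.1 nj.2)
    setT (n, j) [set m | (0 < m)%N]).
by apply/seteqP; split => w /= h n; [move=> _ j _; exact: h|move=> j; exact: (h n I j I)].
Qed.

Lemma mean_ge1 n : 1 <= mean n.
Proof.
rewrite (expectation_nat (X := zeta n 0)); last exact: measurable_zeta_event.
apply: (@le_trans _ _ (\sum_(0 <= k < 1) P [set w | (k < zeta n 0 w)%N])); last first.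
  by apply: nneseries_lim_ge => k _ _; exact: measure_ge0.
rewrite big_nat1.
have m0 : measurable [set w | zeta n 0 w = 0%N].
  exact: (measurable_zeta_event n 0 [set 0%N]).
have -> : [set w | (0 < zeta n 0 w)%N] = ~` [set w | zeta n 0 w = 0%N].
  apply/seteqP; split => w /=; first by move=> h e; rewrite e in h.
  by move=> /eqP; rewrite -lt0n.
rewrite probability_setC// [X in _ - X](_ : _ = 0) ?sube0//.
apply: measure_negligible => //.
by apply: negligibleS (zeta_ge1 n) => w /= ->.
Qed.

Let pr n := \prod_(0 <= k < n) mean k.

Let pr_ge1 n : 1 <= pr n.
Proof.
elim: n => [|n IH]; first by rewrite /pr big_nil.
rewrite /pr big_nat_recr//= -[leLHS]mule1; apply: lee_pmul => //.
exact: mean_ge1.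
Qed.

Let pr_nd : nondecreasing_seq pr.
Proof.
apply/nondecreasing_seqP => n; rewrite /pr big_nat_recr//= -[leLHS]mule1.
apply: lee_wpmul2l; last exact: mean_ge1.
exact: le_trans (pr_ge1 n).
Qed.

Let pr_cvg : pr @ \oo --> mean_product P zeta.
Proof. exact: (ereal_nondecreasing_is_cvgn pr_nd). Qed.

Let pr_le n : pr n <= mean_product P zeta.
Proof.
rewrite /mean_product (cvg_lim _ (ereal_nondecreasing_cvgn pr_nd))//.
by apply: ereal_sup_ubound; exists n.
Qed.

Let pr_fin n : pr n \is a fin_num.
Proof.
rewrite ge0_fin_numE; last exact: le_trans (pr_ge1 n).
exact: le_lt_trans (pr_le n) L_finite.
Qed.

Lemma mean_fin n : mean n \is a fin_num.
Proof.
rewrite ge0_fin_numE; last exact: le_trans (mean_ge1 n).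
apply: le_lt_trans L_finite; apply: le_trans (pr_le n.+1).
rewrite /pr big_nat_recr//= -[leLHS]mul1e; apply: lee_wpmul2r (pr_ge1 n).
exact: le_trans (mean_ge1 n).
Qed.

Lemma mean_gen_size n : 'E_P[bp_size R zeta n] = pr n.
Proof.
elim: n => [|n IH].
  rewrite /pr big_nil (_ : bp_size _ _ _ = cst 1%R) ?expectation_cst//.
by rewrite mean_gen_sizeS ?mean_fin// IH /pr big_nat_recr.
Qed.

Definition mean_limit : R := fine (mean_product P zeta).
Definition mean_size n : R := fine 'E_P[bp_size R zeta n].

Lemma mean_product_fin : mean_product P zeta \is a fin_num.
Proof.
rewrite ge0_fin_numE//; apply: le_trans (pr_le 0).
exact: le_trans (pr_ge1 0).
Qed.

Lemma mean_sizeE n : 'E_P[bp_size R zeta n] = (mean_size n)%:E.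
Proof. by rewrite /mean_size fineK// mean_gen_size. Qed.

Lemma mean_size_ge0 n : (0 <= mean_size n)%R.
Proof. by rewrite -lee_fin -mean_sizeE mean_gen_size (le_trans _ (pr_ge1 n)). Qed.

Lemma mean_size_le n : (mean_size n <= mean_limit)%R.
Proof.
by rewrite -lee_fin -mean_sizeE /mean_limit fineK ?mean_product_fin// mean_gen_size.
Qed.

Lemma mean_limit_ge1 : (1 <= mean_limit)%R.
Proof.
apply: le_trans (mean_size_le 0).
by rewrite -lee_fin -mean_sizeE mean_gen_size.
Qed.

Lemma mean_size_cvg e : (0 < e)%R ->
  exists n0, forall n, (n0 <= n)%N -> (mean_limit - e <= mean_size n)%R.
Proof.
move=> e0; have : pr @ \oo --> mean_limit%:E by rewrite fineK ?mean_product_fin//; exact: pr_cvg.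
move=> /fine_cvgP[_ cv].
have [|N _ H] := cvgr_ge _ cv (mean_limit - e)%R; first by rewrite ltrBlDr ltrDl.
by exists N => n Nn; have := H n Nn; rewrite /= /mean_size mean_gen_size.
Qed.

End branching_means.

Lemma bounded_nondecreasing_nat (u : nat -> nat) (B : nat) :
  (forall n, u n <= u n.+1)%N -> (forall n, u n <= B)%N ->
  exists N, forall n, (N <= n)%N -> u n = u N.
Proof.
move=> uS uB.
have exP : exists m, `[< exists n, u n = m >] by exists (u 0%N); apply/asboolP; exists 0%N.
have ubP m : `[< exists n, u n = m >] -> (m <= B)%N by move=> /asboolP[n <-].
case: (ex_maxnP exP ubP) => m /asboolP[N uN] max.
have mono := @homo_leq _ u leq leqnn leq_trans uS.
exists N => n Nn; apply/eqP; rewrite eqn_leq (mono N n Nn) andbT uN.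
by apply: max; apply/asboolP; exists n.
Qed.

Lemma natr_dist_lt1 (R : realDomainType) (a b : nat) :
  `|a%:R - b%:R| < 1 :> R -> a = b.
Proof.
rewrite ltr_norml ltrBrDr ltrBlDr => /andP[h1 h2].
apply/eqP; rewrite eqn_leq -[(a <= b)%N]ltnS -[(b <= a)%N]ltnS.
rewrite -!(ltr_nat R) -!natr1 [X in X && _](_ : _ = true) /=.
  by rewrite -ltrBlDr addrC.
by rewrite addrC.
Qed.

Section branching_limit.
Context d (T : measurableType d) (R : realType) (P : probability T R).
Variable offspring : nat -> probability nat R.
Variable zeta : nat -> nat -> {RV P >-> nat}.
Hypothesis zeta_law : forall (n j : nat) (A : set nat),
  distribution P (zeta n j) A = offspring n A.
Hypothesis zeta_seq_indep :
  mutually_independent P (fun n : nat => sigma_family (fun j : nat => zeta n j)).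
Hypothesis zeta_ge1 : forall n : nat, {ae P, forall w, (1 <= zeta n 0%N w)%N}.
Hypothesis L_finite : (mean_product P zeta < +oo)%E.
Notation tree w := (fun m j => zeta m j w).
Notation Z n := (fun w => gen_size (tree w) n).
Notation Omega := (all_fertile zeta).
Local Open Scope ereal_scope.

(** Integer sizes converge only by becoming constant; [None] stands for the trees on
    which they do not. *)
Definition settles (o : option nat) : set T :=
  if o is Some k then [set w | exists N, forall n, (N <= n)%N -> Z n w = k]
  else [set w | forall k, ~ exists N, forall n, (N <= n)%N -> Z n w = k].

Lemma limit_settles w k : settles (Some k) w -> bp_limit R zeta w = k%:R.
Proof.
move=> [N H]; apply/cvg_lim => //; apply: cvg_near_cst; near=> n.
by rewrite /bp_size H//; near: n; exact: nbhs_infty_ge.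
Unshelve. all: end_near. Qed.

(** All divergent sequences have the same default limit, which makes [bp_limit] a
    function of the countably valued [settles] class. *)
Lemma limit_unsettled w w' : settles None w -> settles None w' ->
  bp_limit R zeta w = bp_limit R zeta w'.
Proof.
have nocv v : settles None v -> forall l : R, ~ (bp_size R zeta n v @[n --> \oo] --> l).
  move=> nv l cv; have h0 : (0 < 2^-1 :> R)%R by [].
  move/cvgrPdist_lt : cv => /(_ _ h0)[N _ HN].
  apply: (nv (Z N v)); exists N => n Nn.
  have := HN n Nn; have := HN N (leqnn N); rewrite /= /bp_size => a b.
  have : (`|(Z n v)%:R - (Z N v)%:R| < 1 :> R)%R.
    rewrite (_ : _ - _ = (l - (Z N v)%:R) - (l - (Z n v)%:R))%R; last ring.
    by apply: le_lt_trans (ler_normB _ _) _; rewrite [ltRHS](splitr 1) ltrD// mul1r.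
  exact: natr_dist_lt1.
move=> /nocv n1 /nocv n2; rewrite /bp_limit /lim_in.
congr (get _); apply/funext => l; apply/propext; split => h; exfalso.
  exact: (n1 l).
exact: (n2 l).
Qed.

Lemma measurable_bp_limit : measurable_fun setT (bp_limit R zeta).
Proof.
pose G := \bigcup_(nj in setT) sigma_rv ((fun nj : nat * nat => zeta nj.1 nj.2) nj).
have mS k : <<s G >> (settles (Some k)).
  rewrite (_ : settles _ = \bigcup_N \bigcap_n ([set _ | (n < N)%N] `|`
      [set w | [set k] (Z n w)])).
    apply: gsigma_bigcup => N; apply: gsigma_bigcap => n; apply: gsigmaU.
      exact: gsigma_cst.
    exact: gen_gen_size.
  apply/seteqP; split => w /=.
    move=> [N H]; exists N => // n _.
    by have [nN|Nn] := ltnP n N; [left|right; exact: H].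
  move=> [N _ H]; exists N => n Nn.
  by have [/=|//] := H n I; rewrite ltnNge Nn.
have [||f [Hf mf]] := @measurable_selection _ T G _ settles.
- case=> [k|]; first exact: mS.
  rewrite (_ : settles _ = \bigcap_k ~` settles (Some k)).
    by apply: gsigma_bigcap => k; exact: gsigmaC.
  by apply/seteqP; split => w /= h k; [move=> _|]; exact: h.
- move=> w; have [[k h]|h] := pselect (exists k, settles (Some k) w).
    by exists (Some k).
  by exists None => k hk; apply: h; exists k.
pose p0 : R := if pselect (exists w, settles None w) is left e
  then bp_limit R zeta (projT1 (cid e)) else 0%R.
rewrite (_ : bp_limit R zeta = fun w => if f w is Some k then k%:R else p0); last first.
  apply/funext => w; have := Hf w; case: (f w) => [k /limit_settles//|nw].
  rewrite /p0; case: pselect => [e|]; last by case; exists w.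
  by apply: limit_unsettled => //; case: cid.
apply/measurable_EFinP.
apply: (measurable_fun_discrete (f := f) _ (fun o => (if o is Some k then k%:R else p0)%:E)).
by move=> v; apply: (gen_measurable (zeta := zeta)); exact: mf.
Qed.

Let mOmega : measurable Omega.
Proof. by apply: (gen_measurable (zeta := zeta)); exact: gen_all_fertile. Qed.

Let Y n w := (\1_Omega w * bp_size R zeta n w)%:E.

Let mbp n : measurable_fun setT (bp_size R zeta n).
Proof.
move=> _ B mB; rewrite setTI.
exact: (Z_measurable zeta n [set m | B m%:R]).
Qed.

Let mY n : measurable_fun setT (Y n).
Proof. by apply/measurable_EFinP; apply: measurable_funM. Qed.

Let Y0 n w : 0 <= Y n w.
Proof. by rewrite lee_fin mulr_ge0// indicE. Qed.

Let Y_nd w : {homo Y^~ w : m n / (m <= n)%N >-> m <= n}.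
Proof.
apply: homo_leq => //; first exact: le_trans.
move=> n; rewrite /Y lee_fin indicE.
case: (boolP (w \in Omega)) => [|_]; last by rewrite !mul0r.
by rewrite inE => Ow; rewrite !mul1r ler_nat gen_size_leqS.
Qed.

(** Where every vertex has a child the sizes increase; restricting them to this
    almost sure event makes the monotone convergence theorem apply everywhere.  The
    limit is finite almost surely, hence attained. *)
Lemma expectation_bp_limit : 'E_P[bp_limit R zeta] = (mean_limit zeta)%:E.
Proof.
have EY n : \int[P]_w Y n w = 'E_P[bp_size R zeta n].
  rewrite unlock; apply: ae_eq_integral => //; first exact/measurable_EFinP.
  apply: filterS (all_fertile_ae zeta_law zeta_ge1) => w Ow _.
  by rewrite /Y indicE mem_set// mul1r.
have intY : \int[P]_w (limn (Y^~ w)) = (mean_limit zeta)%:E.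
  rewrite monotone_convergence//.
  apply/cvg_lim => //.
  have -> : (fun n => \int[P]_w Y n w) = EFin \o mean_size zeta.
    apply/funext => n; rewrite EY.
    exact: (mean_sizeE zeta_law zeta_seq_indep zeta_ge1 L_finite).
  apply: cvg_EFin; first by apply: nearW.
  apply/cvgrPdist_le => e e0.
  have [n0 Hn0] := mean_size_cvg zeta_law zeta_seq_indep zeta_ge1 L_finite e0.
  near=> n; rewrite ger0_norm.
    rewrite /= lerBlDr -lerBlDl; apply: Hn0; near: n; exact: nbhs_infty_ge.
  rewrite subr_ge0.
  exact: (mean_size_le zeta_law zeta_seq_indep zeta_ge1 L_finite).
have mlim : measurable_fun setT (fun w => limn (Y^~ w)).
  apply: (emeasurable_fun_cvg Y) => //.
  by move=> w _; exact: (ereal_nondecreasing_is_cvgn (@Y_nd w)).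
have Yint : P.-integrable setT (fun w => limn (Y^~ w)).
  apply/integrableP; split => //.
  rewrite (eq_integral (fun w => limn (Y^~ w))) ?intY ?ltry// => w _.
  rewrite gee0_abs//; apply: lime_ge; last by apply: nearW => n.
  exact: (ereal_nondecreasing_is_cvgn (@Y_nd w)).
rewrite -intY unlock; apply: ae_eq_integral => //.
  by apply/measurable_EFinP; exact: measurable_bp_limit.
apply: filterS2 (all_fertile_ae zeta_law zeta_ge1) (integrable_ae measurableT Yint).
move=> w Ow /(_ I) fin _.
have Yw n : Y n w = (Z n w)%:R%:E by rewrite /Y indicE mem_set// mul1r.
have bnd n : (Z n w <= Num.truncn (fine (limn (Y^~ w))))%N.
  rewrite -ltnS -(ltr_nat R); apply: le_lt_trans (truncnS_gt _).
  rewrite -lee_fin fineK// -Yw; apply: lime_ge.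
    exact: (ereal_nondecreasing_is_cvgn (@Y_nd w)).
  by near=> m; apply: Y_nd; near: m; exact: nbhs_infty_ge.
have [N HN] := bounded_nondecreasing_nat (fun n => gen_size_leqS Ow n) bnd.
rewrite (limit_settles (k := Z N w)); last by exists N.
apply/esym/cvg_lim => //; apply: cvg_near_cst; near=> n.
by rewrite Yw HN//; near: n; exact: nbhs_infty_ge.
Unshelve. all: end_near. Qed.

End branching_limit.

(** * Paths of the branching random walk *)

Section reflected_paths.
Variables (R : realType) (c : R).
Implicit Types (s : seq R) (k : nat) (v : seq nat).

Lemma reflected_ge0 s : 0 <= reflected c s.
Proof. by case: s => [|a s] //=; rewrite /reflect_step le_max lexx. Qed.

Lemma reflected_cat_ge s1 s2 :
  \sum_(a <- s1) a - c * (size s1)%:R + reflected c s2 <= reflected c (s1 ++ s2).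
Proof.
elim: s1 => [|a s IH] /=; first by rewrite big_nil mulr0 subrr add0r.
rewrite big_cons /reflect_step /= le_max; apply/orP; right.
rewrite -natr1 mulrDr mulr1; lra.
Qed.

Lemma reflected_ge s k : (k <= size s)%N ->
  \sum_(a <- take k s) a - c * k%:R <= reflected c s.
Proof.
move=> ks; have := reflected_cat_ge (take k s) (drop k s).
rewrite cat_take_drop size_takel//; have := reflected_ge0 (drop k s); lra.
Qed.

Lemma reflected_attained s : exists2 k, (k <= size s)%N &
  reflected c s = \sum_(a <- take k s) a - c * k%:R.
Proof.
elim: s => [|a s [k ks IH]] /=; first by exists 0%N => //; rewrite big_nil mulr0 subrr.
rewrite /reflect_step /=; have [h|h] := leP (reflected c s + a - c) 0.
  by exists 0%N => //; rewrite take0 big_nil mulr0 subrr.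
by exists k.+1 => //=; rewrite big_cons IH -natr1 mulrDr mulr1; lra.
Qed.

Variable y : nat -> nat -> R.
Notation incr v := [seq y e.1 e.2 | e <- path_edges v].

Lemma path_edges_take v k : path_edges (take k v) = take k (path_edges v).
Proof.
rewrite /path_edges -map_take take_iota size_take_min; apply/eq_in_map => i.
rewrite mem_iota add0n => /andP[_ im]; rewrite nth_take//.
exact: leq_trans im (geq_minl _ _).
Qed.

Lemma path_sum_edges v : path_sum y v = \sum_(a <- incr v) a.
Proof.
rewrite /path_sum big_map /path_edges big_map.
by rewrite -[X in _ = \sum_(k <- X) _]/(iota 0 (size v)) -[size v in RHS]subn0 big_mkord.
Qed.

Lemma size_path_edges v : size (path_edges v) = size v.
Proof. by rewrite size_map size_iota. Qed.

Lemma path_sum_take v k :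
  path_sum y (take k v) = \sum_(a <- take k (incr v)) a.
Proof. by rewrite path_sum_edges path_edges_take map_take. Qed.

End reflected_paths.

Section maximum_of_tree.
Context d (T : measurableType d) (R : realType) (P : probability T R).
Variables (zeta : nat -> nat -> {RV P >-> nat}) (xi : nat -> nat -> {RV P >-> R}).
Variable c : R.
Notation tree w := (fun m j => zeta m j w).
Notation incr v w := [seq xi e.1 e.2 w | e <- path_edges v].
Notation sup w := (brw_sup zeta xi c w).
Implicit Types (x : R) (v : seq nat).

Lemma brw_sup_gt_path x w : (x%:E < sup w)%E <->
  exists2 v, root_path (tree w) v &
    x < path_sum (fun i k => xi i k w) v - c * (size v)%:R.
Proof.
rewrite /brw_sup; split.
  move=> /ereal_sup_gt[_ [v rv <-]]; rewrite lte_fin => h.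
  by exists v.
move=> [v rv h]; apply: lt_le_trans (_ : (path_sum _ _ - _)%:E <= _)%E; last first.
  by apply: ereal_sup_ubound; exists v.
by rewrite lte_fin.
Qed.

Lemma brw_sup_gt_reflected x w v : 0 <= x -> root_path (tree w) v ->
  x < reflected c (incr v w) -> (x%:E < sup w)%E.
Proof.
move=> x0 rv; have [k kv ->] := reflected_attained c (incr v w).
move=> h; apply/brw_sup_gt_path; exists (take k v); first exact: root_path_take.
rewrite path_sum_take size_takel//.
by move: kv; rewrite size_map size_path_edges.
Qed.

Lemma measurable_brw_sup_gt x : measurable [set w | (x%:E < sup w)%E].
Proof.
rewrite (_ : [set w | _] = \bigcup_(v in [set: seq nat])
  ([set w | root_path (tree w) v] `&`
   [set w | x < path_sum (fun i k => xi i k w) v - c * (size v)%:R])); last first.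
  apply/seteqP; split => w /=; first by move=> /brw_sup_gt_path[v rv h]; exists v.
  by move=> [v _ [rv h]]; apply/brw_sup_gt_path; exists v.
apply: countable_bigcupT_measurable; first exact: countableP.
move=> v; apply: measurableI.
  by apply: (gen_measurable (zeta := zeta)); exact: gen_root_path.
have mf : measurable_fun setT
    (fun w => path_sum (fun i k => xi i k w) v - c * (size v)%:R).
  apply: measurable_funB; last exact: measurable_cst.
  by apply: measurable_sum => k; exact: measurable_funP.
have := mf measurableT `]x, +oo[%classic (measurable_itv _).
rewrite setTI; congr measurable; apply/seteqP; split => w /=; by rewrite in_itv/= andbT.
Qed.

End maximum_of_tree.

(** * Bounds for the maximum over the tree *)

Section bonferroni.
Context d (T : measurableType d) (R : realType) (P : probability T R).
Context (V : choiceType) (C : V -> set T) (a b : R).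
Hypothesis mC : forall v, measurable (C v).
Local Open Scope ereal_scope.

Lemma bonferroni (s : seq V) : (0 <= b)%R -> uniq s ->
  (forall v, v \in s -> a%:E <= P (C v)) ->
  (forall u v, u \in s -> v \in s -> u != v -> P (C u `&` C v) <= b%:E) ->
  ((size s)%:R * a)%:E <= P (\bigcup_(v in [set` s]) C v) + ((size s)%:R ^+ 2 * b)%:E.
Proof.
move=> b0; elim: s => [|v s IH] /=.
  by rewrite mul0r expr2 mul0r mul0r adde0.
move=> /andP[vs us] aC bC.
have {}IH := IH us (fun u us' => aC u (@mem_behead _ (v :: s) u us'))
  (fun u w us' ws' => bC u w (@mem_behead _ (v :: s) u us') (@mem_behead _ (v :: s) w ws')).
set U := \bigcup_(u in [set` s]) C u in IH *.
have mU : measurable U by rewrite /U bigcup_seq; exact: bigsetU_measurable.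
have -> : \bigcup_(u in [set` v :: s]) C u = C v `|` U.
  by rewrite /U !bigcup_seq big_cons.
have cap : P (C v `&` U) <= ((size s)%:R * b)%:E.
  rewrite /U setI_bigcupr bigcup_seq.
  have : forall u, u \in s -> P (C v `&` C u) <= b%:E.
    move=> u us'; apply: bC; rewrite ?mem_head ?inE ?us' ?orbT//.
    by apply: contraNneq vs => ->.
  elim: (s) => [|u s' IHs] h; first by rewrite big_nil measure0 mul0r.
  rewrite big_cons /= -natr1 mulrDl mul1r addrC EFinD.
  apply: (@le_trans _ _ (P (C v `&` C u) + P (\big[setU/set0]_(j <- s') (C v `&` C j)))).
    apply: measureU2; first exact: measurableI.
    by apply: bigsetU_measurable => *; exact: measurableI.
  apply: leeD; first by apply: h; exact: mem_head.
  by apply: IHs => w ws'; apply: h; rewrite inE ws' orbT.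
have inex : P (C v `|` U) + P (C v `&` U) = P (C v) + P U.
  have -> : C v `|` U = C v `|` (U `\` C v).
    apply/seteqP; split => w [Cw|]; [by left| |by left|by case; right].
    by move=> Uw; have [Cw|nCw] := pselect (C v w); [left|right].
  have {3}-> : U = (C v `&` U) `|` (U `\` C v).
    apply/seteqP; split => w; last by case=> -[].
    by move=> Uw; have [Cw|nCw] := pselect (C v w); [left|right].
  rewrite measureU//; last 2 first.
  - exact: measurableD.
  - by rewrite -subset0 => w [Cw [_ nCw]]; exact: nCw.
  rewrite measureU//; last 3 first.
  - exact: measurableI.
  - exact: measurableD.
  - by rewrite -subset0 => w [[Cw _] [_ nCw]]; exact: nCw.
  by rewrite -addeA [_ + P (C v `&` U)]addeC.
have fC : P (C v) \is a fin_num by rewrite fin_num_measure.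
have fU : P U \is a fin_num by rewrite fin_num_measure.
have fCU : P (C v `|` U) \is a fin_num by rewrite fin_num_measure//; exact: measurableU.
have fI : P (C v `&` U) \is a fin_num by rewrite fin_num_measure//; exact: measurableI.
have aCv := aC v (mem_head _ _).
move: inex cap IH aCv; rewrite -(fineK fC) -(fineK fU) -(fineK fCU) -(fineK fI).
rewrite -!EFinD !lee_fin => -[e] h1 h2 h3.
have n0 : (0 <= (size s)%:R :> R)%R by [].
have nb : (0 <= (size s)%:R * b)%R by rewrite mulr_ge0.
rewrite -natr1; nra.
Qed.

End bonferroni.

Lemma uniq_map_inj (A B : eqType) (h : A -> B) (s : seq A) :
  uniq [seq h u | u <- s] -> {in s &, injective h}.
Proof.
elim: s => //= a s IH /andP[/negP na us] u v.
rewrite !inE => /predU1P[->|us'] /predU1P[->|vs'] // e; last exact: IH.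
  by case: na; rewrite e map_f.
by case: na; rewrite -e map_f.
Qed.

Lemma lower_tail_small (R : realType) (nu : probability R R) (e : R) : 0 < e ->
  exists2 K, 0 <= K & (nu `]-oo, (- K)%R[%classic <= e%:E)%E.
Proof.
move=> e0; pose F (n : nat) : set R := `]-oo, (- n%:R)%R[%classic.
have mF n : measurable (F n) by exact: measurable_itv.
have cv : nu (F n) @[n --> \oo] --> nu (\bigcap_n F n).
  apply: nonincreasing_cvg_mu => //.
  - by rewrite ltey_eq fin_num_measure.
  - exact: bigcapT_measurable.
  - move=> m n mn; apply/subsetPset; apply: subset_itv; rewrite ?bnd_simp//.
    by rewrite lerN2 ler_nat.
have F0 : \bigcap_n F n = set0.
  rewrite -subset0 => x /= Fx.
  have := Fx (Num.truncn `|x|).+1 I; rewrite /F /= in_itv/= => h.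
  have := truncnS_gt `|x|; rewrite ltNge => /negP; apply.
  have := ler_norm (- x); rewrite normrN; lra.
rewrite F0 measure0 in cv; have /fine_cvgP[_ cv'] := cv.
have [N _ H] := cvgr_le _ cv' _ e0.
exists N%:R => //; have := H N (leqnn N).
by rewrite /= -lee_fin fineK// fin_num_measure.
Qed.

Section tree_bounds.
Context d (T : measurableType d) (R : realType) (P : probability T R).
Variables (zeta : nat -> nat -> {RV P >-> nat}) (xi : nat -> nat -> {RV P >-> R}).
Variables (c : R) (nu : probability R R) (offspring : nat -> probability nat R).
Notation X := (fun e : nat * nat => xi e.1 e.2).
Hypothesis xi_law : forall (e : nat * nat) B, measurable B -> P (X e @^-1` B) = nu B.
Hypothesis xi_indep :
  mutually_independent P (fun ik : nat * nat => sigma_rv (xi ik.1 ik.2)).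
Hypothesis xi_zeta_indep :
  independent_classes P
    (sigma_family (fun ik : nat * nat => xi ik.1 ik.2))
    (sigma_family (fun nj : nat * nat => zeta nj.1 nj.2)).
Hypothesis zeta_law : forall (n j : nat) (A : set nat),
  distribution P (zeta n j) A = offspring n A.
Hypothesis zeta_seq_indep :
  mutually_independent P (fun n : nat => sigma_family (fun j : nat => zeta n j)).
Hypothesis zeta_ge1 : forall n : nat, {ae P, forall w, (1 <= zeta n 0%N w)%N}.
Hypothesis L_finite : (mean_product P zeta < +oo)%E.
Notation tree w := (fun m j => zeta m j w).
Notation Z n := (fun w => gen_size (tree w) n).
Notation Omega := (all_fertile zeta).
Notation sup w := (brw_sup zeta xi c w).
Notation genX J := (generated (fun e : nat * nat => sigma_rv (xi e.1 e.2)) J).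
Notation genZ J := (generated (fun nj : nat * nat => sigma_rv (zeta nj.1 nj.2)) J).
Notation hit := (hit c nu).
Implicit Types (x : R) (v : seq nat).
Local Open Scope ereal_scope.

Lemma genX_measurable J A : genX J A -> measurable A.
Proof.
by apply: (@generated_rv_measurable _ _ _ _ R P _ (fun e : nat * nat => xi e.1 e.2)).
Qed.

Definition exceeds x (es : seq (nat * nat)) : set T :=
  [set w | (x < reflected c [seq xi e.1 e.2 w | e <- es])%R].

Lemma exceedsE x es : exceeds x es =
  (fun w => reflected c [seq xi e.1 e.2 w | e <- es]) @^-1` `]x, +oo[%classic.
Proof. by apply/seteqP; split => w; rewrite /exceeds /= in_itv/= andbT. Qed.

Lemma genX_exceeds J x es : (forall e, e \in es -> J e) -> genX J (exceeds x es).
Proof.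
move=> esJ; rewrite exceedsE.
exact: (@generated_reflected _ _ _ P _ (fun e : nat * nat => xi e.1 e.2)).
Qed.

Lemma exceeds_prob x es : uniq es -> P (exceeds x es) = (hit (size es) x)%:E.
Proof.
move=> ues; rewrite exceedsE (reflected_law c xi_indep xi_law)//.
exact: hitE_fin.
Qed.

(** The increments are independent of the tree, so that events about the increments
    along a list of paths read off the tree may be computed for a fixed list. *)
Lemma freeze_tree (f : T -> seq (seq nat)) (B : seq (seq nat) -> set T) :
  (forall V, genZ setT [set w | f w = V]) -> (forall V, genX setT (B V)) ->
  measurable [set w | B (f w) w] /\ P [set w | B (f w) w] = \int[P]_w P (B (f w)).
Proof.
move=> gf gB.
have mf V : measurable [set w | f w = V] by apply: (gen_measurable (zeta := zeta)); exact: gf.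
have mB V : measurable (B V) by exact: genX_measurable (gB V).
split; first exact: measurable_freeze.
apply: freeze => // V; rewrite setIC [RHS]muleC.
exact: (xi_zeta_indep (gB V) (gf V)).
Qed.

Lemma not_fertile_prob : P (~` Omega) = 0.
Proof.
apply: measure_negligible.
  by apply: measurableC; apply: (gen_measurable (zeta := zeta)); exact: gen_all_fertile.
exact: (all_fertile_ae zeta_law zeta_ge1).
Qed.

Definition short_exceeds n x : set T := [set w | exists2 v,
  root_path (tree w) v /\ (size v <= n)%N
  & (x < path_sum (fun i k => xi i k w) v - c * (size v)%:R)%R].

Lemma measurable_short_exceeds n x : measurable (short_exceeds n x).
Proof.
rewrite (_ : short_exceeds n x = \bigcup_(v in [set: seq nat])
  (([set w | root_path (tree w) v] `&` [set _ | (size v <= n)%N]) `&`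
   [set w | x < path_sum (fun i k => xi i k w) v - c * (size v)%:R]%R)); last first.
  apply/seteqP; split => w /=; first by move=> [v rv h]; exists v.
  by move=> [v _ [rv h]]; exists v.
apply: countable_bigcupT_measurable; first exact: countableP.
move=> v; apply: measurableI; first apply: measurableI.
- by apply: (gen_measurable (zeta := zeta)); exact: gen_root_path.
- by apply: (gen_measurable (zeta := zeta) (J := setT)); exact: gsigma_cst.
have mf : measurable_fun setT
    (fun w => path_sum (fun i k => xi i k w) v - c * (size v)%:R)%R.
  apply: measurable_funB; last exact: measurable_cst.
  by apply: measurable_sum => k; exact: measurable_funP.
have := mf measurableT `]x, +oo[%classic (measurable_itv _).
by rewrite setTI; congr measurable; apply/seteqP; split => w /=; rewrite in_itv/= andbT.
Qed.

Lemma genX_bigcup_seq (s : seq (seq nat)) (F : seq nat -> set T) :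
  (forall v, genX setT (F v)) -> genX setT (\bigcup_(v in [set` s]) F v).
Proof.
move=> GF; rewrite bigcup_mkcond; apply: gsigma_bigcup => v.
case: ifPn => _; first exact: GF.
by rewrite -setCT; apply: gsigmaC; exact: gsigmaT.
Qed.

Lemma union_bound (s : seq (seq nat)) (F : seq nat -> set T) (b : R) :
  (forall v, measurable (F v)) -> (forall v, P (F v) <= b%:E) ->
  P (\bigcup_(v in [set` s]) F v) <= ((size s)%:R * b)%:E.
Proof.
move=> mF Fb; rewrite bigcup_seq; elim: s => [|v s IH].
  by rewrite big_nil measure0 mul0r.
rewrite big_cons /= -natr1 mulrDl mul1r addrC EFinD.
apply: (@le_trans _ _ (P (F v) + P (\big[setU/set0]_(j <- s) F j))); last exact: leeD.
by apply: measureU2 => //; exact: bigsetU_measurable.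
Qed.

(** On an everywhere fertile tree a path of at most [n] edges extends to generation
    [n], and the reflected walk along the extension is at least the value of the
    shorter path. *)
Lemma short_exceeds_prob n x : (0 <= x)%R ->
  P (short_exceeds n x) <= (mean_size zeta n * hit n x)%:E.
Proof.
move=> x0.
(* A list with one entry for each vertex of generation [n], chosen measurably. *)
pose Q (V : seq (seq nat)) : set T := [set w | [set size V] (Z n w)] `&`
  \bigcap_v (~` ([set w | root_path (tree w) v] `&` [set _ | size v = n])
             `|` [set _ | v \in V]).
have [||f [Qf gf]] := @measurable_selection _ T
    (\bigcup_(nj in setT) sigma_rv ((fun nj : nat * nat => zeta nj.1 nj.2) nj)) _ Q.
- move=> V; apply: gsigmaI; first exact: gen_gen_size.
  apply: gsigma_bigcap => v; apply: gsigmaU; last exact: gsigma_cst.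
  apply: gsigmaC; apply: gsigmaI; last exact: gsigma_cst.
  exact: gen_root_path.
- move=> w; have [V [sV HV]] := root_path_list (tree w) n; exists V; split => //= v _.
  have [vV|nvV] := boolP (v \in V); first by right.
  by left => -[rv sv]; move: nvV; rewrite HV.
pose B (V : seq (seq nat)) : set T := \bigcup_(v in [set` V])
  (exceeds x (path_edges v) `&` [set _ | size v = n]).
have gB1 v : genX setT (exceeds x (path_edges v) `&` [set _ | size v = n]).
  by apply: gsigmaI; [exact: genX_exceeds|exact: gsigma_cst].
have gB V : genX setT (B V) by exact: genX_bigcup_seq.
have [mBf PBf] := freeze_tree gf gB.
have sub : short_exceeds n x `<=` [set w | B (f w) w] `|` ~` Omega.
  move=> w [v [rv vn] h]; have [Ow|] := pselect (Omega w); last by right.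
  left; have [v' [rv' sv' tv']] := root_path_extend_to Ow rv vn.
  exists v' => /=.
    have [_ /(_ v' I)[/=|//]] := Qf w; by case.
  split => //; rewrite /exceeds /=; apply: lt_le_trans h _.
  rewrite -[in path_sum _ v]tv' path_sum_take.
  by apply: reflected_ge; rewrite size_map size_path_edges sv'.
apply: (@le_trans _ _ (P ([set w | B (f w) w] `|` ~` Omega))).
  apply: le_measure; rewrite ?inE//; first exact: measurable_short_exceeds.
  apply: measurableU => //; apply: measurableC.
  by apply: (gen_measurable (zeta := zeta)); exact: gen_all_fertile.
apply: (@le_trans _ _ (P [set w | B (f w) w] + P (~` Omega))).
  apply: measureU2 => //; apply: measurableC.
  by apply: (gen_measurable (zeta := zeta)); exact: gen_all_fertile.
have -> : P (~` Omega) = 0 by exact: not_fertile_prob.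
rewrite adde0 PBf.
have PB V : P (B V) <= ((size V)%:R * hit n x)%:E.
  apply: union_bound => v; first exact: genX_measurable (gB1 v).
  have [sv|sv] := pselect (size v = n).
    have -> : hit n x = hit (size (path_edges v)) x by rewrite size_path_edges sv.
    rewrite -exceeds_prob ?path_edges_uniq//.
    apply: le_measure; rewrite ?inE//; first exact: genX_measurable (gB1 v).
    by apply: (@genX_measurable setT); exact: genX_exceeds.
  rewrite [X in P X](_ : _ = set0) ?measure0 ?lee_fin ?hit_ge0//.
  by rewrite -subset0 => w [_ /sv].
apply: (@le_trans _ _ (\int[P]_w ((bp_size R zeta n w)%:E * (hit n x)%:E))).
  apply: ge0_le_integral => //.
  - have mf V : measurable [set w | f w = V].
      by apply: (gen_measurable (zeta := zeta)); exact: gf.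
    exact: (measurable_fun_discrete mf (fun V => P (B V))).
  - apply: emeasurable_funM; last exact: measurable_cst.
    apply/measurable_EFinP => _ A mA; rewrite setTI.
    exact: (Z_measurable zeta n [set m | A m%:R]).
  - move=> w _; apply: le_trans (PB _) _; rewrite /bp_size.
    by have [/= <- _] := Qf w; rewrite EFinM.
rewrite ge0_integralZr//; last 3 first.
- apply/measurable_EFinP => _ A mA; rewrite setTI.
  exact: (Z_measurable zeta n [set m | A m%:R]).
- by move=> w _; rewrite lee_fin ler0n.
- by rewrite lee_fin hit_ge0.
rewrite EFinM -(mean_sizeE zeta_law zeta_seq_indep zeta_ge1 L_finite) unlock.
by [].
Qed.

Lemma sup_prob_upper x (b : R) : (0 <= x)%R -> (forall n, hit n x <= b)%R ->
  P [set w | x%:E < sup w] <= (mean_limit zeta * b)%:E.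
Proof.
move=> x0 hb.
have -> : [set w | x%:E < sup w] = \bigcup_n short_exceeds n x.
  apply/seteqP; split => w.
    by move=> /brw_sup_gt_path[v rv h]; exists (size v) => //; exists v.
  by move=> [n _ [v [rv _] h]]; apply/brw_sup_gt_path; exists v.
have mU : measurable (\bigcup_n short_exceeds n x).
  by apply: bigcupT_measurable => n; exact: measurable_short_exceeds.
have cv : P (short_exceeds n x) @[n --> \oo] --> P (\bigcup_n short_exceeds n x).
  apply: nondecreasing_cvg_mu => //.
  - by move=> n; exact: measurable_short_exceeds.
  - move=> m n mn; apply/subsetPset => w [v [rv vm] h]; exists v => //; split => //.
    exact: leq_trans mn.
rewrite -(cvg_lim _ cv)//; apply: lime_le; first by apply/cvg_ex; eexists; exact: cv.
apply: nearW => n; apply: le_trans (short_exceeds_prob n x0) _; rewrite lee_fin.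
apply: ler_pM => //.
- exact: (mean_size_ge0 zeta_law zeta_seq_indep zeta_ge1 L_finite).
- exact: hit_ge0.
- exact: (mean_size_le zeta_law zeta_seq_indep zeta_ge1 L_finite).
Qed.

Definition no_low_jump (K : R) (es : seq (nat * nat)) : set T :=
  [set w | forall e, e \in es -> (- K <= xi e.1 e.2 w)%R].

Lemma genX_no_low_jump J K es : (forall e, e \in es -> J e) ->
  genX J (no_low_jump K es).
Proof.
move=> esJ; rewrite (_ : no_low_jump K es = \bigcap_e (if e \in es then
   X e @^-1` `[(- K)%R, +oo[%classic else setT)).
  apply: gsigma_bigcap => e; case: ifPn => [ee|_]; last exact: gsigmaT.
  exact: (@generated_preimage _ _ _ _ _ P _ (fun e : nat * nat => xi e.1 e.2) J e _ (esJ e ee)).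
apply/seteqP; split => w /= h e.
  by move=> _; case: ifPn => // ee; rewrite /= in_itv/= andbT; exact: h.
by move=> ee; have := h e I; rewrite ee /= in_itv/= andbT.
Qed.

Lemma no_low_jump_prob K es :
  P (~` no_low_jump K es) <= (size es)%:R%:E * nu `]-oo, (- K)%R[%classic.
Proof.
have mJ s : measurable (no_low_jump K s).
  apply: (@genX_measurable setT); exact: genX_no_low_jump.
elim: es => [|e es IH].
  rewrite (_ : ~` _ = set0) ?measure0 ?mul0e//.
  by rewrite -subset0 => w /=; apply.
have me : measurable (X e @^-1` `]-oo, (- K)%R[%classic).
  by rewrite -[X in measurable X]setTI; exact: measurable_funP.
have -> : ~` no_low_jump K (e :: es) = X e @^-1` `]-oo, (- K)%R[%classic `|` ~` no_low_jump K es.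
  apply/seteqP; split => w /=.
    move=> h; have [lt|ge] := ltP (xi e.1 e.2 w) (- K)%R.
      by left; rewrite /= in_itv.
    right => h'; apply: h => e'; rewrite inE => /predU1P[->//|]; exact: h'.
  rewrite in_itv/= => -[lt|h] h'.
    by have := h' e (mem_head _ _); rewrite leNgt lt.
  by apply: h => e' ee'; apply: h'; rewrite inE ee' orbT.
apply: (@le_trans _ _ (P (X e @^-1` `]-oo, (- K)%R[%classic) + P (~` no_low_jump K es))).
  by apply: measureU2 => //; exact: measurableC.
rewrite /= -natr1 EFinD ge0_muleDl// mul1e addeC; apply: leeD => //.
by rewrite xi_law.
Qed.

(** The two requirements bear on disjoint sets of edges and together bring the path
    to a value above [y - (K + c) * g]; see [climbs_sup]. *)
Definition climbs g K y v : set T :=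
  no_low_jump K (take g (path_edges v)) `&` exceeds y (drop g (path_edges v)).

Lemma climbs_sup g K x v w : (0 <= x)%R -> (g <= size v)%N -> root_path (tree w) v ->
  climbs g K (x + (K + c) * g%:R)%R v w -> x%:E < sup w.
Proof.
move=> x0 gv rv [low ex]; apply: (brw_sup_gt_reflected x0 rv).
rewrite -(cat_take_drop g (path_edges v)) map_cat.
apply: lt_le_trans (reflected_cat_ge _ _ _).
rewrite size_map size_takel ?size_path_edges//.
have : (- K * g%:R <= \sum_(a <- [seq xi e.1 e.2 w | e <- take g (path_edges v)]) a)%R.
  have {1}-> : g = size (take g (path_edges v)) by rewrite size_takel ?size_path_edges.
  move: low; elim: (take _ _) => [|e s IH] low; first by rewrite big_nil mulr0.
  rewrite /= big_cons -natr1 mulrDr mulr1 addrC lerD//.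
    by apply: low; exact: mem_head.
  by apply: IH => e' ee'; apply: low; rewrite inE ee' orbT.
move: ex; rewrite /exceeds /=; lra.
Qed.

Lemma genX_climbs J g K y v : (forall e, J e) -> genX J (climbs g K y v).
Proof.
by move=> JT; apply: gsigmaI; [exact: genX_no_low_jump|exact: genX_exceeds].
Qed.

Lemma climbs_prob g n K y v (eta : R) : size v = (g + n)%N ->
  g%:R%:E * nu `]-oo, (- K)%R[%classic <= eta%:E ->
  ((1 - eta) * hit n y)%:E <= P (climbs g K y v).
Proof.
move=> sv small.
pose hd := take g (path_edges v); pose tl := drop g (path_edges v).
have szh : size hd = g by rewrite size_takel ?size_path_edges ?sv ?leq_addr.
have szt : size tl = n by rewrite size_drop size_path_edges sv addKn.
have ue := path_edges_uniq v.
have ut : uniq tl by exact: drop_uniq.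
have -> : P (climbs g K y v) = P (no_low_jump K hd) * P (exceeds y tl).
  apply: (@grouping_rv _ _ _ _ _ _ _ _ xi_indep [set` hd] [set` tl]).
  - rewrite disj_set2E; apply/eqP; rewrite -subset0 => e [/= eh et].
    move: ue; rewrite -(cat_take_drop g (path_edges v)) cat_uniq => /and3P[_ /hasPn h _].
    by have := h e et; rewrite /= eh.
  - exact: genX_no_low_jump.
  - exact: genX_exceeds.
rewrite exceeds_prob// szt EFinM.
apply: lee_wpmul2r; first by rewrite lee_fin hit_ge0.
have mJ : measurable (no_low_jump K hd).
  apply: (@genX_measurable setT); exact: genX_no_low_jump.
have := no_low_jump_prob K hd; rewrite szh probability_setC//.
have fJ : P (no_low_jump K hd) \is a fin_num by rewrite fin_num_measure.
move=> /le_trans/(_ small); rewrite -(fineK fJ) -EFinB !lee_fin; lra.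
Qed.

Lemma climbs_pair_prob g n K y u v :
  size u = (g + n)%N -> size v = (g + n)%N ->
  (forall e, e \in drop g (path_edges u) -> e \notin drop g (path_edges v)) ->
  P (climbs g K y u `&` climbs g K y v) <= (hit n y ^+ 2)%:E.
Proof.
move=> su sv dis.
have st (w : seq nat) : size w = (g + n)%N -> size (drop g (path_edges w)) = n.
  by move=> sw; rewrite size_drop size_path_edges sw addKn.
have ut w : uniq (drop g (path_edges w)) by apply: drop_uniq; exact: path_edges_uniq.
have mE w : measurable (exceeds y (drop g (path_edges w))).
  by apply: (@genX_measurable setT); exact: genX_exceeds.
have mC w : measurable (climbs g K y w).
  by apply: (@genX_measurable setT); exact: genX_climbs.
apply: (@le_trans _ _ (P (exceeds y (drop g (path_edges u)) `&`
                          exceeds y (drop g (path_edges v))))).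
  apply: le_measure; rewrite ?inE; [exact: measurableI|exact: measurableI|].
  by move=> w [[_ h1] [_ h2]].
rewrite (@grouping_rv _ _ _ _ _ _ _ _ xi_indep [set` drop g (path_edges u)]
  [set` drop g (path_edges v)]).
- rewrite !exceeds_prob// !st// -EFinM.
- rewrite disj_set2E; apply/eqP; rewrite -subset0 => e [/= /dis + ev].
  by rewrite ev.
- exact: genX_exceeds.
- exact: genX_exceeds.
Qed.

(** Bonferroni's inequality costs the square of the number of vertices, and [Z_g] may
    have infinite second moment: only [N] vertices of generation [g] are used. *)
Definition truncated_mean g N : R := fine (\int[P]_w ((minn (Z g w) N)%:R%:E : \bar R)).

Lemma measurable_nat_event (u : nat -> R) g :
  measurable_fun setT (fun w => u (Z g w)).
Proof.
move=> _ A mA; rewrite setTI; exact: (Z_measurable zeta g [set m | A (u m)]).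
Qed.

Let mtrunc g N : measurable_fun setT (fun w => (minn (Z g w) N)%:R%:E : \bar R).
Proof. by apply/measurable_EFinP; exact: (measurable_nat_event (fun m => (minn m N)%:R)). Qed.

Lemma truncated_meanE g N :
  \int[P]_w ((minn (Z g w) N)%:R%:E : \bar R) = (truncated_mean g N)%:E.
Proof.
rewrite /truncated_mean fineK// ge0_fin_numE; last by apply: integral_ge0.
apply: (@le_lt_trans _ _ (\int[P]_w N%:R%:E)).
  apply: ge0_le_integral => // w _.
  by rewrite lee_fin ler_nat geq_minr.
by rewrite integral_probability_cst ltry.
Qed.

Lemma truncated_mean_cvg g e : (0 < e)%R ->
  exists N, (mean_size zeta g - e <= truncated_mean g N)%R.
Proof.
move=> e0.
pose u N w : \bar R := (minn (Z g w) N)%:R%:E.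
have cv : \int[P]_w u N w @[N --> \oo] --> \int[P]_w (limn (u^~ w)).
  apply: cvg_monotone_convergence => //; [by move=> k; exact: mtrunc|by move=> k w _; rewrite lee_fin|].
  move=> w _ a b ab; rewrite lee_fin ler_nat leq_min geq_minl.
  exact: leq_trans (geq_minr _ _) ab.
have E : \int[P]_w (limn (u^~ w)) = (mean_size zeta g)%:E.
  rewrite -(mean_sizeE zeta_law zeta_seq_indep zeta_ge1 L_finite) unlock.
  apply: eq_integral => w _; apply/cvg_lim => //; apply: cvg_near_cst; near=> k.
  by rewrite /u /bp_size (minn_idPl _)//; near: k; exact: nbhs_infty_ge.
rewrite E in cv; have /fine_cvgP[_ cv'] := cv.
have [|N _ H] := cvgr_ge _ cv' (mean_size zeta g - e)%R.
  by rewrite ltrBlDr ltrDl.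
by exists N; exact: (H N (leqnn N)).
Unshelve. all: end_near. Qed.

(** Given the tree, Bonferroni's inequality applies to one ray through each of at
    most [N] vertices of generation [g]; two of these rays climb independently after
    generation [g]. *)
Lemma sup_prob_lower g n N K x (eta : R) :
  (0 <= x)%R -> (eta <= 1)%R -> g%:R%:E * nu `]-oo, (- K)%R[%classic <= eta%:E ->
  let y := (x + (K + c) * g%:R)%R in
  (truncated_mean g N * ((1 - eta) * hit n y))%:E
  <= P [set w | x%:E < sup w] + (N%:R ^+ 2 * hit n y ^+ 2)%:E.
Proof.
move=> x0 eta1 small; set y := (x + (K + c) * g%:R)%R; rewrite /=.
(* A measurable choice of rays; any list will do on the null event that some vertex
   has no child. *)
pose Q (V : seq (seq nat)) : set T := ~` Omega `|`
  (([set w | [set m | size V = minn m N] (Z g w)] `&`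
   \bigcap_v ([set _ | v \notin V] `|`
     ([set w | root_path (tree w) v] `&` [set _ | size v = (g + n)%N]))) `&`
   [set _ | uniq [seq nth 0%N (0%N :: v) g | v <- V]]).
have [||f [Qf gf]] := @measurable_selection _ T
    (\bigcup_(nj in setT) sigma_rv ((fun nj : nat * nat => zeta nj.1 nj.2) nj)) _ Q.
- move=> V; apply: gsigmaU; first by apply: gsigmaC; exact: gen_all_fertile.
  apply: gsigmaI; last exact: gsigma_cst.
  apply: gsigmaI; first exact: gen_gen_size.
  apply: gsigma_bigcap => v; apply: gsigmaU; first exact: gsigma_cst.
  by apply: gsigmaI; [exact: gen_root_path|exact: gsigma_cst].
- move=> w; have [Ow|nOw] := pselect (Omega w); last by exists [::]; left.
  have [V [sV rV uV]] := ray_list Ow g n N; exists V; right; split => //; split => // v _.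
  by have [/rV[rv sv]|nV] := boolP (v \in V); [right|left].
have Qfs w : Omega w -> [/\ size (f w) = minn (Z g w) N,
    forall v, v \in f w -> root_path (tree w) v /\ size v = (g + n)%N
  & uniq [seq nth 0%N (0%N :: v) g | v <- f w]].
  move=> Ow; have [//|[[/= h1 h2] h3]] := Qf w; split => // v vf.
  by have [/=|//] := h2 v I; rewrite vf.
pose C := climbs g K y.
pose B (V : seq (seq nat)) : set T := \bigcup_(v in [set` V]) C v.
have gC v : genX setT (C v) by exact: genX_climbs.
have gB V : genX setT (B V) by exact: genX_bigcup_seq.
have mC v : measurable (C v) by exact: (genX_measurable (gC v)).
have [mBf PBf] := freeze_tree gf gB.
have mO : measurable Omega by apply: (gen_measurable (zeta := zeta)); exact: gen_all_fertile.
have sub : [set w | B (f w) w] `<=` [set w | x%:E < sup w] `|` ~` Omega.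
  move=> w [v /= vf Cv]; have [Ow|] := pselect (Omega w); last by right.
  have [_ /(_ v vf)[rv sv] _] := Qfs w Ow; left.
  by apply: (climbs_sup x0 _ rv Cv); rewrite sv leq_addr.
have le1 : \int[P]_w P (B (f w)) <= P [set w | x%:E < sup w].
  rewrite -PBf; apply: (@le_trans _ _ (P ([set w | x%:E < sup w] `|` ~` Omega))).
    apply: le_measure; rewrite ?inE//; apply: measurableU; last exact: measurableC.
    exact: measurable_brw_sup_gt.
  apply: (@le_trans _ _ (P [set w | x%:E < sup w] + P (~` Omega))).
    by apply: measureU2; [exact: measurable_brw_sup_gt|exact: measurableC].
  have -> : P (~` Omega) = 0 by exact: not_fertile_prob.
  by rewrite adde0.
apply: le_trans (leeD2r _ le1).
have h0 := hit_ge0 c nu n y.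
have a0 : (0 <= (1 - eta) * hit n y)%R by rewrite mulr_ge0// subr_ge0.
have mf V : measurable [set w | f w = V].
  by apply: (gen_measurable (zeta := zeta)); exact: gf.
have mPB := measurable_fun_discrete mf (fun V => P (B V)).
rewrite EFinM -truncated_meanE -ge0_integralZr//.
have -> : (N%:R ^+ 2 * hit n y ^+ 2)%:E = \int[P]_w (N%:R ^+ 2 * hit n y ^+ 2)%:E.
  by rewrite integral_probability_cst.
rewrite -ge0_integralD//; last by move=> w _; rewrite lee_fin mulr_ge0// sqr_ge0.
apply: ae_ge0_le_integral => //.
- by move=> w _; rewrite mule_ge0// lee_fin.
- by apply: emeasurable_funM => //; exact: measurable_cst.
- by move=> w _; rewrite adde_ge0// lee_fin mulr_ge0// sqr_ge0.
- by apply: emeasurable_funD => //; exact: measurable_cst.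
apply: filterS (all_fertile_ae zeta_law zeta_ge1) => w Ow _.
have [sV rV uV] := Qfs w Ow.
rewrite -EFinM -sV.
have bon := @bonferroni _ T R P _ C ((1 - eta) * hit n y)%R (hit n y ^+ 2)%R mC (f w)
  (sqr_ge0 _) (map_uniq uV).
apply: le_trans (bon _ _) _.
- move=> v /rV[_ sv].
  exact: (@climbs_prob g n K y v eta sv small).
- move=> u v uf vf uv; have [ru su] := rV u uf; have [rv sv] := rV v vf.
  apply: (@climbs_pair_prob g n K y u v su sv).
  apply: path_edges_disjoint ru rv _ _; first by rewrite su.
  move=> e; move/negP: uv; apply; apply/eqP.
  exact: (uniq_map_inj uV).
rewrite leeD2l// lee_fin ler_wpM2r ?sqr_ge0//.
by rewrite lerXn2r ?nnegrE// sV ler_nat geq_minr.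
Qed.

Local Close Scope ereal_scope.

Variable G : probability (measurableTypeR R) R.
Hypothesis G_subexp : subexponential G.
Hypothesis nu_integrable : nu.-integrable setT (fun t : R => t%:E).
Hypothesis nu_mean0 : (\int[nu]_t t%:E = 0)%E.
Hypothesis c0 : 0 < c.
Variable Ks : R.
Hypothesis Ks0 : 0 <= Ks.
Hypothesis overshoot_tail : forall r, Ks <= r -> overshoot nu r = tail G r.
Notation f := (ftail G).
Notation L := (mean_limit zeta).
Let p x : R := fine (P [set w | (x%:E < sup w)%E]).

Let pE x : P [set w | (x%:E < sup w)%E] = (p x)%:E.
Proof. by rewrite /p fineK// fin_num_measure//; exact: measurable_brw_sup_gt. Qed.

Lemma sup_tail_upper e : 0 < e -> exists x0, forall x, x0 <= x ->
  p x <= (L / c + e) * f x.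
Proof.
have L1 : 1 <= L by exact: (mean_limit_ge1 zeta_law zeta_seq_indep zeta_ge1 L_finite).
move=> e0; have eL : 0 < e / L by rewrite divr_gt0//; lra.
have [x1 H1] := hit_upper nu_integrable nu_mean0 c0 G_subexp Ks0 overshoot_tail eL.
exists (Num.max 0 x1) => x; rewrite ge_max => /andP[x0 x1x].
rewrite -lee_fin -pE.
apply: le_trans (sup_prob_upper x0 (H1 _ x1x)) _.
rewrite lee_fin mulrA ler_wpM2r ?ftail_ge0//.
by rewrite mulrDr [L * (e / L)]mulrC divfK//; lra.
Qed.

(** Choose in this order the generation [g], the number [N] of its vertices, and the
    bound [K] on downward jumps; [n] depends on [x], as in [hit_lower]. *)
Lemma sup_tail_lower e : 0 < e -> exists x0, forall x, x0 <= x ->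
  (L / c - e) * f x <= p x.
Proof.
have L1 : 1 <= L by exact: (mean_limit_ge1 zeta_law zeta_seq_indep zeta_ge1 L_finite).
have cpos : 0 < c := c0; have ci : 0 < c^-1 by rewrite invr_gt0.
have Lc : 0 < L / c by rewrite divr_gt0//; lra.
move=> e0; pose M := L + 2 * c^-1 + 2 * (L / c) + 1.
have M0 : 0 < M by rewrite /M; lra.
pose h := Num.min (4^-1) (Num.min c^-1 (e / M)).
have h0 : 0 < h by rewrite !lt_min invr_gt0 ci divr_gt0//= ltr0n.
have h4 : h <= 4^-1 by rewrite ge_min lexx.
have hc : h <= c^-1 by rewrite !ge_min lexx orbT.
have hM : h * M <= e by rewrite -ler_pdivlMr// !ge_min lexx !orbT.
have [g Hg] := mean_size_cvg zeta_law zeta_seq_indep zeta_ge1 L_finite h0.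
have {}Hg := Hg g (leqnn g).
have [N HN] := truncated_mean_cvg g h0.
have hg0 : 0 < h / g.+1%:R by rewrite divr_gt0.
have [K K0 HK] := lower_tail_small nu hg0.
have small : (g%:R%:E * nu `]-oo, (- K)%R[%classic <= h%:E)%E.
  apply: (@le_trans _ _ (g%:R%:E * (h / g.+1%:R)%:E)%E); first exact: lee_wpmul2l.
  by rewrite -EFinM lee_fin mulrA ler_pdivrMr// mulrC ler_pM2l// ler_nat.
pose s := (K + c) * g%:R.
have s0 : 0 <= s by rewrite mulr_ge0// addr_ge0// ltW.
have [x1 H1] := hit_lower nu_integrable nu_mean0 c0 G_subexp Ks0 overshoot_tail h0.
have [x2 H2] := hit_upper nu_integrable nu_mean0 c0 G_subexp Ks0 overshoot_tail ltr01.
have [x3 H3] := ftail_shift G_subexp s0 h0.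
pose D := N%:R ^+ 2 * (c^-1 + 1) ^+ 2 : R.
have D0 : 0 <= D by rewrite mulr_ge0// sqr_ge0.
have hD : 0 < h / (D + 1) by rewrite divr_gt0//; lra.
have [x4 H4] := ftail_cvg0 G hD.
exists (Num.max 0 (Num.max x1 (Num.max x2 (Num.max x3 x4)))) => x.
rewrite !ge_max => /and5P[x0 x1x x2x x3x x4x].
have [n Hn] := H1 (x + s) ltac:(lra).
have {}Hn := Hn n (leqnn n).
have up := H2 (x + s) ltac:(lra) n.
have sh := H3 x x3x.
have fx := ftail_gt0 G_subexp x.
have fy : f (x + s) <= f x by apply: ftail_nonincreasing; lra.
have fy0 := ftail_ge0 G (x + s).
have h1 : h <= 1 by lra.
have := sup_prob_lower n N x0 h1 small.
rewrite -/s /= pE -EFinD lee_fin => low.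
set q := hit n (x + s) in Hn up low *.
have q0 : 0 <= q by exact: hit_ge0.
(* [q] is of order [f x], which tends to 0. *)
have sq : N%:R ^+ 2 * q ^+ 2 <= h * f x.
  have q2 : q ^+ 2 <= (c^-1 + 1) ^+ 2 * (f x * f x).
    have c1 : 0 <= c^-1 + 1 by lra.
    rewrite -expr2 -exprMn; apply: lerXn2r; rewrite ?nnegrE//.
      by rewrite mulr_ge0// ltW.
    by apply: le_trans up _; rewrite ler_wpM2l.
  apply: (@le_trans _ _ (D * (f x * f x))).
    have -> : D * (f x * f x) = N%:R ^+ 2 * ((c^-1 + 1) ^+ 2 * (f x * f x)).
      by rewrite /D [RHS]mulrA.
    by rewrite ler_wpM2l// sqr_ge0.
  rewrite mulrA ler_pM2r//.
  have := H4 x x4x; rewrite ltr_pdivlMr; last lra.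
  by have := ftail_ge0 G x; nra.
have qlow : (c^-1 - h) * ((1 - h) * f x) <= q.
  by apply: le_trans Hn; rewrite ler_wpM2l// subr_ge0.
have tm : L - 2 * h <= truncated_mean g N by lra.
have prod : (L - 2 * h) * ((1 - h) * ((c^-1 - h) * ((1 - h) * f x)))
    <= truncated_mean g N * ((1 - h) * q).
  have a1 : 0 <= 1 - h by lra.
  have a2 : 0 <= (c^-1 - h) * ((1 - h) * f x).
    by rewrite mulr_ge0 ?subr_ge0// mulr_ge0// ltW.
  apply: ler_pM => //; first lra.
  + by rewrite mulr_ge0.
  + by rewrite ler_wpM2l.
have coef : L / c - e + h <= (L - 2 * h) * (c^-1 - h) * ((1 - h) * (1 - h)).
  have u1 : L / c - h * (L + 2 * c^-1) <= (L - 2 * h) * (c^-1 - h) by nra.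
  have u2 : (L - 2 * h) * (c^-1 - h) <= L / c by nra.
  have u3 : 1 - 2 * h <= (1 - h) * (1 - h) by nra.
  have u4 : 0 <= (L - 2 * h) * (c^-1 - h) by apply: mulr_ge0; lra.
  have u5 : (L - 2 * h) * (c^-1 - h) * (1 - 2 * h) <=
      (L - 2 * h) * (c^-1 - h) * ((1 - h) * (1 - h)) by rewrite ler_wpM2l.
  have u6 : h * ((L - 2 * h) * (c^-1 - h)) <= h * (L / c) by rewrite ler_wpM2l// ltW.
  rewrite /M in hM; lra.
have := ler_wpM2r (ltW fx) coef.
move: prod low sq; lra.
Qed.

End tree_bounds.

(** * Comparison of the three functions *)

Definition eventually_close (R : realType) (f u : R -> R) (A : R) : Prop :=
  forall e, 0 < e -> exists x0, forall x, x0 <= x ->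
  (A - e) * f x <= u x /\ u x <= (A + e) * f x.

Lemma tail_equiv_close (R : realType) (f : R -> R) (u v : R -> \bar R) (A : R) :
  (forall x, 0 < f x) -> 0 < A ->
  eventually_close f (fine \o u) A -> eventually_close f (fine \o v) A ->
  tail_equiv u v.
Proof.
move=> f0 A0 Hu Hv; apply/cvgrPdist_le => d d0.
(* With [e <= A / 2] the denominator stays above [A / 2 * f x], while the difference
   is at most [2 * e * f x]. *)
pose e := Num.min (A / 2) (A * d / 4).
have e0 : 0 < e by rewrite lt_min !divr_gt0// mulr_gt0.
have eA : e <= A / 2 by rewrite ge_min lexx.
have ed : e <= A * d / 4 by rewrite ge_min lexx orbT.
have [x1 H1] := Hu e e0; have [x2 H2] := Hv e e0.
exists (Num.max x1 x2); split; first exact: num_real.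
move=> x; rewrite gt_max => /andP[xx1 xx2].
have [a1 a2] := H1 x (ltW xx1); have [b1 b2] := H2 x (ltW xx2).
rewrite /= in a1 a2 b1 b2; have fx := f0 x.
set p := fine (u x) in a1 a2 *; set q := fine (v x) in b1 b2 *.
have q1 : A / 2 * f x <= q.
  by apply: le_trans b1; rewrite ler_pM2r//; lra.
have q0 : 0 < q by apply: lt_le_trans q1; rewrite mulr_gt0// divr_gt0.
rewrite -[X in X - _](divff (lt0r_neq0 q0)) -mulrBl normrM normfV (gtr0_norm q0).
rewrite ler_pdivrMr//.
have dq : d * (A / 2 * f x) <= d * q by rewrite ler_pM2l.
have ef : e * f x <= A * d / 4 * f x by rewrite ler_pM2r.
by rewrite ler_norml; apply/andP; split; lra.
Qed.

Section law_of_increments.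
Context d (T : measurableType d) (R : realType) (P : probability T R).
Context (X : {RV P >-> R}) (F : R -> R).
Local Open Scope ereal_scope.

Lemma distribution_integrable : P.-integrable setT (fun w => (X w)%:E) ->
  (distribution P X).-integrable setT (fun t : R => t%:E).
Proof.
move=> /integrableP[_ intX]; apply/integrableP; split; first exact: EFin_measurable.
rewrite ge0_integral_distribution//.
by apply: measurableT_comp => //; exact: EFin_measurable.
Qed.

Lemma distribution_mean : P.-integrable setT (fun w => (X w)%:E) ->
  \int[distribution P X]_t t%:E = 'E_P[X].
Proof.
move=> iX; rewrite integral_distribution//.
by rewrite unlock.
Qed.

End law_of_increments.

Lemma eq_distribution_cdf d (T : measurableType d) (R : realType)
    (P : probability T R) (X Y : {RV P >-> R}) (F : R -> R) :
  (forall x, cdf X x = (F x)%:E) -> (forall x, cdf Y x = (F x)%:E) ->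
  forall B, measurable B -> P (X @^-1` B) = distribution P Y B.
Proof.
move=> XF YF B mB; rewrite -[LHS]/(distribution P X B).
apply: eq_probability_rays => // x.
rewrite -[LHS]/(ccdf X x) -[RHS]/(ccdf Y x).
by rewrite !ccdf_1_cdf XF YF.
Qed.

Lemma weighted_tail_close (R : realType) (c : R) (nu : probability R R) (F : R -> R)
    (G : probability (measurableTypeR R) R) (Ks : R) (m : nat -> R) (L : R) :
  nu.-integrable setT (fun t : R => t%:E) ->
  (forall x, nu `]-oo, x]%classic = (F x)%:E) -> 0 < c ->
  subexponential G -> (forall r, Ks <= r -> overshoot nu r = tail G r) ->
  (forall n, 0 <= m n) -> (forall n, m n <= L) ->
  (forall e, 0 < e -> exists n0, forall n, (n0 <= n)%N -> L - e <= m n) ->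
  1 <= L ->
  eventually_close (ftail G) (fine \o weighted_tail c F m) (L / c).
Proof.
move=> nui nuF c0 G_subexp KsE m0 mL m_cvg L1 e e0.
have PhiE x : Ks <= x -> fine (overshoot nu x) = ftail G x by move=> /KsE ->.
have Phi0 e' : 0 < e' -> exists x0, forall x, x0 <= x -> fine (overshoot nu x) < e'.
  move=> /(ftail_cvg0 G)[x0 H]; exists (Num.max Ks x0) => x.
  by rewrite ge_max => /andP[/PhiE -> /H].
have ci : 0 < c^-1 by rewrite invr_gt0.
pose h := Num.min 2^-1 (e / (c^-1 + L / c)).
have Lc : 0 < L / c by rewrite divr_gt0//; lra.
have M0 : 0 < c^-1 + L / c by lra.
have h0 : 0 < h by rewrite lt_min divr_gt0// invr_gt0 ltr0n.
have h2 : h <= 2^-1 by rewrite ge_min lexx.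
have hM : h * (c^-1 + L / c) <= e by rewrite -ler_pdivlMr// ge_min lexx orbT.
have [n0 Hn0] := weighted_tail_lower nui nuF c0 Phi0 m0 m_cvg h0.
have s0 : 0 <= c * n0%:R by rewrite mulr_ge0// ltW.
have [x1 H1] := ftail_shift G_subexp s0 h0.
exists (Num.max Ks x1) => x; rewrite ge_max => /andP[Kx x1x].
have up := weighted_tail_upper nui nuF c0 m0 mL x.
have low := Hn0 x.
have fin : weighted_tail c F m x \is a fin_num.
  by rewrite fin_real// (lt_le_trans _ low) ?ltNyr//= (le_lt_trans up)// ltry.
move: up low; rewrite -(fineK fin) !lee_fin !PhiE//; last by lra.
set q := fine _ => up low /=.
have fx := ftail_gt0 G_subexp x.
split; last by apply: le_trans up _; rewrite ler_pM2r//; lra.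
apply: le_trans low; have sh := H1 x x1x.
have Lh : 0 <= (L - h) / c by rewrite divr_ge0 ?ltW//; lra.
apply: le_trans (ler_wpM2l Lh sh); rewrite mulrA ler_pM2r//.
have hc : 0 <= h * c^-1 by rewrite mulr_ge0 ?ltW.
have hhc : h * (h * c^-1) <= 2^-1 * (h * c^-1) by rewrite ler_wpM2r.
by move: hM hc; rewrite /=; nra.
Qed.

Theorem theorem1 (R : realType) (d : measure_display) (T : measurableType d)
  (P : probability T R)
  (offspring : nat -> probability nat R)
  (zeta : nat -> nat -> {RV P >-> nat})
  (F : R -> R)
  (xi : nat -> nat -> {RV P >-> R})
  (FI : probability (measurableTypeR R) R)
  (zeta_law : forall (n j : nat) (A : set nat),
     distribution P (zeta n j) A = offspring n A)
  (zeta_indep : forall n : nat,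
     mutually_independent P (fun j : nat => sigma_rv (zeta n j)))
  (zeta_seq_indep :
     mutually_independent P (fun n : nat => sigma_family (fun j : nat => zeta n j)))
  (xi_law : forall (i k : nat) (x : R), cdf (xi i k) x = (F x)%:E)
  (xi_indep :
     mutually_independent P (fun ik : nat * nat => sigma_rv (xi ik.1 ik.2)))
  (xi_zeta_indep :
     independent_classes P
       (sigma_family (fun ik : nat * nat => xi ik.1 ik.2))
       (sigma_family (fun nj : nat * nat => zeta nj.1 nj.2)))
  (zeta_ge1 : forall n : nat, {ae P, forall w, (1 <= zeta n 0%N w)%N})
  (L_finite : (mean_product P zeta < +oo)%E)
  (xi_integrable : forall i k : nat,
     P.-integrable setT (fun w => (xi i k w)%:E))
  (xi_mean0 : forall i k : nat, ('E_P[xi i k] = 0)%E)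
  (FI_law : integrated_tail_law F FI)
  (FI_subexp : subexponential FI) :
  forall c : R, 0 < c ->
    tail_equiv (fun x : R => P [set w | (x%:E < brw_sup zeta xi c w)%E])
               (H_infty P zeta F c)
    /\
    tail_equiv (H_infty P zeta F c)
               (fun x : R => ('E_P[bp_limit R zeta] * (c^-1)%:E
                              * integrated_tail F x)%E).
Proof.
move=> c c0.
pose nu : probability R R := distribution P (xi 0%N 0%N).
have law (e : nat * nat) B : measurable B -> P (xi e.1 e.2 @^-1` B) = nu B.
  exact: (eq_distribution_cdf (xi_law e.1 e.2) (xi_law 0%N 0%N)).
have nui := distribution_integrable (xi_integrable 0%N 0%N).
have num : (\int[nu]_t t%:E = 0)%E.
  by rewrite distribution_mean ?xi_mean0//; exact: xi_integrable.
have nuF x : nu `]-oo, x]%classic = (F x)%:E by exact: xi_law.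
have FIE x : tail FI x = Order.min 1%E (overshoot nu x).
  by rewrite FI_law /integrated_tail (integral_survival nuF).
have [x1 Hx1] := ftail_cvg0 FI ltr01.
(* From [Ks] on the tail of [FI] is below 1, so that it is the integral itself. *)
pose Ks := Num.max 0 x1; have Ks0 : 0 <= Ks by rewrite le_max lexx.
have KsE r : Ks <= r -> overshoot nu r = tail FI r.
  rewrite ge_max => /andP[_ /Hx1]; rewrite -lte_fin -tail_fin FIE.
  by case: (leP 1%E (overshoot nu r)) => // _; rewrite lte_fin ltxx.
have L1 := mean_limit_ge1 zeta_law zeta_seq_indep zeta_ge1 L_finite.
pose L := mean_limit zeta; have Lc : 0 < L / c by rewrite divr_gt0// (lt_le_trans ltr01).
have fpos := ftail_gt0 FI_subexp.
have Hclose : eventually_close (ftail FI) (fine \o H_infty P zeta F c) (L / c).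
  have -> : H_infty P zeta F c = weighted_tail c F (mean_size zeta).
    apply/funext => x; apply: eq_eseriesr => n _.
    by rewrite (mean_sizeE zeta_law zeta_seq_indep zeta_ge1 L_finite).
  apply: (weighted_tail_close nui nuF c0 FI_subexp KsE) => //.
  - exact: (mean_size_ge0 zeta_law zeta_seq_indep zeta_ge1 L_finite).
  - exact: (mean_size_le zeta_law zeta_seq_indep zeta_ge1 L_finite).
  - exact: (mean_size_cvg zeta_law zeta_seq_indep zeta_ge1 L_finite).
split; apply: (tail_equiv_close (f := ftail FI) (A := L / c)) => //.
- move=> e e0.
  have [y1 H1] := sup_tail_lower law xi_indep xi_zeta_indep zeta_law zeta_seq_indep
    zeta_ge1 L_finite FI_subexp nui num c0 Ks0 KsE e0.
  have [y2 H2] := sup_tail_upper law xi_indep xi_zeta_indep zeta_law zeta_seq_indep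
    zeta_ge1 L_finite FI_subexp nui num c0 Ks0 KsE e0.
  exists (Num.max y1 y2) => x; rewrite ge_max => /andP[y1x y2x].
  by split; [exact: H1|exact: H2].
- move=> e e0; exists 0 => x _ /=.
  rewrite (expectation_bp_limit zeta_law zeta_seq_indep zeta_ge1 L_finite).
  rewrite -FI_law tail_fin -!EFinM /=.
  by split; rewrite ler_pM2r//; rewrite /L; lra.
Qed.
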